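(* Let $\phi$ be a Schröder map with Koenigs eigenfunction $\sigma$. Then the composition operator $C_{\phi}$ is complex symmetric on $H^2(\mathbb{D})$ if and only if the Koenigs sequence $(\sigma^n)_{n\in\mathbb{N}}$ is complete and conjugate-orthogonal in $H^2(\mathbb{D})$.
   Context: $\mathbb{D}$ is the open unit disk in $\mathbb{C}$ and $\mathbb{N}=\{0,1,2,\dots\}$. $H^2(\mathbb{D})$ is the Hardy space of analytic functions $f(z)=\sum_{n\ge 0}\widehat f(n)z^n$ on $\mathbb{D}$ with $\sum_n|\widehat f(n)|^2<\infty$, a Hilbert space with inner product $\langle f,g\rangle=\sum_n\widehat f(n)\overline{\widehat g(n)}$. For an analytic self-map $\phi$ of $\mathbb{D}$, the composition operator is $C_\phi f=f\circ\phi$; it is bounded on $H^2(\mathbb{D})$. A Schröder map is an analytic map $\phi:\mathbb{D}\to\mathbb{D}$ that fixes a point $a\in\mathbb{D}$ with $0<|\phi'(a)|<1$. By Koenigs' theorem, the eigenvalues of $C_\phi$ acting on the space $H(\mathbb{D})$ of all analytic functions on $\mathbb{D}$ are $\phi'(a)^n$, $n\in\mathbb{N}$, and all are simple. The Koenigs eigenfunction $\sigma$ of $\phi$ is the eigenfunction (unique up to a nonzero scalar) for the eigenvalue $\phi'(a)$: $\sigma\in H(\mathbb{D})$, $\sigma\not\equiv 0$, $\sigma\circ\phi=\phi'(a)\sigma$. The sequence $(\sigma^n)_{n\in\mathbb{N}}$ (with $\sigma^0=1$) is the Koenigs sequence of $\phi$. A priori $\sigma^n$ need not lie in $H^2(\mathbb{D})$;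 saying that the sequence is complete or conjugate-orthogonal in $H^2(\mathbb{D})$ includes that all $\sigma^n\in H^2(\mathbb{D})$. A conjugation on a Hilbert space $\mathcal{H}$ is a conjugate-linear map $J:\mathcal{H}\to\mathcal{H}$ with $\langle Jf,Jg\rangle=\langle g,f\rangle$ for all $f,g\in\mathcal{H}$ and $J^2=I$. A bounded operator $T$ on $\mathcal{H}$ is complex symmetric if $JT=T^*J$ for some conjugation $J$ on $\mathcal{H}$. A sequence $(f_n)_{n\in\mathbb{N}}$ in $\mathcal{H}$ is conjugate-orthogonal if there is a conjugation $J$ on $\mathcal{H}$ with $\langle Jf_n,f_m\rangle=0$ for all $n\ne m$. It is complete if its linear span is dense in $\mathcal{H}$. *)

(* Defs.v *)
From Stdlib Require Import Reals Lra Psatz FunctionalExtensionality ProofIrrelevance.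
From Coquelicot Require Import Coquelicot.

Open Scope R_scope.

Record disk : Type := Disk { disk_val :> C; disk_lt1 : Cmod disk_val < 1 }.

Definition analytic (f : disk -> C) : Prop :=
  forall c : disk, exists (a : nat -> C) (r : posreal),
    forall z : disk, Cmod (z - c)%C < r ->
      is_pseries (K := C_AbsRing) (V := C_NormedModule) a (z - c)%C (f z).

(* Extension by 0 outside the disk, so that Coquelicot's derivative of
   functions [C -> C] applies; the disk being open, the extension does not
   affect derivatives at its points. *)
Definition extend0 (f : disk -> C) (z : C) : C :=
  match Rlt_dec (Cmod z) 1 with
  | left h => f (Disk z h)
  | right _ => 0
  end.

Definition disk_derive (f : disk -> C) (a : disk) : C := C_derive (extend0 f) a.

Definition schroder_map (phi : disk -> disk) (a : disk) : Prop :=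
  analytic (fun z => phi z) /\
  phi a = a /\
  0 < Cmod (disk_derive (fun z => phi z) a) < 1.

Definition koenigs_eigenfunction
    (phi : disk -> disk) (a : disk) (sigma : disk -> C) : Prop :=
  analytic sigma /\
  (exists z : disk, sigma z <> 0) /\
  (forall z : disk,
     sigma (phi z) = (disk_derive (fun w => phi w) a * sigma z)%C).

(* Abstract notions, for a complex vector space [H] with inner product [ip]
   (linear in the first argument). *)

Definition ip_norm {H : ModuleSpace C_Ring} (ip : H -> H -> C) (f : H) : R :=
  sqrt (Re (ip f f)).

Definition conjugation {H : ModuleSpace C_Ring} (ip : H -> H -> C)
    (J : H -> H) : Prop :=
  (forall f g : H, J (plus f g) = plus (J f) (J g)) /\
  (forall (c : C) (f : H), J (scal c f) = scal (Cconj c) (J f)) /\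
  (forall f g : H, ip (J f) (J g) = ip g f) /\
  (forall f : H, J (J f) = f).

Definition bounded_operator {H : ModuleSpace C_Ring} (ip : H -> H -> C)
    (T : H -> H) : Prop :=
  (forall f g : H, T (plus f g) = plus (T f) (T g)) /\
  (forall (c : C) (f : H), T (scal c f) = scal c (T f)) /\
  (exists M : R, forall f : H, ip_norm ip (T f) <= M * ip_norm ip f).

Definition is_adjoint {H : ModuleSpace C_Ring} (ip : H -> H -> C)
    (T Tstar : H -> H) : Prop :=
  forall f g : H, ip (T f) g = ip f (Tstar g).

Definition complex_symmetric {H : ModuleSpace C_Ring} (ip : H -> H -> C)
    (T : H -> H) : Prop :=
  bounded_operator ip T /\
  exists J Tstar : H -> H,
    conjugation ip J /\ is_adjoint ip T Tstar /\
    forall f : H, J (T f) = Tstar (J f).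

Definition conjugate_orthogonal {H : ModuleSpace C_Ring} (ip : H -> H -> C)
    (s : nat -> H) : Prop :=
  exists J : H -> H, conjugation ip J /\
    forall n m : nat, n <> m -> ip (J (s n)) (s m) = 0.

Definition in_span {H : ModuleSpace C_Ring} (s : nat -> H) (g : H) : Prop :=
  exists (N : nat) (c : nat -> C), g = sum_n (fun n => scal (c n) (s n)) N.

Definition complete_sequence {H : ModuleSpace C_Ring} (ip : H -> H -> C)
    (s : nat -> H) : Prop :=
  forall (f : H) (eps : R), 0 < eps ->
    exists g : H, in_span s g /\ ip_norm ip (minus f g) < eps.

(* The function and its Taylor coefficients at 0 determine each other, so
   equality in [H2] is equality of functions on the disk. *)
Record H2 : Type := mkH2 {
  h2_fun :> disk -> C;
  h2_coef : nat -> C;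
  h2_taylor : forall z : disk,
    is_pseries (K := C_AbsRing) (V := C_NormedModule) h2_coef (z : C) (h2_fun z);
  h2_square_summable : ex_series (fun n => Cmod (h2_coef n) ^ 2)
}.

Lemma H2_ext (f g : H2) : (forall z, f z = g z) ->
  (forall n, h2_coef f n = h2_coef g n) -> f = g.
Proof.
destruct f as [f a Hf Ha], g as [g b Hg Hb]; simpl; intros E1 E2.
apply functional_extensionality in E1, E2; subst.
now rewrite (proof_irrelevance _ Hf Hg), (proof_irrelevance _ Ha Hb).
Qed.

Lemma H2_plus_taylor (f g : H2) (z : disk) :
  is_pseries (K := C_AbsRing) (V := C_NormedModule)
    (fun n => h2_coef f n + h2_coef g n)%C (z : C) (f z + g z)%C.
Proof. exact (is_pseries_plus _ _ _ _ _ (h2_taylor f z) (h2_taylor g z)). Qed.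

Lemma H2_plus_square_summable (f g : H2) :
  ex_series (fun n => Cmod (h2_coef f n + h2_coef g n)%C ^ 2).
Proof.
apply (ex_series_le (K := R_AbsRing) (V := R_CompleteNormedModule) _
  (fun n => 2 * (Cmod (h2_coef f n) ^ 2 + Cmod (h2_coef g n) ^ 2))).
- intros n.
  change (Rabs (Cmod (h2_coef f n + h2_coef g n)%C ^ 2)
    <= 2 * (Cmod (h2_coef f n) ^ 2 + Cmod (h2_coef g n) ^ 2)).
  rewrite Rabs_pos_eq by apply pow2_ge_0.
  pose proof (Cmod_triangle (h2_coef f n) (h2_coef g n)).
  pose proof (Cmod_ge_0 (h2_coef f n + h2_coef g n)%C).
  pose proof (pow2_ge_0 (Cmod (h2_coef f n) - Cmod (h2_coef g n))).
  nra.
- apply (ex_series_scal (K := R_AbsRing) (V := R_NormedModule) 2).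
  exact (ex_series_plus _ _ (h2_square_summable f) (h2_square_summable g)).
Qed.

Lemma H2_scal_taylor (c : C) (f : H2) (z : disk) :
  is_pseries (K := C_AbsRing) (V := C_NormedModule)
    (fun n => c * h2_coef f n)%C (z : C) (c * f z)%C.
Proof.
apply (is_pseries_scal (K := C_AbsRing) (V := C_NormedModule) c).
- exact (Cmult_comm z c).
- exact (h2_taylor f z).
Qed.

Lemma H2_scal_square_summable (c : C) (f : H2) :
  ex_series (fun n => Cmod (c * h2_coef f n)%C ^ 2).
Proof.
apply (ex_series_ext (fun n => Cmod c ^ 2 * Cmod (h2_coef f n) ^ 2)).
- intros n; rewrite Cmod_mult; symmetry; apply Rpow_mult_distr.
- exact (ex_series_scal (K := R_AbsRing) (V := R_NormedModule) _ _
    (h2_square_summable f)).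
Qed.

Lemma H2_zero_taylor (z : disk) :
  is_pseries (K := C_AbsRing) (V := C_NormedModule) (fun _ => RtoC 0) (z : C) (RtoC 0).
Proof.
apply (filterlim_ext (fun _ => RtoC 0)).
- intros n; induction n as [|n IH].
  + rewrite sum_O; symmetry; apply (Cmult_0_r _).
  + rewrite sum_Sn, <- IH; symmetry.
    change (0 + pow_n (K := C_Ring) (z : C) (S n) * 0 = 0)%C; ring.
- apply filterlim_const.
Qed.

Lemma H2_zero_square_summable : ex_series (fun _ : nat => Cmod 0 ^ 2).
Proof.
exists 0; apply (filterlim_ext (fun _ => 0)).
- intros n; rewrite sum_n_const, Cmod_0; ring.
- apply filterlim_const.
Qed.

Definition H2_plus (f g : H2) : H2 :=
  mkH2 _ _ (H2_plus_taylor f g) (H2_plus_square_summable f g).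
Definition H2_scal (c : C) (f : H2) : H2 :=
  mkH2 _ _ (H2_scal_taylor c f) (H2_scal_square_summable c f).
Definition H2_zero : H2 := mkH2 _ _ H2_zero_taylor H2_zero_square_summable.
Definition H2_opp (f : H2) : H2 := H2_scal (- (1))%C f.

Ltac H2_tac := intros; apply H2_ext; intros; simpl; try ring.

Lemma H2_plus_comm f g : H2_plus f g = H2_plus g f.
Proof. H2_tac. Qed.
Lemma H2_plus_assoc f g h : H2_plus f (H2_plus g h) = H2_plus (H2_plus f g) h.
Proof. H2_tac. Qed.
Lemma H2_plus_zero f : H2_plus f H2_zero = f.
Proof. H2_tac. Qed.
Lemma H2_plus_opp f : H2_plus f (H2_opp f) = H2_zero.
Proof. H2_tac. Qed.
Lemma H2_scal_scal (c d : C) f : H2_scal c (H2_scal d f) = H2_scal (c * d)%C f.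
Proof. H2_tac. Qed.
Lemma H2_scal_one f : H2_scal 1 f = f.
Proof. H2_tac. Qed.
Lemma H2_scal_plus (c : C) f g :
  H2_scal c (H2_plus f g) = H2_plus (H2_scal c f) (H2_scal c g).
Proof. H2_tac. Qed.
Lemma H2_plus_scal (c d : C) f :
  H2_scal (c + d)%C f = H2_plus (H2_scal c f) (H2_scal d f).
Proof. H2_tac. Qed.

Definition H2_AbelianMonoid_mixin :=
  AbelianMonoid.Mixin H2 H2_plus H2_zero
    H2_plus_comm H2_plus_assoc H2_plus_zero.
Canonical H2_AbelianMonoid :=
  AbelianMonoid.Pack H2 H2_AbelianMonoid_mixin H2.

Definition H2_AbelianGroup_mixin :=
  AbelianGroup.Mixin H2_AbelianMonoid H2_opp H2_plus_opp.
Canonical H2_AbelianGroup :=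
  AbelianGroup.Pack H2
    (AbelianGroup.Class H2 H2_AbelianMonoid_mixin H2_AbelianGroup_mixin) H2.

Definition H2_ModuleSpace_mixin :=
  ModuleSpace.Mixin C_Ring H2_AbelianGroup H2_scal
    H2_scal_scal H2_scal_one H2_scal_plus H2_plus_scal.
Canonical H2_ModuleSpace : ModuleSpace C_Ring :=
  ModuleSpace.Pack C_Ring H2
    (ModuleSpace.Class C_Ring H2
       (AbelianGroup.Class H2 H2_AbelianMonoid_mixin H2_AbelianGroup_mixin)
       H2_ModuleSpace_mixin) H2.

(* [Series] is real-valued, so the complex sum is taken componentwise; it
   converges by [H2_inner_is_series]. *)
Definition H2_inner (f g : H2) : C :=
  (Series (fun n => Re (h2_coef f n * Cconj (h2_coef g n))%C),
   Series (fun n => Im (h2_coef f n * Cconj (h2_coef g n))%C)).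

Lemma H2_inner_is_series (f g : H2) :
  is_series (K := C_AbsRing) (V := C_NormedModule)
    (fun n => h2_coef f n * Cconj (h2_coef g n))%C (H2_inner f g).
Proof.
assert (E : ex_series (K := C_AbsRing) (V := C_NormedModule)
  (fun n => h2_coef f n * Cconj (h2_coef g n))%C).
{ apply (ex_series_le (K := C_AbsRing) (V := C_CompleteNormedModule) _
    (fun n => Cmod (h2_coef f n) ^ 2 + Cmod (h2_coef g n) ^ 2)).
  - intros n; change (Cmod (h2_coef f n * Cconj (h2_coef g n)) <=
      Cmod (h2_coef f n) ^ 2 + Cmod (h2_coef g n) ^ 2).
    rewrite Cmod_mult, Cmod_conj.
    pose proof (Cmod_ge_0 (h2_coef f n)).
    pose proof (Cmod_ge_0 (h2_coef g n)).
    nra.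
  - exact (ex_series_plus _ _ (h2_square_summable f) (h2_square_summable g)). }
destruct E as [l Hl].
enough (H2_inner f g = l) as -> by exact Hl.
assert (S1 : forall (u : nat -> C) n, fst (sum_n u n : C) = sum_n (fun k => Re (u k)) n).
{ intros u n; induction n as [|n IH]; [now rewrite !sum_O|].
  rewrite !sum_Sn, <- IH; reflexivity. }
assert (S2 : forall (u : nat -> C) n, snd (sum_n u n : C) = sum_n (fun k => Im (u k)) n).
{ intros u n; induction n as [|n IH]; [now rewrite !sum_O|].
  rewrite !sum_Sn, <- IH; reflexivity. }
unfold H2_inner; rewrite (surjective_pairing l); f_equal; apply is_series_unique.
- apply filterlim_locally; intros eps.
  generalize (proj1 (filterlim_locally _ _) Hl eps); apply filter_imp.
  intros n [B _]; rewrite <- S1; exact B.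
- apply filterlim_locally; intros eps.
  generalize (proj1 (filterlim_locally _ _) Hl eps); apply filter_imp.
  intros n [_ B]; rewrite <- S2; exact B.
Qed.

(* [T] is the operator [f |-> f o phi], everywhere defined on the Hardy space. *)
Definition is_composition_operator (phi : disk -> disk) (T : H2 -> H2) : Prop :=
  forall (f : H2) (z : disk), T f z = f (phi z).

(* In particular, all powers of [sigma] belong to the Hardy space. *)
Definition is_koenigs_sequence (sigma : disk -> C) (s : nat -> H2) : Prop :=
  forall (n : nat) (z : disk), s n z = (sigma z ^ n)%C.

(* Main.v *)
Require Import Defs.
From Stdlib Require Import Reals Lra Lia Psatz Classical ClassicalEpsilon List.
From Stdlib Require Import FunctionalExtensionality ProofIrrelevance.
From Coquelicot Require Import Coquelicot.
Import ListNotations.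

(** Let [la] be the derivative of [phi] at its fixed point [a].

From complex symmetry to the Koenigs sequence. Functions vanishing to order
[n] at [a] are invariant under composition with [phi], which multiplies
their [n]-th Taylor coefficient at [a] by [la ^ n]. Hence the elements [K_n]
of the Hardy space that represent the Taylor coefficients at [a] satisfy
[T^* K_n = conj (la ^ n) K_n + (a combination of the earlier K_j)]
([composition_triangular]). The conjugation [J] turns [T^*] into [T], so the
[u_n = J K_n] satisfy
[u_n (phi z) = la ^ n u_n z + (a combination of the earlier u_j z)]
([conjugate_kernels_triangular]). The powers of [la] being distinct, this
triangular system can be diagonalised: adding to [u_n] a combination of
earlier eigenfunctions gives an eigenfunction of composition for [la ^ n],
which Koenigs' theorem ([koenigs_simple]) identifies as a multiple of
[sigma ^ n]. The multiple is not zero, because its inner product with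
[J ((z - a) ^ n)] is 1. So all powers of [sigma] lie in the Hardy space
([koenigs_power_in_H2]) and span the same subspaces as the [u_n]. Since [J] is
isometric and a function orthogonal to every [K_n] has a vanishing Taylor
series at [a], that span is dense; orthogonality of [J sigma ^ n] and
[sigma ^ m] is that of eigenvectors of [T^*] and [T] for different
eigenvalues.

From the Koenigs sequence to complex symmetry. The identity [J T = T^* J]
says that the bilinear form [(f, g) |-> <T f, J g>] is symmetric. On the
powers of [sigma] this is the assumed orthogonality, and completeness
propagates it to all [f] and [g], as soon as [T] is known to be everywhere
defined and bounded. That [f o phi] has a Taylor series converging on the
whole disk follows from completeness itself ([composition_pser]): if
combinations of the [sigma ^ n] approximate [f] in norm, the combinations
with coefficients multiplied by [la ^ n] approximate [f o phi] locally
uniformly. The norm bound is Littlewood's subordination principle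
([littlewood]): for a polynomial [f], the harmonic function [u] with boundary
values [|f| ^ 2] on the unit circle dominates [|f| ^ 2], so the mean of
[|f o phi| ^ 2] over a circle about 0 is at most the mean of [u o phi], which
is [u (phi 0)].

Means over circles are taken as averages over the [N]-th roots of unity,
which are exact for Taylor polynomials of degree below [N]. The changes of
centre of power series and their products both rest on one theorem about
triangular double series, [fubini_triangular]. *)

(** * Finite sums, limits and series of complex numbers *)

(** Sums run over [k < n], so that the empty sum is available. *)
Fixpoint csum (u : nat -> C) (n : nat) : C :=
  match n with O => 0 | S m => (csum u m + u m)%C end.

Fixpoint rsum (u : nat -> R) (n : nat) : R :=
  match n with O => 0 | S m => rsum u m + u m end.

Definition cvto (u : nat -> C) (l : C) : Prop :=
  forall eps, 0 < eps -> exists N, forall n, (N <= n)%nat -> Cmod (u n - l) < eps.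

Definition csums (u : nat -> C) (l : C) : Prop := cvto (csum u) l.

Lemma csum_ext_lt u v n : (forall k, (k < n)%nat -> u k = v k) -> csum u n = csum v n.
Proof.
induction n as [|n IH]; intros H; simpl; [easy|].
rewrite IH by (intros; apply H; lia); rewrite H by lia; easy.
Qed.

Lemma csum_ext u v n : (forall k, u k = v k) -> csum u n = csum v n.
Proof. intros H; apply csum_ext_lt; auto. Qed.

Lemma rsum_ext_lt u v n : (forall k, (k < n)%nat -> u k = v k) -> rsum u n = rsum v n.
Proof.
induction n as [|n IH]; intros H; simpl; [easy|].
rewrite IH by (intros; apply H; lia); rewrite H by lia; easy.
Qed.

Lemma rsum_le u v n : (forall k, (k < n)%nat -> u k <= v k) -> rsum u n <= rsum v n.
Proof.
induction n as [|n IH]; intros H; simpl; [lra|].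
specialize (H n ltac:(lia)) as H1. assert (rsum u n <= rsum v n) by (apply IH; intros; apply H; lia). lra.
Qed.

Lemma rsum_scal c u n : rsum (fun k => c * u k) n = c * rsum u n.
Proof. induction n as [|n IH]; simpl; [|rewrite IH]; ring. Qed.

Lemma rsum_plus u v n : rsum (fun k => u k + v k) n = rsum u n + rsum v n.
Proof. induction n as [|n IH]; simpl; [|rewrite IH]; ring. Qed.

Lemma rsum_const c n : rsum (fun _ => c) n = INR n * c.
Proof. induction n as [|n IH]; [simpl; ring|]. rewrite S_INR; simpl rsum; rewrite IH; ring. Qed.

Lemma rsum_pos u n : (forall k, 0 <= u k) -> 0 <= rsum u n.
Proof. intros H; induction n as [|n IH]; simpl; [lra|]; specialize (H n); lra. Qed.

Lemma rsum_mono u n m : (forall k, 0 <= u k) -> (n <= m)%nat -> rsum u n <= rsum u m.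
Proof. intros H; induction 1 as [|m L IH]; [lra|]. simpl; specialize (H m); lra. Qed.

Lemma csum_plus u v n : csum (fun k => u k + v k)%C n = (csum u n + csum v n)%C.
Proof. induction n as [|n IH]; simpl; [|rewrite IH]; ring. Qed.

Lemma csum_minus u v n : csum (fun k => u k - v k)%C n = (csum u n - csum v n)%C.
Proof. induction n as [|n IH]; simpl; [|rewrite IH]; ring. Qed.

Lemma csum_scal c u n : csum (fun k => c * u k)%C n = (c * csum u n)%C.
Proof. induction n as [|n IH]; simpl; [|rewrite IH]; ring. Qed.

Lemma csum_zero (u : nat -> C) n : (forall k, (k < n)%nat -> u k = 0) -> csum u n = 0.
Proof.
induction n as [|n IH]; intros H; simpl; [easy|].
rewrite IH by (intros; apply H; lia); rewrite H by lia; ring.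
Qed.

Lemma csum_first u n : csum u (S n) = (u O + csum (fun k => u (S k)) n)%C.
Proof. induction n as [|n IH]; [simpl; ring|]. change (csum u (S (S n))) with (csum u (S n) + u (S n))%C. rewrite IH; simpl; ring. Qed.

Lemma rsum_first u n : rsum u (S n) = u O + rsum (fun k => u (S k)) n.
Proof. induction n as [|n IH]; [simpl; ring|]. change (rsum u (S (S n))) with (rsum u (S n) + u (S n)). rewrite IH; simpl; ring. Qed.

Lemma csum_switch (u : nat -> nat -> C) n m :
  csum (fun i => csum (u i) m) n = csum (fun j => csum (fun i => u i j) n) m.
Proof.
induction n as [|n IH]; simpl.
- symmetry; apply csum_zero; easy.
- rewrite IH, <- csum_plus; easy.
Qed.

Lemma csum_conj u n : Cconj (csum u n) = csum (fun k => Cconj (u k)) n.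
Proof.
induction n as [|n IH]; simpl; [|rewrite Cplus_conj, IH; easy].
unfold Cconj; simpl; now rewrite Ropp_0.
Qed.

Lemma Cmod_csum u n : Cmod (csum u n) <= rsum (fun k => Cmod (u k)) n.
Proof.
induction n as [|n IH]; simpl; [rewrite Cmod_0; lra|].
pose proof (Cmod_triangle (csum u n) (u n)); lra.
Qed.

Lemma Cmod_sub_sym x y : Cmod (x - y) = Cmod (y - x).
Proof. rewrite <- Cmod_opp; f_equal; ring. Qed.

Lemma Cmod_sub_triangle x y z : Cmod (x - z) <= Cmod (x - y) + Cmod (y - z).
Proof. replace (x - z)%C with ((x - y) + (y - z))%C by ring; apply Cmod_triangle. Qed.

Lemma Cmod_le_diff x y : Cmod x <= Cmod y + Cmod (x - y).
Proof. replace x with (y + (x - y))%C at 1 by ring; apply Cmod_triangle. Qed.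

Lemma Cmod_sub_le x y : Cmod (x - y) <= Cmod x + Cmod y.
Proof. unfold Cminus; rewrite <- (Cmod_opp y); apply Cmod_triangle. Qed.

Lemma Cmod_csum_tail u n m : (n <= m)%nat ->
  Cmod (csum u m - csum u n) <= rsum (fun k => Cmod (u k)) m - rsum (fun k => Cmod (u k)) n.
Proof.
induction 1 as [|m L IH].
- replace (csum u n - csum u n)%C with (RtoC 0) by ring; rewrite Cmod_0; lra.
- simpl. replace (csum u m + u m - csum u n)%C with ((csum u m - csum u n) + u m)%C by ring.
  pose proof (Cmod_triangle (csum u m - csum u n) (u m)); lra.
Qed.

Lemma cvto_ext u v l : (forall n, u n = v n) -> cvto u l -> cvto v l.
Proof.
intros E H eps He; destruct (H eps He) as [N HN]; exists N; intros; rewrite <- E; auto.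
Qed.

Lemma cvto_const c : cvto (fun _ => c) c.
Proof. intros eps He; exists O; intros; replace (c - c)%C with (RtoC 0) by ring; rewrite Cmod_0; lra. Qed.

Lemma cvto_plus u v l m : cvto u l -> cvto v m -> cvto (fun n => u n + v n)%C (l + m)%C.
Proof.
intros H1 H2 eps He.
destruct (H1 (eps/2) ltac:(lra)) as [N1 HN1]; destruct (H2 (eps/2) ltac:(lra)) as [N2 HN2].
exists (N1 + N2)%nat; intros n Hn.
specialize (HN1 n ltac:(lia)); specialize (HN2 n ltac:(lia)).
replace (u n + v n - (l + m))%C with ((u n - l) + (v n - m))%C by ring.
pose proof (Cmod_triangle (u n - l) (v n - m)); lra.
Qed.

Lemma cvto_scal c u l : cvto u l -> cvto (fun n => c * u n)%C (c * l)%C.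
Proof.
intros H eps He. pose proof (Cmod_ge_0 c).
destruct (H (eps / (Cmod c + 1))) as [N HN]; [apply Rdiv_lt_0_compat; lra|].
exists N; intros n Hn; specialize (HN n Hn).
replace (c * u n - c * l)%C with (c * (u n - l))%C by ring; rewrite Cmod_mult.
apply Rle_lt_trans with (Cmod c * (eps / (Cmod c + 1))).
- apply Rmult_le_compat_l; lra.
- apply Rlt_le_trans with ((Cmod c + 1) * (eps / (Cmod c + 1))).
  + apply Rmult_lt_compat_r; [apply Rdiv_lt_0_compat; lra|lra].
  + right; field; lra.
Qed.

Lemma cvto_minus u v l m : cvto u l -> cvto v m -> cvto (fun n => u n - v n)%C (l - m)%C.
Proof.
intros H1 H2; replace (l - m)%C with (l + (-(1)) * m)%C by ring.
apply (cvto_ext (fun n => u n + (-(1)) * v n)%C); [intros; ring|].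
apply cvto_plus; [easy|now apply cvto_scal].
Qed.

Lemma cvto_conj u l : cvto u l -> cvto (fun n => Cconj (u n)) (Cconj l).
Proof.
intros H eps He; destruct (H eps He) as [N HN]; exists N; intros n Hn.
rewrite <- Cminus_conj, Cmod_conj; auto.
Qed.

Lemma cvto_unique u l m : cvto u l -> cvto u m -> l = m.
Proof.
intros H1 H2. apply Ceq_minus, Cmod_eq_0.
destruct (Req_dec (Cmod (l - m)) 0) as [E|E]; [easy|exfalso].
pose proof (Cmod_ge_0 (l - m)).
destruct (H1 (Cmod (l-m)/2) ltac:(lra)) as [N1 HN1]; destruct (H2 (Cmod (l-m)/2) ltac:(lra)) as [N2 HN2].
specialize (HN1 (N1+N2)%nat ltac:(lia)); specialize (HN2 (N1+N2)%nat ltac:(lia)).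
rewrite Cmod_sub_sym in HN1.
pose proof (Cmod_sub_triangle l (u (N1+N2)%nat) m); lra.
Qed.

(** Closed balls are closed. *)
Lemma cvto_le u l c B : (exists N, forall n, (N <= n)%nat -> Cmod (u n - c) <= B) ->
  cvto u l -> Cmod (l - c) <= B.
Proof.
intros [N0 HB] H; apply Rnot_lt_le; intros L.
destruct (H (Cmod (l - c) - B) ltac:(lra)) as [N HN].
specialize (HN (N0+N)%nat ltac:(lia)); specialize (HB (N0+N)%nat ltac:(lia)).
rewrite Cmod_sub_sym in HN. pose proof (Cmod_sub_triangle l (u (N0+N)%nat) c); lra.
Qed.

Lemma cvto_csum (u : nat -> nat -> C) (c : nat -> C) N :
  (forall n, cvto (u n) (c n)) -> cvto (fun M => csum (fun n => u n M) N) (csum c N).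
Proof.
intros H; induction N as [|N IH]; simpl; [apply cvto_const|].
now apply cvto_plus.
Qed.

Lemma Cmod_le_Re_Im z : Cmod z <= Rabs (Re z) + Rabs (Im z).
Proof.
pose proof (Cmod2_alt z). pose proof (Cmod_ge_0 z).
pose proof (Rabs_pos (Re z)); pose proof (Rabs_pos (Im z)).
apply Rnot_lt_le; intros L.
rewrite <- (pow2_abs (Re z)), <- (pow2_abs (Im z)) in H; nra.
Qed.

Lemma Re_le_Cmod z : Re z <= Cmod z.
Proof. pose proof (re_le_Cmod z); pose proof (Rle_abs (Re z)); lra. Qed.

Lemma Im_le_Cmod z : Rabs (Im z) <= Cmod z.
Proof. pose proof (Rmax_Cmod z) as H; apply Rle_trans with (2 := H); apply Rmax_r. Qed.

(** The real and imaginary parts are Cauchy sequences of reals. *)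
Lemma cvto_cauchy u :
  (forall eps, 0 < eps -> exists N, forall n, (N <= n)%nat -> Cmod (u n - u N) < eps) ->
  exists l, cvto u l.
Proof.
intros H.
assert (K : forall p : C -> R, (forall x y, p (x - y)%C = p x - p y) -> (forall x, Rabs (p x) <= Cmod x) ->
  exists l, Un_cv (fun n => p (u n)) l).
{ intros p Hp1 Hp2. destruct (Rcomplete.R_complete (fun n => p (u n))) as [l Hl]; [|now exists l].
  intros eps He; destruct (H (eps/2) ltac:(lra)) as [N HN]; exists N; intros n m Hn Hm.
  unfold Rdist; rewrite <- Hp1. apply Rle_lt_trans with (1 := Hp2 _).
  pose proof (HN n Hn); pose proof (HN m Hm) as Q; rewrite Cmod_sub_sym in Q.
  pose proof (Cmod_sub_triangle (u n) (u N) (u m)); lra. }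
destruct (K Re) as [a Ha]; [easy|apply re_le_Cmod|].
destruct (K Im) as [b Hb]; [easy|apply Im_le_Cmod|].
exists (a, b); intros eps He.
destruct (Ha (eps/2) ltac:(lra)) as [N1 HN1]; destruct (Hb (eps/2) ltac:(lra)) as [N2 HN2].
exists (N1 + N2)%nat; intros n Hn.
specialize (HN1 n ltac:(lia)); specialize (HN2 n ltac:(lia)); unfold Rdist in *.
pose proof (Cmod_le_Re_Im (u n - (a, b))) as Q; simpl in Q.
unfold Rminus in *; unfold Re, Im in *; lra.
Qed.

(** The partial sums come within [eps] of their supremum. *)
Lemma rsum_tail v B : (forall n, rsum v n <= B) ->
  forall eps, 0 < eps -> exists N, forall n, rsum v n <= rsum v N + eps.
Proof.
intros HB eps He.
destruct (completeness (fun x => exists n, x = rsum v n)) as [V [HV1 HV2]].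
- exists B; intros x [n ->]; auto.
- exists 0; exists O; easy.
- destruct (classic (exists N, V - eps < rsum v N)) as [[N HN]|HN].
  + exists N; intros n; specialize (HV1 (rsum v n) ltac:(now exists n)); lra.
  + exfalso. assert (V <= V - eps); [|lra]. apply HV2; intros x [n ->].
    apply Rnot_lt_le; intros L; apply HN; now exists n.
Qed.

Lemma csums_dominated u v B : (forall n, Cmod (u n) <= v n) -> (forall n, rsum v n <= B) ->
  exists l, csums u l.
Proof.
intros H HB; apply cvto_cauchy; intros eps He.
destruct (rsum_tail v B HB (eps/2) ltac:(lra)) as [N HN]; exists N; intros n Hn.
apply Rle_lt_trans with (rsum v n - rsum v N); [|specialize (HN n); lra].
clear HN; induction Hn as [|m L IH].
- replace (csum u N - csum u N)%C with (RtoC 0) by ring; rewrite Cmod_0; lra.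
- simpl. replace (csum u m + u m - csum u N)%C with ((csum u m - csum u N) + u m)%C by ring.
  pose proof (Cmod_triangle (csum u m - csum u N) (u m)); specialize (H m); lra.
Qed.

Lemma csums_tail_le u l N B :
  csums u l -> (forall n, (N <= n)%nat -> rsum (fun k => Cmod (u k)) n - rsum (fun k => Cmod (u k)) N <= B) ->
  Cmod (l - csum u N) <= B.
Proof.
intros H HB; apply (cvto_le (csum u)); [|easy].
exists N; intros n Hn; apply Rle_trans with (1 := Cmod_csum_tail u N n Hn); auto.
Qed.

Lemma csums_le u l B : csums u l -> (forall n, rsum (fun k => Cmod (u k)) n <= B) -> Cmod l <= B.
Proof.
intros H HB; replace l with (l - csum u 0)%C by (simpl; ring).
apply (csums_tail_le u l 0 B H); intros n _; simpl; specialize (HB n); lra.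
Qed.

Lemma csums_ext u v l : (forall n, u n = v n) -> csums u l -> csums v l.
Proof. intros H; apply cvto_ext; intros; now apply csum_ext. Qed.

Lemma csums_plus u v l m : csums u l -> csums v m -> csums (fun k => u k + v k)%C (l + m)%C.
Proof.
intros H1 H2; apply (cvto_ext (fun n => csum u n + csum v n)%C).
- intros; now rewrite csum_plus.
- now apply cvto_plus.
Qed.

Lemma csums_minus u v l m : csums u l -> csums v m -> csums (fun k => u k - v k)%C (l - m)%C.
Proof.
intros H1 H2; apply (cvto_ext (fun n => csum u n - csum v n)%C).
- intros; now rewrite csum_minus.
- now apply cvto_minus.
Qed.

Lemma csums_scal c u l : csums u l -> csums (fun k => c * u k)%C (c * l)%C.
Proof.
intros H1; apply (cvto_ext (fun n => c * csum u n)%C).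
- intros; now rewrite csum_scal.
- now apply cvto_scal.
Qed.

Lemma csums_conj u l : csums u l -> csums (fun k => Cconj (u k)) (Cconj l).
Proof.
intros H1; apply (cvto_ext (fun n => Cconj (csum u n))).
- intros; now rewrite csum_conj.
- now apply cvto_conj.
Qed.

Lemma csums_finite (u : nat -> C) N : (forall n, (N <= n)%nat -> u n = 0) -> csums u (csum u N).
Proof.
intros H eps He; exists N; intros n Hn.
replace (csum u n) with (csum u N).
- replace (csum u N - csum u N)%C with (RtoC 0) by ring; rewrite Cmod_0; lra.
- induction Hn as [|m L IH]; [easy|]. simpl; rewrite H by easy; rewrite <- IH; ring.
Qed.

Lemma csums_term u l : csums u l -> exists M, 0 <= M /\ forall n, Cmod (u n) <= M.
Proof.
intros H. destruct (H 1 ltac:(lra)) as [N HN].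
pose proof (rsum_pos (fun k => Cmod (u k)) N ltac:(intros; apply Cmod_ge_0)) as P.
exists (rsum (fun k => Cmod (u k)) N + 2); split; [lra|].
intros n. destruct (Nat.le_gt_cases N n) as [L|L].
- pose proof (HN n L) as A1; pose proof (HN (S n) ltac:(lia)) as A2; simpl in A2.
  rewrite Cmod_sub_sym in A1.
  replace (u n) with ((csum u n + u n - l) + (l - csum u n))%C by ring.
  pose proof (Cmod_triangle (csum u n + u n - l) (l - csum u n)); lra.
- pose proof (rsum_mono (fun k => Cmod (u k)) (S n) N ltac:(intros; apply Cmod_ge_0) ltac:(lia)).
  simpl in H0. pose proof (rsum_pos (fun k => Cmod (u k)) n ltac:(intros; apply Cmod_ge_0)); lra.
Qed.

(** The difference between the sum of the first [N] columns and that of the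
    first [N] rows only involves terms of rows beyond [N], and these are small
    because the absolute values of all entries have a finite sum. *)
Lemma fubini_triangular (u : nat -> nat -> C) (c : nat -> C) (L : C) (B : R) :
  (forall m n, (m < n)%nat -> u m n = 0) ->
  (forall M, rsum (fun m => rsum (fun n => Cmod (u m n)) (S m)) M <= B) ->
  (forall n, csums (fun m => u m n) (c n)) ->
  csums (fun m => csum (u m) (S m)) L ->
  csums c L.
Proof.
intros Hz HB Hc HL.
set (rr := fun m => rsum (fun n => Cmod (u m n)) (S m)) in *.
set (row := fun m => csum (u m) (S m)).
assert (Hrow : forall m N, (m < N)%nat -> csum (u m) N = row m).
{ intros m N H; induction H as [|N H IH]; [easy|]. simpl; rewrite IH, Hz by lia; ring. }
assert (Hrr : forall m N, rsum (fun n => Cmod (u m n)) N <= rr m).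
{ intros m N; destruct (Nat.le_gt_cases N (S m)) as [H|H].
  - apply rsum_mono; [intros; apply Cmod_ge_0|easy].
  - right; induction H as [|N H IH]; simpl.
    + unfold rr; simpl; rewrite (Hz m (S m)) by lia; rewrite Cmod_0; ring.
    + rewrite IH, Hz by lia; rewrite Cmod_0; ring. }
assert (D : forall N M, (N <= M)%nat ->
  Cmod (csum (fun n => csum (fun m => u m n) M) N - csum row N) <= rsum rr M - rsum rr N).
{ intros N M H. rewrite <- csum_switch. induction H as [|M H IH].
  - rewrite (csum_ext_lt (fun i => csum (u i) N) row) by (intros; now apply Hrow).
    replace (csum row N - csum row N)%C with (RtoC 0) by ring; rewrite Cmod_0; lra.
  - simpl. set (X := csum _ M) in *.
    replace (X + csum (u M) N - csum row N)%C with ((X - csum row N) + csum (u M) N)%C by ring.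
    pose proof (Cmod_triangle (X - csum row N) (csum (u M) N)).
    pose proof (Cmod_csum (u M) N). pose proof (Hrr M N). lra. }
intros eps He.
destruct (rsum_tail rr B HB (eps/3) ltac:(lra)) as [N1 HN1].
destruct (HL (eps/3) ltac:(lra)) as [N2 HN2].
exists (N1 + N2)%nat; intros N HN. specialize (HN2 N ltac:(lia)).
assert (Q : Cmod (csum c N - csum row N) <= eps/3).
{ apply (cvto_le (fun M => csum (fun n => csum (fun m => u m n) M) N)).
  - exists N; intros M HM. apply Rle_trans with (1 := D N M HM).
    pose proof (HN1 M). assert (rsum rr N1 <= rsum rr N); [|lra].
    apply rsum_mono; [|lia]. intros k; apply rsum_pos; intros; apply Cmod_ge_0.
  - apply cvto_csum; exact Hc. }
pose proof (Cmod_sub_triangle (csum c N) (csum row N) L). fold row in HN2. lra.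
Qed.

Lemma Cconj_RtoC (r : R) : Cconj (RtoC r) = RtoC r.
Proof. unfold Cconj, RtoC; simpl; now rewrite Ropp_0. Qed.

Lemma cvto_mult u v l m : cvto u l -> cvto v m -> cvto (fun n => u n * v n)%C (l * m)%C.
Proof.
intros Hu Hv.
apply (cvto_ext (fun n => ((u n - l) * (v n - m) + m * u n) + l * v n - l * m)%C); [intros; ring|].
replace (l * m)%C with ((0 + m * l) + l * m - l * m)%C at 1 by ring.
apply cvto_minus; [|apply cvto_const]. apply cvto_plus; [|now apply cvto_scal].
apply cvto_plus; [|now apply cvto_scal].
intros eps He.
destruct (Hu (Rmin 1 eps) ltac:(apply Rmin_glb_lt; lra)) as [N1 H1]; destruct (Hv 1 ltac:(lra)) as [N2 H2].
exists (N1 + N2)%nat; intros n Hn. specialize (H1 n ltac:(lia)); specialize (H2 n ltac:(lia)).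
replace ((u n - l) * (v n - m) - 0)%C with ((u n - l) * (v n - m))%C by ring. rewrite Cmod_mult.
pose proof (Rmin_r 1 eps). pose proof (Cmod_ge_0 (u n - l)); pose proof (Cmod_ge_0 (v n - m)). nra.
Qed.

Lemma csum_RtoC u n : csum (fun k => RtoC (u k)) n = RtoC (rsum u n).
Proof. induction n as [|n IH]; simpl; [easy|]. now rewrite IH, RtoC_plus. Qed.

Lemma cvto_Re_le u l B : (exists N, forall n, (N <= n)%nat -> Re (u n) <= B) -> cvto u l -> Re l <= B.
Proof.
intros [N HN] H. apply Rnot_lt_le; intros L. destruct (H (Re l - B) ltac:(lra)) as [M HM].
specialize (HN (N + M)%nat ltac:(lia)); specialize (HM (N + M)%nat ltac:(lia)).
pose proof (re_le_Cmod (u (N + M)%nat - l)) as Q. pose proof (Rle_abs (- Re (u (N+M)%nat - l))) as Q2.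
rewrite Rabs_Ropp in Q2. change (Re (u (N+M)%nat - l)) with (Re (u (N+M)%nat) - Re l) in *. lra.
Qed.

Lemma sq_conj z : RtoC (Cmod z ^ 2) = (z * Cconj z)%C.
Proof. exact (Cmod2_conj z). Qed.

(** Fatou's lemma for finitely many coefficients. *)
Lemma rsum_sq_limit (u : nat -> nat -> C) (a c : nat -> C) J B :
  (forall j, cvto (fun n => u n j) (a j)) ->
  (exists N, forall n, (N <= n)%nat -> rsum (fun j => Cmod (u n j - c j) ^ 2) J <= B) ->
  rsum (fun j => Cmod (a j - c j) ^ 2) J <= B.
Proof.
intros Hu [N HN].
assert (K : cvto (fun n => csum (fun j => RtoC (Cmod (u n j - c j) ^ 2)) J)
              (csum (fun j => RtoC (Cmod (a j - c j) ^ 2)) J)).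
{ apply (cvto_csum (fun j n => RtoC (Cmod (u n j - c j) ^ 2))). intros j; rewrite sq_conj.
  apply (cvto_ext (fun n => (u n j - c j) * Cconj (u n j - c j))%C); [intros n; now rewrite sq_conj|].
  assert (cvto (fun n => u n j - c j)%C (a j - c j)) by (apply cvto_minus; [apply Hu|apply cvto_const]).
  apply cvto_mult; [easy|]. now apply cvto_conj. }
rewrite csum_RtoC in K. rewrite <- (re_RtoC (rsum _ _)).
apply (cvto_Re_le _ _ B) in K; [exact K|].
exists N; intros n Hn. rewrite csum_RtoC, re_RtoC; auto.
Qed.

Lemma rsum_le_limit u l : (forall k, 0 <= u k) -> csums (fun k => RtoC (u k)) (RtoC l) -> forall n, rsum u n <= l.
Proof.
intros Hu H n. apply Rnot_lt_le; intros L. destruct (H (rsum u n - l) ltac:(lra)) as [N HN].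
specialize (HN (N + n)%nat ltac:(lia)). rewrite csum_RtoC, <- RtoC_minus, Cmod_R in HN.
pose proof (rsum_mono u n (N + n) Hu ltac:(lia)). pose proof (Rle_abs (rsum u (N + n) - l)). lra.
Qed.

Lemma sq_le_sq x y : 0 <= y -> x ^ 2 <= y ^ 2 -> x <= y.
Proof. intros; nra. Qed.

Lemma rsum_sum_n u n : sum_n (G := R_AbelianMonoid) u n = rsum u (S n).
Proof.
induction n as [|n IH]; [rewrite sum_O; symmetry; exact (Rplus_0_l _)|]. rewrite sum_Sn, IH; reflexivity.
Qed.

Lemma ex_series_bounded u B : (forall k, 0 <= u k) -> (forall n, rsum u n <= B) -> ex_series u.
Proof.
intros Hu HB. destruct (ex_finite_lim_seq_incr (sum_n u) B) as [l Hl].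
- intros n; rewrite !rsum_sum_n; simpl; specialize (Hu (S n)); lra.
- intros n; rewrite rsum_sum_n; auto.
- now exists l.
Qed.

(** With [A' = A + e] and [B' = B + e], which unlike [A] and [B] cannot vanish,
    sum the inequalities [2 x y <= (B' / A') x ^ 2 + (A' / B') y ^ 2] and let [e]
    tend to 0. *)
Lemma rsum_cauchy_schwarz x y n A B : 0 <= A -> 0 <= B ->
  rsum (fun k => x k ^ 2) n <= A ^ 2 -> rsum (fun k => y k ^ 2) n <= B ^ 2 ->
  rsum (fun k => x k * y k) n <= A * B.
Proof.
intros HA HB Hx Hy.
assert (K : forall e, 0 < e -> rsum (fun k => x k * y k) n <= (A + e) * (B + e)).
{ intros e He. set (A' := A + e); set (B' := B + e). assert (0 < A') by (unfold A'; lra). assert (0 < B') by (unfold B'; lra).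
  apply Rle_trans with (rsum (fun k => B' / A' / 2 * x k ^ 2 + A' / B' / 2 * y k ^ 2) n).
  - apply rsum_le; intros k _. apply Rminus_le.
    replace (x k * y k - (B' / A' / 2 * x k ^ 2 + A' / B' / 2 * y k ^ 2))
      with (- ((B' * x k - A' * y k) ^ 2 / (2 * A' * B'))) by (field; lra).
    apply Ropp_le_cancel; rewrite Ropp_involutive, Ropp_0. apply Rdiv_le_0_compat; [apply pow2_ge_0|]. nra.
  - rewrite rsum_plus, !rsum_scal.
    apply Rle_trans with (B' / A' / 2 * A' ^ 2 + A' / B' / 2 * B' ^ 2); [|right; field; lra].
    assert (0 <= B' / A' / 2) by (apply Rdiv_le_0_compat; [apply Rdiv_le_0_compat; lra|lra]).
    assert (0 <= A' / B' / 2) by (apply Rdiv_le_0_compat; [apply Rdiv_le_0_compat; lra|lra]).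
    apply Rplus_le_compat; apply Rmult_le_compat_l; try easy; unfold A', B'; nra. }
apply Rnot_lt_le; intros L. set (d := rsum (fun k => x k * y k) n - A * B) in *. assert (0 < d) by (unfold d in *; lra).
set (e := Rmin 1 (d / (2 * (A + B + 1)))).
assert (0 < d / (2 * (A + B + 1))) by (apply Rdiv_lt_0_compat; lra).
assert (0 < e) by (apply Rmin_glb_lt; lra).
specialize (K e ltac:(easy)). pose proof (Rmin_l 1 (d / (2 * (A + B + 1)))); pose proof (Rmin_r 1 (d / (2 * (A + B + 1)))).
fold e in H2, H3.
assert (e * (A + B + 1) <= d / 2).
{ apply Rle_trans with (d / (2 * (A + B + 1)) * (A + B + 1)); [apply Rmult_le_compat_r; lra|right; field; lra]. }
unfold d in *; nra.
Qed.

(** * Power series *)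

Definition pser (a : nat -> C) (z l : C) : Prop := csums (fun n => a n * z ^ n)%C l.

Lemma sum_n_csum (u : nat -> C) n : sum_n (G := C_AbelianMonoid) u n = csum u (S n).
Proof.
induction n as [|n IH].
- rewrite sum_O; simpl; ring.
- rewrite sum_Sn, IH; reflexivity.
Qed.

Lemma is_series_csums (u : nat -> C) l :
  is_series (K := C_AbsRing) (V := C_NormedModule) u l <-> csums u l.
Proof.
apply (iff_trans (filterlim_locally_ball_norm (K := C_AbsRing) (U := C_NormedModule)
  (sum_n (G := C_NormedModule) u) l)); split.
- intros H eps He; destruct (H (mkposreal eps He)) as [N HN]; exists (S N).
  intros n Hn; destruct n as [|n]; [lia|]. rewrite <- sum_n_csum.
  specialize (HN n ltac:(lia)); exact HN.
- intros H eps; destruct (H eps (cond_pos eps)) as [N HN]; exists N; intros n Hn.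
  change (Cmod (sum_n (G := C_AbelianMonoid) u n - l) < eps).
  rewrite sum_n_csum; apply HN; lia.
Qed.

Lemma pow_n_Cpow (z : C) n : pow_n (K := C_Ring) z n = (z ^ n)%C.
Proof. induction n as [|n IH]; simpl; [easy|]. now rewrite IH. Qed.

Lemma is_pseries_pser a z l :
  is_pseries (K := C_AbsRing) (V := C_NormedModule) a z l <-> pser a z l.
Proof.
unfold is_pseries; rewrite is_series_csums; unfold pser.
assert (E : forall n, scal (V := C_NormedModule) (pow_n (K := C_Ring) z n) (a n) = (a n * z ^ n)%C).
{ intros n; rewrite (Cmult_comm (a n)).
  exact (f_equal (fun x => (x * a n)%C) (pow_n_Cpow z n)). }
split; apply csums_ext; intros n; [exact (E n)|symmetry; exact (E n)].
Qed.

(** Only the values of [f] in the disk matter, so [r] may exceed the distance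
    from [c] to the unit circle; convergence is then guaranteed only up to that
    circle. *)
Definition tseries (f : disk -> C) (c : disk) (a : nat -> C) (r : R) : Prop :=
  0 < r /\ forall z : disk, Cmod (z - c) < r -> pser a (z - c) (f z).

Lemma analytic_tseries f : analytic f <-> forall c, exists a r, tseries f c a r.
Proof.
split; intros H c; destruct (H c) as [a [r Hr]].
- exists a, r; split; [apply cond_pos|]. intros z Hz; apply is_pseries_pser; auto.
- destruct Hr as [Hr1 Hr2]. exists a, (mkposreal r Hr1); intros z Hz; apply is_pseries_pser; auto.
Qed.

Lemma disk_near (c : disk) (w : C) : Cmod w < 1 - Cmod c -> exists z : disk, (z - c = w)%C.
Proof.
intros H. assert (K : Cmod (c + w) < 1) by (pose proof (Cmod_triangle c w); lra).
exists (Disk _ K); simpl; ring.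
Qed.

Lemma rsum_geom_tail v M q N m : 0 <= q < 1 -> (forall k, v k <= M * q ^ k) -> (N <= m)%nat ->
  rsum v m - rsum v N <= M * (q ^ N - q ^ m) / (1 - q).
Proof.
intros Hq Hv; induction 1 as [|m L IH].
- right; field; lra.
- simpl. specialize (Hv m).
  replace (M * (q ^ N - q * q ^ m) / (1 - q)) with (M * (q ^ N - q ^ m) / (1 - q) + M * q ^ m) by (field; lra).
  lra.
Qed.

Lemma rsum_geom v M q n : 0 <= M -> 0 <= q < 1 -> (forall k, v k <= M * q ^ k) ->
  rsum v n <= M / (1 - q).
Proof.
intros HM Hq Hv. pose proof (rsum_geom_tail v M q 0 n Hq Hv ltac:(lia)) as H; simpl in H.
assert (M * (1 - q ^ n) / (1 - q) <= M / (1 - q)); [|lra].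
apply Rmult_le_compat_r; [left; apply Rinv_0_lt_compat; lra|].
pose proof (pow_le q n ltac:(lra)); nra.
Qed.

(** Bounded terms at radius [rho] give a geometric bound at smaller radii. *)
Lemma coef_geom (a : nat -> C) M rho s n : 0 < rho -> 0 <= s -> Cmod (a n) * rho ^ n <= M ->
  Cmod (a n) * s ^ n <= M * (s / rho) ^ n.
Proof.
intros Hr Hs H. pose proof (pow_lt rho n Hr).
replace s with (rho * (s / rho)) at 1 by (field; lra).
rewrite Rpow_mult_distr, <- Rmult_assoc. apply Rmult_le_compat_r; [|easy].
apply pow_le, Rdiv_le_0_compat; lra.
Qed.

Lemma ratio_lt_1 s rho : 0 <= s < rho -> 0 <= s / rho < 1.
Proof.
intros H; split; [apply Rdiv_le_0_compat; lra|]. apply Rmult_lt_reg_r with rho; [lra|].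
replace (s / rho * rho) with s by (field; lra); lra.
Qed.

(** The terms of a convergent series at a point at distance [rho] are bounded. *)
Lemma tseries_coef_bound f c a r rho : tseries f c a r -> 0 < rho -> rho < r -> rho < 1 - Cmod c ->
  exists M, 0 <= M /\ forall n, Cmod (a n) * rho ^ n <= M.
Proof.
intros [_ H] H0 H1 H2.
assert (E : Cmod rho = rho) by (rewrite Cmod_R; apply Rabs_pos_eq; lra).
destruct (disk_near c rho) as [z Hz]; [now rewrite E|].
destruct (csums_term _ _ (H z ltac:(now rewrite Hz, E))) as [M [HM K]].
exists M; split; [easy|]; intros n; specialize (K n).
now rewrite Hz, Cmod_mult, Cmod_pow, E in K.
Qed.

Lemma tseries_abs_bound f c a r s : tseries f c a r -> 0 <= s -> s < r -> s < 1 - Cmod c ->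
  exists B, forall n, rsum (fun k => Cmod (a k) * s ^ k) n <= B.
Proof.
intros H Hs H1 H2. set (rho := (s + Rmin r (1 - Cmod c)) / 2).
assert (s < rho /\ rho < r /\ rho < 1 - Cmod c) as [K1 [K2 K3]].
{ unfold rho; pose proof (Rmin_l r (1 - Cmod c)); pose proof (Rmin_r r (1 - Cmod c)).
  assert (s < Rmin r (1 - Cmod c)) by (apply Rmin_glb_lt; lra); lra. }
destruct (tseries_coef_bound f c a r rho H ltac:(lra) K2 K3) as [M [HM HB]].
exists (M / (1 - s / rho)); intros n; apply rsum_geom; [easy|apply ratio_lt_1; lra|].
intros k; apply coef_geom; auto; lra.
Qed.

Lemma tseries_weaken f c a r r' : tseries f c a r -> 0 < r' <= r -> tseries f c a r'.
Proof. intros [_ H] H'; split; [lra|]; intros z Hz; apply H; lra. Qed.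

Lemma tseries_ext f g c a r : (forall z, f z = g z) -> tseries f c a r -> tseries g c a r.
Proof. intros E [H1 H2]; split; [easy|]; intros z Hz; rewrite <- E; auto. Qed.

Lemma tseries_plus f g c a b r : tseries f c a r -> tseries g c b r ->
  tseries (fun z => f z + g z)%C c (fun n => a n + b n)%C r.
Proof.
intros [H1 H2] [_ H3]; split; [easy|]; intros z Hz.
apply (csums_ext (fun n => a n * (z - c) ^ n + b n * (z - c) ^ n)%C); [intros; ring|].
apply csums_plus; [now apply H2|now apply H3].
Qed.

Lemma csums_shift u l n : csums u l -> csums (fun m => if (m <? n)%nat then 0 else u (m - n)%nat) l.
Proof.
intros H eps He; destruct (H eps He) as [N HN]; exists (n + N)%nat; intros m Hm.
replace (csum _ m) with (csum u (m - n)); [apply HN; lia|].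
replace m with (n + (m - n))%nat at 2 by lia. generalize (m - n)%nat as p; clear.
induction p as [|p IH].
- rewrite Nat.add_0_r; symmetry; change (csum u 0) with (RtoC 0); apply csum_zero; intros k Hk.
  destruct (Nat.ltb_spec k n); [easy|lia].
- rewrite Nat.add_succ_r; simpl; rewrite IH; f_equal.
  destruct (Nat.ltb_spec (n + p) n); [lia|]. f_equal; lia.
Qed.

Definition cauchy_coef (a b : nat -> C) (m : nat) : C := csum (fun n => a n * b (m - n)%nat)%C (S m).

Lemma rsum_triangle_le x y M : (forall n, 0 <= x n) -> (forall n, 0 <= y n) ->
  rsum (fun m => rsum (fun n => x n * y (m - n)%nat) (S m)) M <= rsum x M * rsum y M.
Proof.
intros Hx Hy.
assert (E : rsum (fun m => rsum (fun n => x n * y (m - n)%nat) (S m)) M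
  = rsum (fun n => x n * rsum y (M - n)) M).
{ induction M as [|M IH]; [easy|]. cbn [rsum]; cbn [rsum] in IH; rewrite IH.
  rewrite <- Rplus_assoc, <- rsum_plus. f_equal.
  - apply rsum_ext_lt; intros k Hk. replace (S M - k)%nat with (S (M - k)) by lia; simpl; ring.
  - replace (S M - M)%nat with 1%nat by lia; rewrite Nat.sub_diag; simpl; ring. }
rewrite E, Rmult_comm, <- rsum_scal. apply rsum_le; intros k Hk.
rewrite Rmult_comm; apply Rmult_le_compat_r; [easy|]. apply rsum_mono; [easy|lia].
Qed.

Lemma csum_scal_r c u n : csum (fun k => u k * c)%C n = (csum u n * c)%C.
Proof. induction n as [|n IH]; simpl; [|rewrite IH]; ring. Qed.

(** Entry [(m, n)] of the triangular array is [a_n b_(m - n) w ^ m]: its rows sum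
    to the terms of the Cauchy product and its columns to [a_n w ^ n G]. *)
Lemma pser_mult a b w F G A B :
  (forall n, rsum (fun k => Cmod (a k) * Cmod w ^ k) n <= A) ->
  (forall n, rsum (fun k => Cmod (b k) * Cmod w ^ k) n <= B) ->
  pser a w F -> pser b w G -> pser (cauchy_coef a b) w (F * G)%C.
Proof.
intros HA HB HF HG.
set (x := fun k => Cmod (a k) * Cmod w ^ k) in *. set (y := fun k => Cmod (b k) * Cmod w ^ k) in *.
assert (Px : forall n, 0 <= x n) by (intros; apply Rmult_le_pos; [apply Cmod_ge_0|apply pow_le, Cmod_ge_0]).
assert (Py : forall n, 0 <= y n) by (intros; apply Rmult_le_pos; [apply Cmod_ge_0|apply pow_le, Cmod_ge_0]).
set (u := fun m n => if (m <? n)%nat then RtoC 0 else (a n * w ^ n * (b (m - n)%nat * w ^ (m - n)))%C).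
assert (Hu : forall m n, (n < S m)%nat -> u m n = (a n * b (m - n)%nat * w ^ m)%C).
{ intros m n H; unfold u; destruct (Nat.ltb_spec m n); [lia|].
  transitivity (a n * b (m - n)%nat * (w ^ n * w ^ (m - n)))%C; [ring|].
  rewrite <- Cpow_add_r; replace (n + (m - n))%nat with m by lia; easy. }
assert (Hrow : forall m, csum (u m) (S m) = (cauchy_coef a b m * w ^ m)%C).
{ intros m; unfold cauchy_coef; rewrite <- csum_scal_r; apply csum_ext_lt; intros; now apply Hu. }
assert (Habs : forall M, rsum (fun m => rsum (fun n => Cmod (u m n)) (S m)) M <= A * B).
{ intros M. apply Rle_trans with (rsum x M * rsum y M).
  - rewrite (rsum_ext_lt _ (fun m => rsum (fun n => x n * y (m - n)%nat) (S m))).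
    + now apply rsum_triangle_le.
    + intros m _; apply rsum_ext_lt; intros n Hn; unfold u, x, y.
      destruct (Nat.ltb_spec m n); [lia|]. now rewrite !Cmod_mult, !Cmod_pow.
  - apply Rmult_le_compat; auto using rsum_pos. }
destruct (csums_dominated (fun m => csum (u m) (S m)) (fun m => rsum (fun n => Cmod (u m n)) (S m)) (A * B)) as [L HL].
{ intros; apply Cmod_csum. } { exact Habs. }
assert (HL' : csums (fun n => G * (a n * w ^ n))%C L).
{ apply (fubini_triangular u _ L (A * B)); [|easy| |easy].
  - intros m n H; unfold u; destruct (Nat.ltb_spec m n); [easy|lia].
  - intros n.
    apply (csums_shift (fun k => a n * w ^ n * (b k * w ^ k))%C).
    replace (G * (a n * w ^ n))%C with (a n * w ^ n * G)%C by ring. now apply csums_scal. }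
replace (F * G)%C with L.
- apply (csums_ext (fun m => csum (u m) (S m))); [exact Hrow|easy].
- apply (cvto_unique _ _ _ HL'). rewrite Cmult_comm. now apply csums_scal.
Qed.

(** Two local expansions are first restricted to a common radius, inside the
    disk. *)
Lemma analytic_combine (f g h : disk -> C) :
  (forall (c : disk) a b r, r <= 1 - Cmod c -> tseries f c a r -> tseries g c b r -> exists d, tseries h c d r) ->
  analytic f -> analytic g -> analytic h.
Proof.
rewrite !analytic_tseries; intros H Hf Hg c.
destruct (Hf c) as [a [r1 Ha]]; destruct (Hg c) as [b [r2 Hb]].
set (r := Rmin (Rmin r1 r2) (1 - Cmod c)).
assert (0 < r /\ r <= r1 /\ r <= r2 /\ r <= 1 - Cmod c) as (K1 & K2 & K3 & K4).
{ pose proof (disk_lt1 c). destruct Ha, Hb. unfold r; repeat split.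
  - repeat apply Rmin_glb_lt; lra.
  - apply Rle_trans with (1 := Rmin_l _ _), Rmin_l.
  - apply Rle_trans with (1 := Rmin_l _ _), Rmin_r.
  - apply Rmin_r. }
destruct (H c a b r K4) as [d Hd]; [apply (tseries_weaken _ _ _ r1); auto|apply (tseries_weaken _ _ _ r2); auto|].
now exists d, r.
Qed.

Lemma analytic_plus f g : analytic f -> analytic g -> analytic (fun z => f z + g z)%C.
Proof.
apply analytic_combine; intros c a b r _ Ha Hb; eexists; apply (tseries_plus _ _ _ _ _ _ Ha Hb).
Qed.

Lemma analytic_mult f g : analytic f -> analytic g -> analytic (fun z => f z * g z)%C.
Proof.
apply analytic_combine; intros c a b r Hr Ha Hb; exists (cauchy_coef a b); split; [apply Ha|].
intros z Hz. pose proof (Cmod_ge_0 (z - c)).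
destruct (tseries_abs_bound _ _ _ _ (Cmod (z - c)) Ha) as [A HA]; try lra.
destruct (tseries_abs_bound _ _ _ _ (Cmod (z - c)) Hb) as [B HB]; try lra.
apply (pser_mult _ _ _ _ _ A B HA HB); [now apply Ha|now apply Hb].
Qed.

Lemma analytic_const k : analytic (fun _ => k).
Proof.
apply analytic_tseries; intros c. exists (fun n => match n with O => k | _ => 0 end), 1; split; [lra|].
intros z _. set (u := fun n => (match n with O => k | S _ => 0 end * (z - c) ^ n)%C).
assert (E : csums u (csum u 1)).
{ apply csums_finite; intros n Hn; unfold u; destruct n; [lia|ring]. }
replace (csum u 1) with k in E by (unfold u; simpl; ring). exact E.
Qed.

Lemma analytic_scal k f : analytic f -> analytic (fun z => k * f z)%C.
Proof. intros H; apply (analytic_mult (fun _ => k)); [apply analytic_const|easy]. Qed.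

Lemma analytic_minus f g : analytic f -> analytic g -> analytic (fun z => f z - g z)%C.
Proof.
intros Hf Hg. assert (E : (fun z => f z - g z)%C = (fun z => f z + (-(1)) * g z)%C).
{ apply functional_extensionality; intros; ring. }
rewrite E; apply analytic_plus; [easy|now apply analytic_scal].
Qed.

Lemma analytic_pow f n : analytic f -> analytic (fun z => f z ^ n)%C.
Proof.
intros H; induction n as [|n IH]; [exact (analytic_const 1)|exact (analytic_mult f _ H IH)].
Qed.

Lemma pser_at_0 a l : pser a 0 l -> a O = l.
Proof.
intros H. apply (cvto_unique (csum (fun n => a n * 0 ^ n)%C)); [|exact H].
intros eps He; exists 1%nat; intros n Hn. destruct n as [|n]; [lia|].
rewrite csum_first, csum_zero by (intros; simpl; ring).
simpl. replace (a O * 1 + 0 - a O)%C with (RtoC 0) by ring. rewrite Cmod_0; lra.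
Qed.

Lemma tseries_at f c a r : tseries f c a r -> a O = f c.
Proof.
intros [Hr H]. apply pser_at_0. replace (RtoC 0) with (c - c)%C by ring. apply H.
replace (c - c)%C with (RtoC 0) by ring. now rewrite Cmod_0.
Qed.

(** * Changing the centre of a power series *)

(** [tc c m n] is the coefficient of [w ^ n] in [(c + w) ^ m]. *)
Fixpoint tc (c : C) (m n : nat) : C :=
  match m with
  | O => match n with O => 1 | _ => 0 end
  | S m' => (c * tc c m' n + match n with O => 0 | S n' => tc c m' n' end)%C
  end.

Lemma tc_gt c m n : (m < n)%nat -> tc c m n = 0.
Proof.
revert n; induction m as [|m IH]; intros n H; simpl.
- destruct n; [lia|easy].
- destruct n; [lia|]. rewrite !IH by lia; ring.
Qed.

Lemma tc_binomial c w m : csum (fun n => tc c m n * w ^ n)%C (S m) = ((c + w) ^ m)%C.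
Proof.
induction m as [|m IH]; [simpl; ring|].
rewrite csum_first.
replace (csum _ (S m)) with (c * csum (fun k => tc c m (S k) * w ^ S k) (S m)
   + w * csum (fun k => tc c m k * w ^ k) (S m))%C.
- rewrite IH. replace (((c + w) ^ S m)%C) with (c * (c + w) ^ m + w * (c + w) ^ m)%C by (simpl; ring).
  rewrite <- IH at 2. rewrite (csum_first (fun n => tc c m n * w ^ n)%C). cbn [csum]. rewrite (tc_gt c m (S m)) by lia. simpl; ring.
- rewrite <- !csum_scal, <- csum_plus. apply csum_ext; intros k; simpl; ring.
Qed.

(** The same recursion as for [tc_binomial], with absolute values: this is the
    binomial formula for [(|c| + s) ^ m], as an inequality. *)
Lemma tc_abs c s m : 0 <= s ->
  rsum (fun n => Cmod (tc c m n) * s ^ n) (S m) <= (Cmod c + s) ^ m.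
Proof.
intros Hs; induction m as [|m IH].
- simpl; rewrite Cmod_1; lra.
- pose proof (Cmod_ge_0 c).
  apply Rle_trans with (rsum (fun n => Cmod c * (Cmod (tc c m n) * s ^ n)
     + s * match n with O => 0 | S n' => Cmod (tc c m n') * s ^ n' end) (S (S m))).
  + apply rsum_le; intros k _. simpl tc.
    apply Rle_trans with ((Cmod c * Cmod (tc c m k) + match k with O => 0 | S n' => Cmod (tc c m n') end) * s ^ k).
    * apply Rmult_le_compat_r; [now apply pow_le|]. apply Rle_trans with (1 := Cmod_triangle _ _).
      rewrite Cmod_mult. destruct k; [rewrite Cmod_0|]; lra.
    * right; destruct k; simpl; ring.
  + rewrite rsum_plus, !rsum_scal, (rsum_first (fun n => match n with O => 0 | S n' => Cmod (tc c m n') * s ^ n' end)).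
    cbn [rsum] in *. rewrite (tc_gt c m (S m)), Cmod_0 by lia. simpl pow. nra.
Qed.

Lemma tc_le c s m n : 0 < s -> Cmod (tc c m n) <= (Cmod c + s) ^ m / s ^ n.
Proof.
intros Hs. pose proof (pow_lt s n Hs). pose proof (Cmod_ge_0 c).
apply Rmult_le_reg_r with (s ^ n); [easy|]. unfold Rdiv; rewrite Rmult_assoc, Rinv_l, Rmult_1_r by lra.
destruct (Nat.le_gt_cases n m) as [L|L].
- apply Rle_trans with (2 := tc_abs c s m ltac:(lra)).
  assert (P : forall k, 0 <= Cmod (tc c m k) * s ^ k) by (intros; apply Rmult_le_pos; [apply Cmod_ge_0|apply pow_le; lra]).
  pose proof (rsum_mono _ (S n) (S m) P ltac:(lia)) as Q; simpl in Q; simpl.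
  pose proof (rsum_pos _ n P); lra.
- rewrite tc_gt, Cmod_0, Rmult_0_l by easy. apply pow_le; lra.
Qed.

(** Expand each [(c + w) ^ m] by the binomial formula and sum the resulting
    triangular array by columns. *)
Lemma pser_recenter a b c w F B :
  (forall N, rsum (fun m => Cmod (a m) * (Cmod c + Cmod w) ^ m) N <= B) ->
  (forall n, csums (fun m => a m * tc c m n)%C (b n)) ->
  pser a (c + w) F -> pser b w F.
Proof.
intros HB Hb HF.
apply (fubini_triangular (fun m n => a m * (tc c m n * w ^ n))%C _ F B).
- intros m n H; rewrite tc_gt by easy; ring.
- intros M; apply Rle_trans with (2 := HB M). apply rsum_le; intros m _.
  rewrite (rsum_ext_lt _ (fun n => Cmod (a m) * (Cmod (tc c m n) * Cmod w ^ n))).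
  + rewrite rsum_scal; apply Rmult_le_compat_l; [apply Cmod_ge_0|]. apply tc_abs, Cmod_ge_0.
  + intros; now rewrite !Cmod_mult, Cmod_pow.
- intros n; rewrite (Cmult_comm (b n)).
  apply (csums_ext (fun m => w ^ n * (a m * tc c m n))%C); [intros; ring|]. now apply csums_scal.
- apply (csums_ext (fun n => a n * (c + w) ^ n)%C); [|exact HF].
  intros m; now rewrite csum_scal, tc_binomial.
Qed.

(** * Leading terms and the identity theorem *)

(** [f z = al (z - c) ^ n + o ((z - c) ^ n)]; [al] may be 0, in which case this
    says that [f] vanishes to an order greater than [n] at [c]. Leading
    terms are enough to compare both sides of an eigenvalue equation, and they
    compose without substituting power series into each other. *)
Definition asymp (f : disk -> C) (c : disk) (n : nat) (al : C) : Prop :=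
  forall eps, 0 < eps -> exists del, 0 < del /\
    forall z : disk, Cmod (z - c) < del ->
      Cmod (f z - al * (z - c) ^ n) <= eps * Cmod (z - c) ^ n.

Lemma asymp_ext f g c n al : (forall z, f z = g z) -> asymp f c n al -> asymp g c n al.
Proof. intros E H eps He; destruct (H eps He) as [d [Hd K]]; exists d; split; [easy|]; intros; rewrite <- E; auto. Qed.

Lemma asymp_scal k f c n al : asymp f c n al -> asymp (fun z => k * f z)%C c n (k * al)%C.
Proof.
intros H eps He. pose proof (Cmod_ge_0 k).
destruct (H (eps / (Cmod k + 1))) as [d [Hd K]]; [apply Rdiv_lt_0_compat; lra|].
exists d; split; [easy|]; intros z Hz; specialize (K z Hz).
replace (k * f z - k * al * (z - c) ^ n)%C with (k * (f z - al * (z - c) ^ n))%C by ring.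
rewrite Cmod_mult. pose proof (pow_le (Cmod (z - c)) n (Cmod_ge_0 _)).
apply Rle_trans with (Cmod k * (eps / (Cmod k + 1) * Cmod (z - c) ^ n)); [now apply Rmult_le_compat_l|].
rewrite <- Rmult_assoc; apply Rmult_le_compat_r; [easy|].
apply Rle_trans with ((Cmod k + 1) * (eps / (Cmod k + 1))); [|right; field; lra].
apply Rmult_le_compat_r; [left; apply Rdiv_lt_0_compat|]; lra.
Qed.

Lemma asymp_plus f g c n al be : asymp f c n al -> asymp g c n be ->
  asymp (fun z => f z + g z)%C c n (al + be)%C.
Proof.
intros Hf Hg eps He.
destruct (Hf (eps/2) ltac:(lra)) as [d1 [Hd1 K1]]; destruct (Hg (eps/2) ltac:(lra)) as [d2 [Hd2 K2]].
exists (Rmin d1 d2); split; [now apply Rmin_glb_lt|]; intros z Hz.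
specialize (K1 z (Rlt_le_trans _ _ _ Hz (Rmin_l _ _))); specialize (K2 z (Rlt_le_trans _ _ _ Hz (Rmin_r _ _))).
replace (f z + g z - (al + be) * (z - c) ^ n)%C with ((f z - al * (z - c) ^ n) + (g z - be * (z - c) ^ n))%C by ring.
pose proof (Cmod_triangle (f z - al * (z - c) ^ n) (g z - be * (z - c) ^ n)). lra.
Qed.

Lemma asymp_minus f g c n al be : asymp f c n al -> asymp g c n be ->
  asymp (fun z => f z - g z)%C c n (al - be)%C.
Proof.
intros Hf Hg. replace (al - be)%C with (al + (-(1)) * be)%C by ring.
apply (asymp_ext (fun z => f z + (-(1)) * g z)%C); [intros; ring|].
apply asymp_plus; [easy|now apply asymp_scal].
Qed.

Lemma asymp_bound f c n al : asymp f c n al ->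
  exists del, 0 < del /\ forall z : disk, Cmod (z - c) < del ->
    Cmod (f z) <= (Cmod al + 1) * Cmod (z - c) ^ n.
Proof.
intros H; destruct (H 1 ltac:(lra)) as [d [Hd K]]; exists d; split; [easy|]; intros z Hz; specialize (K z Hz).
pose proof (Cmod_le_diff (f z) (al * (z - c) ^ n)) as Q. rewrite Cmod_mult, Cmod_pow in Q. lra.
Qed.

Lemma asymp_of_bound f (c : disk) n K d : 0 < d ->
  (forall z : disk, Cmod (z - c) < d -> Cmod (f z) <= K * Cmod (z - c) ^ S n) -> asymp f c n 0.
Proof.
intros Hd H eps He. pose proof (Rabs_pos K).
exists (Rmin d (eps / (Rabs K + 1))); split.
{ apply Rmin_glb_lt; [easy|]. apply Rdiv_lt_0_compat; lra. }
intros z Hz. replace (f z - 0 * (z - c) ^ n)%C with (f z) by ring.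
apply Rle_trans with (1 := H z (Rlt_le_trans _ _ _ Hz (Rmin_l _ _))).
simpl pow; rewrite <- Rmult_assoc. apply Rmult_le_compat_r; [apply pow_le, Cmod_ge_0|].
assert (Hz' : Cmod (z - c) < eps / (Rabs K + 1)) by (apply Rlt_le_trans with (1 := Hz), Rmin_r).
pose proof (Cmod_ge_0 (z - c)). pose proof (Rle_abs K).
apply Rle_trans with ((Rabs K + 1) * (eps / (Rabs K + 1))); [|right; field; lra].
apply Rle_trans with ((Rabs K + 1) * Cmod (z - c)).
- apply Rmult_le_compat_r; lra.
- apply Rmult_le_compat_l; lra.
Qed.

Lemma asymp_lower f c n m al : (m < n)%nat -> asymp f c n al -> asymp f c m 0.
Proof.
intros L H; destruct (asymp_bound _ _ _ _ H) as [d [Hd K]].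
apply (asymp_of_bound f c m (Cmod al + 1) (Rmin d 1)); [apply Rmin_glb_lt; lra|].
intros z Hz. apply Rle_trans with (1 := K z (Rlt_le_trans _ _ _ Hz (Rmin_l _ _))).
assert (Hz' : Cmod (z - c) < 1) by (apply Rlt_le_trans with (1 := Hz), Rmin_r).
pose proof (Cmod_ge_0 (z - c)). pose proof (Cmod_ge_0 al).
apply Rmult_le_compat_l; [lra|].
replace n with (S m + (n - S m))%nat by lia. rewrite pow_add.
rewrite <- (Rmult_1_r (Cmod (z - c) ^ S m)) at 2. apply Rmult_le_compat_l; [now apply pow_le|].
rewrite <- (pow1 (n - S m)). apply pow_incr; lra.
Qed.

Lemma asymp_mult f g c n m al be : asymp f c n al -> asymp g c m be ->
  asymp (fun z => f z * g z)%C c (n + m) (al * be)%C.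
Proof.
intros Hf Hg eps He. pose proof (Cmod_ge_0 al); pose proof (Cmod_ge_0 be).
destruct (asymp_bound _ _ _ _ Hg) as [d0 [Hd0 K0]].
destruct (Hf (eps/2 / (Cmod be + 1))) as [d1 [Hd1 K1]]; [apply Rdiv_lt_0_compat; lra|].
destruct (Hg (eps/2 / (Cmod al + 1))) as [d2 [Hd2 K2]]; [apply Rdiv_lt_0_compat; lra|].
exists (Rmin d0 (Rmin d1 d2)); split; [repeat apply Rmin_glb_lt; easy|]; intros z Hz.
specialize (K0 z ltac:(apply Rlt_le_trans with (1 := Hz), Rmin_l)).
specialize (K1 z ltac:(apply Rlt_le_trans with (1 := Hz), Rle_trans with (1 := Rmin_r _ _), Rmin_l)).
specialize (K2 z ltac:(apply Rlt_le_trans with (1 := Hz), Rle_trans with (1 := Rmin_r _ _), Rmin_r)).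
set (w := (z - c)%C) in *.
replace (f z * g z - al * be * w ^ (n + m))%C
  with ((f z - al * w ^ n) * g z + al * w ^ n * (g z - be * w ^ m))%C by (rewrite Cpow_add_r; ring).
apply Rle_trans with (1 := Cmod_triangle _ _). rewrite !Cmod_mult, Cmod_pow, pow_add.
set (x := Cmod w ^ n) in *. set (y := Cmod w ^ m) in *.
assert (0 <= x) by apply pow_le, Cmod_ge_0. assert (0 <= y) by apply pow_le, Cmod_ge_0.
apply Rle_trans with ((eps/2 / (Cmod be + 1) * x) * ((Cmod be + 1) * y) + (Cmod al + 1) * x * (eps/2 / (Cmod al + 1) * y)).
- apply Rplus_le_compat.
  + apply Rmult_le_compat; auto using Cmod_ge_0.
  + apply Rmult_le_compat; auto using Cmod_ge_0.
    * apply Rmult_le_pos; lra.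
    * apply Rmult_le_compat_r; lra.
- right; field; lra.
Qed.

Lemma asymp_one c : asymp (fun _ => 1) c 0 1.
Proof.
intros eps He; exists 1; split; [lra|]; intros z _; simpl.
replace (1 - 1 * 1)%C with (RtoC 0) by ring; rewrite Cmod_0; lra.
Qed.

Lemma asymp_pow f c al n : asymp f c 1 al -> asymp (fun z => f z ^ n)%C c n (al ^ n)%C.
Proof.
intros H; induction n as [|n IH]; [exact (asymp_one c)|].
exact (asymp_mult f _ c 1 n al _ H IH).
Qed.

Lemma disk_punctured (c : disk) d : 0 < d -> exists z : disk, 0 < Cmod (z - c) < d.
Proof.
intros Hd. pose proof (disk_lt1 c).
assert (E : 0 < Rmin d (1 - Cmod c)) by (apply Rmin_glb_lt; lra).
assert (E2 : Cmod (Rmin d (1 - Cmod c) / 2)%R = Rmin d (1 - Cmod c) / 2) by (rewrite Cmod_R; apply Rabs_pos_eq; lra).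
destruct (disk_near c (Rmin d (1 - Cmod c) / 2)%R) as [z' Hz'].
- rewrite E2; pose proof (Rmin_r d (1 - Cmod c)); lra.
- exists z'; rewrite Hz', E2. pose proof (Rmin_l d (1 - Cmod c)); lra.
Qed.

(** A nonzero leading term makes zeros isolated. *)
Lemma asymp_nonzero f c n (al : C) : al <> 0 -> asymp f c n al ->
  exists del, 0 < del /\ forall z : disk, 0 < Cmod (z - c) < del -> f z <> 0.
Proof.
intros Ha H. apply Cmod_gt_0 in Ha.
destruct (H (Cmod al / 2) ltac:(lra)) as [d [Hd K]]; exists d; split; [easy|]; intros z [Hz1 Hz2] E.
specialize (K z Hz2); rewrite E in K.
replace (0 - al * (z - c) ^ n)%C with (- (al * (z - c) ^ n))%C in K by ring.
rewrite Cmod_opp, Cmod_mult, Cmod_pow in K. pose proof (pow_lt _ n Hz1). nra.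
Qed.

Lemma asymp_unique f c n al be : asymp f c n al -> asymp f c n be -> al = be.
Proof.
intros H1 H2. destruct (classic (al - be = 0)%C) as [E|E]; [now apply Ceq_minus|exfalso].
pose proof (asymp_minus _ _ _ _ _ _ H1 H2) as H.
destruct (asymp_nonzero _ _ _ _ E H) as [d [Hd K]]. destruct (disk_punctured c d Hd) as [z Hz].
apply (K z Hz); ring.
Qed.

(** Coefficients are at most [M / rho ^ k], so the remainder after [n + 1] terms
    is at most a constant times the [n + 1]-st power of the distance. *)
Lemma tseries_tail f c a r n : tseries f c a r ->
  asymp (fun z => f z - csum (fun k => a k * (z - c) ^ k) n)%C c n (a n).
Proof.
intros [Hr H]. pose proof (disk_lt1 c).
set (rho := Rmin r (1 - Cmod c) / 2).
assert (Hm : 0 < Rmin r (1 - Cmod c)) by (apply Rmin_glb_lt; lra).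
pose proof (Rmin_l r (1 - Cmod c)); pose proof (Rmin_r r (1 - Cmod c)).
destruct (tseries_coef_bound f c a r rho (conj Hr H)) as [M [HM HB]]; try (unfold rho; lra).
assert (Hrho : 0 < rho) by (unfold rho; lra).
apply (asymp_ext (fun z => (f z - csum (fun k => a k * (z - c) ^ k) (S n)) + a n * (z - c) ^ n)%C).
{ intros z; simpl; ring. }
refine (eq_ind _ (asymp _ c n) _ _ (Cplus_0_l (a n))). apply asymp_plus.
- apply (asymp_of_bound _ _ _ (2 * M / rho ^ S n) (rho / 2)); [lra|].
  intros z Hz. pose proof (Cmod_ge_0 (z - c)).
  set (s := Cmod (z - c)) in *.
  assert (Hq : 0 <= s / rho < 1) by (apply ratio_lt_1; lra).
  assert (Hq2 : s / rho <= 1 / 2).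
  { apply Rmult_le_reg_r with rho; [lra|]. unfold Rdiv at 1; rewrite Rmult_assoc, Rinv_l; lra. }
  apply (csums_tail_le (fun k => a k * (z - c) ^ k)%C); [apply H; fold s; unfold rho in Hz; lra|].
  intros m Hmn.
  apply Rle_trans with (M * ((s / rho) ^ S n - (s / rho) ^ m) / (1 - s / rho)).
  + apply rsum_geom_tail; [easy| |easy]. intros k; rewrite Cmod_mult, Cmod_pow.
    apply coef_geom; auto.
  + replace (2 * M / rho ^ S n * s ^ S n) with (M * (s / rho) ^ S n * 2).
    2:{ unfold Rdiv at 1; rewrite Rpow_mult_distr, pow_inv by lra. field. apply pow_nonzero; lra. }
    pose proof (pow_le (s / rho) m ltac:(lra)). pose proof (pow_le (s / rho) (S n) ltac:(lra)).
    apply Rmult_le_compat; [ | left; apply Rinv_0_lt_compat; lra | nra | ].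
    * apply Rmult_le_pos; [easy|].
      replace m with (S n + (m - S n))%nat by lia; rewrite pow_add.
      pose proof (pow_incr (s / rho) 1 (m - S n) ltac:(lra)) as Q; rewrite pow1 in Q. nra.
    * replace 2 with (/ (1/2)) by field. apply Rinv_le_contravar; lra.
- intros eps He; exists 1; split; [lra|]; intros z _.
  replace (a n * (z - c) ^ n - a n * (z - c) ^ n)%C with (RtoC 0) by ring. rewrite Cmod_0.
  apply Rmult_le_pos; [lra|apply pow_le, Cmod_ge_0].
Qed.

Lemma tseries_asymp f c a r n : tseries f c a r -> (forall k, (k < n)%nat -> a k = 0) -> asymp f c n (a n).
Proof.
intros H Z. apply (asymp_ext (fun z => f z - csum (fun k => a k * (z - c) ^ k) n)%C).
- intros z; rewrite csum_zero; [ring|]. intros k Hk; rewrite Z by easy; ring.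
- now apply (tseries_tail _ _ _ r).
Qed.

(** By induction on [k], both 0 and the [k]-th coefficient are leading
    coefficients of order [k], and these are unique. *)
Lemma asymp_tseries f c a r n al : tseries f c a r -> asymp f c n al ->
  (forall k, (k < n)%nat -> a k = 0) /\ a n = al.
Proof.
intros H K. assert (Z : forall k, (k < n)%nat -> a k = 0).
{ intros k; induction k as [k IH] using (well_founded_induction Nat.lt_wf_0); intros L.
  apply (asymp_unique f c k); [|now apply (asymp_lower _ _ n _ al)].
  apply (tseries_asymp _ _ _ r); [easy|]. intros j Hj; apply IH; lia. }
split; [easy|]. apply (asymp_unique f c n); [|easy]. now apply (tseries_asymp _ _ _ r).
Qed.

Lemma tseries_dichotomy f c a r : tseries f c a r ->
  (forall z : disk, Cmod (z - c) < r -> f z = 0) \/ exists k, a k <> 0 /\ asymp f c k (a k).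
Proof.
intros H. destruct (classic (exists k, a k <> 0)) as [[k Hk]|N].
- right. induction k as [k IH] using (well_founded_induction Nat.lt_wf_0).
  destruct (classic (exists j, (j < k)%nat /\ a j <> 0)) as [[j [Lj Hj]]|N]; [now apply (IH j)|].
  exists k; split; [easy|]. apply (tseries_asymp _ _ _ r); [easy|].
  intros j Lj; apply NNPP; intros Hj; apply N; now exists j.
- left; intros z Hz. apply (cvto_unique (csum (fun n => a n * (z - c) ^ n)%C)); [now apply H|].
  apply (cvto_ext (fun _ => RtoC 0)); [|apply cvto_const].
  intros n; symmetry; apply csum_zero; intros k _.
  replace (a k) with (RtoC 0); [ring|]. symmetry; apply NNPP; intros Hk; apply N; now exists k.
Qed.

Lemma tseries_unique f c a b r r' : tseries f c a r -> tseries f c b r' -> forall n, a n = b n.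
Proof.
intros Ha Hb n; induction n as [n IH] using (well_founded_induction Nat.lt_wf_0).
pose proof (tseries_tail _ _ _ _ n Ha) as Ka. pose proof (tseries_tail _ _ _ _ n Hb) as Kb.
apply (asymp_unique _ c n _ _ Ka). revert Kb; apply asymp_ext.
intros z; apply (f_equal (fun x => f z - x)%C), csum_ext_lt; intros k Hk; now rewrite IH.
Qed.

Lemma Cmod_convex x y t : 0 <= t <= 1 -> Cmod x < 1 -> Cmod y < 1 ->
  Cmod (x + RtoC t * (y - x)) < 1.
Proof.
intros Ht Hx Hy. replace (x + t * (y - x))%C with ((RtoC (1 - t)) * x + RtoC t * y)%C.
- apply Rle_lt_trans with (1 := Cmod_triangle _ _). rewrite !Cmod_mult, !Cmod_R, !Rabs_pos_eq by lra.
  pose proof (Cmod_ge_0 x); pose proof (Cmod_ge_0 y).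
  destruct (Req_dec t 0); [subst; lra|]. assert (t * Cmod y < t * 1) by (apply Rmult_lt_compat_l; lra). nra.
- rewrite RtoC_minus; ring.
Qed.

(** Along the segment from [c] to [z], consider the supremum of the times up to
    which [f] vanishes. At that point the zeros of [f] are not isolated, so [f]
    vanishes in a neighbourhood, and the supremum is the end of the segment. *)
Lemma identity_theorem f (c : disk) d : analytic f -> 0 < d ->
  (forall z : disk, Cmod (z - c) < d -> f z = 0) -> forall z, f z = 0.
Proof.
intros Hf Hd Hz z. apply NNPP; intros Nz.
assert (Hzc : 0 < Cmod (z - c)).
{ apply Rnot_le_lt; intros L. apply Nz, Hz; lra. }
set (L := Cmod (z - c)) in *.
set (gam := fun t => (c + RtoC t * (z - c))%C).
assert (Hdist : forall s t, Cmod (gam s - gam t) = Rabs (s - t) * L).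
{ intros s t; unfold gam. replace (c + s * (z - c) - (c + t * (z - c)))%C with (RtoC (s - t) * (z - c))%C by (rewrite RtoC_minus; ring).
  now rewrite Cmod_mult, Cmod_R. }
assert (Hgam : forall t, 0 <= t <= 1 -> exists p : disk, p = gam t :> C).
{ intros t Ht. exists (Disk _ (Cmod_convex c z t Ht (disk_lt1 c) (disk_lt1 z))); easy. }
set (S := fun t => 0 <= t <= 1 /\ forall s (p : disk), 0 <= s <= t -> p = gam s :> C -> f p = 0).
destruct (completeness S) as [T [HT1 HT2]].
- exists 1; intros t [Ht _]; lra.
- exists 0; split; [lra|]. intros s p Hs Hp. apply Hz. rewrite Hp.
  replace s with 0 by lra. unfold gam; replace (c + 0 * (z - c) - c)%C with (RtoC 0) by ring. rewrite Cmod_0; lra.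
- assert (HT0 : 0 < T).
  { set (t := Rmin 1 (d / L / 2)). assert (0 < d / L) by (apply Rdiv_lt_0_compat; lra).
    assert (Ht : 0 < t) by (apply Rmin_glb_lt; lra).
    apply Rlt_le_trans with (1 := Ht), HT1. split; [pose proof (Rmin_l 1 (d/L/2)); unfold t in *; lra|].
    intros s p Hs Hp; apply Hz. rewrite Hp.
    replace (gam s - c)%C with (gam s - gam 0)%C by (unfold gam; ring).
    rewrite Hdist, Rabs_pos_eq by lra. assert (t <= d / L / 2) by apply Rmin_r.
    apply Rle_lt_trans with (d / L / 2 * L); [apply Rmult_le_compat_r; lra|].
    replace (d / L / 2 * L) with (d / 2) by (field; lra). lra. }
  assert (HT3 : T <= 1) by (apply HT2; intros t [Ht _]; lra).
  assert (Hbelow : forall s (p : disk), 0 <= s < T -> p = gam s :> C -> f p = 0).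
  { intros s p Hs Hp. apply NNPP; intros N. assert (T <= s); [|lra].
    apply HT2; intros t [Ht Kt]. apply Rnot_lt_le; intros Hst. apply N, (Kt s); [lra|easy]. }
  destruct (Hgam T ltac:(lra)) as [q Hq].
  destruct (proj1 (analytic_tseries f) Hf q) as [a [r Hr]].
  destruct (tseries_dichotomy f q a r Hr) as [E|[k [Hk Ka]]].
  (* [f] vanishes near [q], so the supremum can only be 1 *)
  + destruct Hr as [Hr _].
    set (T' := Rmin 1 (T + r / L / 2)). assert (0 < r / L) by (apply Rdiv_lt_0_compat; lra).
    assert (HT' : S T').
    { assert (T < T + r / L / 2) by lra.
      split; [unfold T'; split; [apply Rmin_glb; lra|apply Rmin_l]|].
      intros s p Hs Hp. destruct (Rlt_le_dec s T) as [Hl|Hl]; [now apply (Hbelow s)|].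
      apply E. rewrite Hp, Hq, Hdist, Rabs_pos_eq by lra.
      assert (T' <= T + r / L / 2) by apply Rmin_r.
      apply Rle_lt_trans with (r / L / 2 * L); [apply Rmult_le_compat_r; lra|].
      replace (r / L / 2 * L) with (r / 2) by (field; lra). lra. }
    assert (T' = 1).
    { pose proof (HT1 _ HT'). unfold T', Rmin in *. destruct (Rle_dec 1 (T + r / L / 2)); [easy|lra]. }
    apply Nz. apply (proj2 HT' 1); [lra|]. unfold gam; ring.
  + destruct (asymp_nonzero _ _ _ _ Hk Ka) as [e [He Ke]].
    set (s := Rmax 0 (T - e / L / 2)). assert (0 < e / L) by (apply Rdiv_lt_0_compat; lra).
    assert (Hs : 0 <= s < T /\ T - s <= e / L / 2).
    { unfold s; repeat split; [apply Rmax_l|apply Rmax_lub_lt; lra|]. pose proof (Rmax_r 0 (T - e / L / 2)); lra. }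
    destruct (Hgam s ltac:(lra)) as [p Hp].
    apply (Ke p); [|now apply (Hbelow s)].
    rewrite Hp, Hq, Hdist, Rabs_left by lra. split.
    * apply Rmult_lt_0_compat; lra.
    * apply Rle_lt_trans with (e / L / 2 * L); [apply Rmult_le_compat_r; lra|].
      replace (e / L / 2 * L) with (e / 2) by (field; lra). lra.
Qed.

Lemma analytic_leading f (c z0 : disk) : analytic f -> f z0 <> 0 -> exists k (al : C), al <> 0 /\ asymp f c k al.
Proof.
intros Hf Hz. destruct (proj1 (analytic_tseries f) Hf c) as [a [r Hr]].
destruct (tseries_dichotomy f c a r Hr) as [E|[k [Hk Ka]]]; [|now exists k, (a k)].
exfalso; apply Hz, (identity_theorem f c r Hf); [apply Hr|easy].
Qed.

(** Substitute [phi z - a = la (z - a) + o (z - a)]. *)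
Lemma asymp_comp f (phi : disk -> disk) (a : disk) n al la :
  phi a = a -> asymp (fun z => phi z - a)%C a 1 la -> asymp f a n al ->
  asymp (fun z => f (phi z)) a n (al * la ^ n)%C.
Proof.
intros Ha Hphi Hf.
apply (asymp_ext (fun z => (f (phi z) - al * (phi z - a) ^ n) + al * (phi z - a) ^ n)%C); [intros; ring|].
replace (al * la ^ n)%C with (0 + al * la ^ n)%C by ring.
apply asymp_plus; [|apply asymp_scal, (asymp_pow (fun z => phi z - a)%C); exact Hphi].
intros eps He. pose proof (Cmod_ge_0 la) as P.
assert (Pn : 0 < (Cmod la + 1) ^ n) by (apply pow_lt; lra).
destruct (asymp_bound _ _ _ _ Hphi) as [d1 [Hd1 K1]].
destruct (Hf (eps / (Cmod la + 1) ^ n)) as [d2 [Hd2 K2]]; [now apply Rdiv_lt_0_compat|].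
exists (Rmin d1 (d2 / (Cmod la + 1))); split; [apply Rmin_glb_lt; [easy|apply Rdiv_lt_0_compat; lra]|].
intros z Hz. specialize (K1 z (Rlt_le_trans _ _ _ Hz (Rmin_l _ _))); rewrite pow_1 in K1.
assert (Hz2 : Cmod (z - a) < d2 / (Cmod la + 1)) by (apply Rlt_le_trans with (1 := Hz), Rmin_r).
assert (K3 : Cmod (phi z - a) < d2).
{ apply Rle_lt_trans with (1 := K1). replace d2 with ((Cmod la + 1) * (d2 / (Cmod la + 1))) by (field; lra).
  apply Rmult_lt_compat_l; lra. }
replace (f (phi z) - al * (phi z - a) ^ n - 0 * (z - a) ^ n)%C with (f (phi z) - al * (phi z - a) ^ n)%C by ring.
apply Rle_trans with (1 := K2 _ K3).
apply Rle_trans with (eps / (Cmod la + 1) ^ n * ((Cmod la + 1) * Cmod (z - a)) ^ n).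
- apply Rmult_le_compat_l; [left; now apply Rdiv_lt_0_compat|]. apply pow_incr; split; [apply Cmod_ge_0|easy].
- rewrite Rpow_mult_distr; right; field; lra.
Qed.

(** * The Hardy space *)

Notation ip := H2_inner.
Notation hn := (ip_norm H2_inner).

Lemma H2_inner_csums (f g : H2) : csums (fun n => h2_coef f n * Cconj (h2_coef g n))%C (ip f g).
Proof. apply is_series_csums, H2_inner_is_series. Qed.

Lemma H2_pser (f : H2) (z : disk) : pser (h2_coef f) z (f z).
Proof. apply is_pseries_pser, h2_taylor. Qed.

(** The partial sums of [|f_n| ^ 2] are real, hence so is their limit. *)
Lemma H2_inner_self (f : H2) : ip f f = RtoC (Re (ip f f)).
Proof.
apply (cvto_unique (csum (fun n => h2_coef f n * Cconj (h2_coef f n))%C)); [apply H2_inner_csums|].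
pose proof (H2_inner_csums f f) as H. intros eps He; destruct (H eps He) as [N HN]; exists N; intros n Hn.
specialize (HN n Hn).
rewrite (csum_ext _ (fun k => RtoC (Cmod (h2_coef f k) ^ 2))) in * by (intros; now rewrite sq_conj).
rewrite csum_RtoC in *. rewrite <- RtoC_minus, Cmod_R.
apply Rle_lt_trans with (2 := HN). exact (re_le_Cmod (RtoC _ - ip f f)).
Qed.

Lemma H2_norm_sq_partial (f : H2) n : rsum (fun k => Cmod (h2_coef f k) ^ 2) n <= Re (ip f f).
Proof.
apply rsum_le_limit; [intros; apply pow2_ge_0|]. rewrite <- H2_inner_self.
apply (csums_ext (fun k => h2_coef f k * Cconj (h2_coef f k))%C); [intros; now rewrite sq_conj|].
apply H2_inner_csums.
Qed.

Lemma H2_inner_self_pos (f : H2) : 0 <= Re (ip f f).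
Proof. exact (H2_norm_sq_partial f 0). Qed.

Lemma H2_norm_pos (f : H2) : 0 <= hn f.
Proof. apply sqrt_pos. Qed.

Lemma H2_norm_sq (f : H2) : hn f ^ 2 = Re (ip f f).
Proof. unfold ip_norm. simpl; rewrite Rmult_1_r. apply sqrt_sqrt, H2_inner_self_pos. Qed.

Lemma H2_norm_partial (f : H2) n : rsum (fun k => Cmod (h2_coef f k) ^ 2) n <= hn f ^ 2.
Proof. rewrite H2_norm_sq; apply H2_norm_sq_partial. Qed.

Lemma H2_norm_le (f : H2) B : 0 <= B -> (forall n, rsum (fun k => Cmod (h2_coef f k) ^ 2) n <= B ^ 2) -> hn f <= B.
Proof.
intros HB H. apply sq_le_sq; [easy|]. rewrite H2_norm_sq.
apply (cvto_Re_le (csum (fun n => h2_coef f n * Cconj (h2_coef f n))%C)); [|apply H2_inner_csums].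
exists O; intros n _. rewrite (csum_ext _ (fun k => RtoC (Cmod (h2_coef f k) ^ 2))) by (intros; now rewrite sq_conj).
rewrite csum_RtoC, re_RtoC; auto.
Qed.

Lemma H2_coef_le (f : H2) n : Cmod (h2_coef f n) <= hn f.
Proof.
apply sq_le_sq; [apply H2_norm_pos|]. apply Rle_trans with (2 := H2_norm_partial f (S n)).
simpl rsum. pose proof (rsum_pos (fun k => Cmod (h2_coef f k) ^ 2) n ltac:(intros; apply pow2_ge_0)). simpl in *; lra.
Qed.

Lemma H2_abs_bound (f : H2) s n : 0 <= s < 1 -> rsum (fun k => Cmod (h2_coef f k) * s ^ k) n <= hn f / (1 - s).
Proof.
intros Hs; apply rsum_geom; [apply H2_norm_pos|easy|].
intros k; apply Rmult_le_compat_r; [apply pow_le; lra|apply H2_coef_le].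
Qed.

Lemma H2_eval_le (f : H2) (z : disk) : Cmod (f z) <= hn f / (1 - Cmod z).
Proof.
apply (csums_le _ _ _ (H2_pser f z)). intros n.
rewrite (rsum_ext_lt _ (fun k => Cmod (h2_coef f k) * Cmod z ^ k)) by (intros; now rewrite Cmod_mult, Cmod_pow).
apply H2_abs_bound; split; [apply Cmod_ge_0|apply disk_lt1].
Qed.

(** Square-summable coefficients are bounded, so the power series converges on the disk. *)
Lemma H2_of_coef (a : nat -> C) B : (forall n, rsum (fun k => Cmod (a k) ^ 2) n <= B) ->
  exists f : H2, forall n, h2_coef f n = a n.
Proof.
intros HB.
assert (B0 : 0 <= B) by exact (HB O).
assert (Ha : forall n, Cmod (a n) <= sqrt B).
{ intros n; apply sq_le_sq; [apply sqrt_pos|]. simpl (sqrt B ^ 2); rewrite Rmult_1_r, sqrt_sqrt by easy.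
  apply Rle_trans with (2 := HB (S n)). simpl rsum.
  pose proof (rsum_pos (fun k => Cmod (a k) ^ 2) n ltac:(intros; apply pow2_ge_0)). simpl in *; lra. }
assert (E : forall z : disk, exists l, pser a z l).
{ intros z. apply (csums_dominated _ (fun k => sqrt B * Cmod z ^ k) (sqrt B / (1 - Cmod z))).
  - intros n; rewrite Cmod_mult, Cmod_pow. apply Rmult_le_compat_r; [apply pow_le, Cmod_ge_0|easy].
  - intros n; apply rsum_geom; [apply sqrt_pos|split; [apply Cmod_ge_0|apply disk_lt1]|intros; lra]. }
set (F := fun z => proj1_sig (constructive_indefinite_description _ (E z))).
assert (HF : forall z : disk, is_pseries (K := C_AbsRing) (V := C_NormedModule) a (z : C) (F z)).
{ intros z; apply is_pseries_pser. exact (proj2_sig (constructive_indefinite_description _ (E z))). }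
exists (mkH2 F a HF (ex_series_bounded _ B ltac:(intros; apply pow2_ge_0) HB)); easy.
Qed.

Definition disk0 : disk := Disk 0 ltac:(rewrite Cmod_0; lra).

Lemma global_tseries (F : disk -> C) a : (forall z : disk, pser a z (F z)) <-> tseries F disk0 a 1.
Proof.
assert (E : forall z : disk, (z - disk0)%C = z) by (intros; simpl; ring).
split.
- intros H; split; [lra|]. intros z _; rewrite E; apply H.
- intros [_ H] z; rewrite <- E; apply H; rewrite E; apply disk_lt1.
Qed.

Lemma H2_eq (f g : H2) : (forall z, f z = g z) -> f = g.
Proof.
intros E; apply H2_ext; [easy|]. apply (tseries_unique f disk0 _ _ 1 1).
- apply global_tseries, H2_pser.
- apply (tseries_ext g); [easy|]. apply global_tseries, H2_pser.
Qed.

Lemma H2_eq_coef (f g : H2) : (forall n, h2_coef f n = h2_coef g n) -> f = g.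
Proof.
intros E; apply H2_eq; intros z. apply (cvto_unique (csum (fun n => h2_coef f n * z ^ n)%C)); [apply H2_pser|].
apply (csums_ext (fun n => h2_coef g n * z ^ n)%C); [intros; now rewrite E|apply H2_pser].
Qed.

(** ** Inner product algebra *)

Lemma ip_plus_l (f g h : H2) : ip (plus f g) h = (ip f h + ip g h)%C.
Proof.
apply (cvto_unique _ _ _ (H2_inner_csums (plus f g) h)).
apply (csums_ext (fun n => h2_coef f n * Cconj (h2_coef h n) + h2_coef g n * Cconj (h2_coef h n))%C).
- intros n; change (h2_coef (plus f g) n) with (h2_coef f n + h2_coef g n)%C; ring.
- apply csums_plus; apply H2_inner_csums.
Qed.

Lemma ip_scal_l c (f h : H2) : ip (scal c f) h = (c * ip f h)%C.
Proof.
apply (cvto_unique _ _ _ (H2_inner_csums (scal c f) h)).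
apply (csums_ext (fun n => c * (h2_coef f n * Cconj (h2_coef h n)))%C).
- intros n; change (h2_coef (scal c f) n) with (c * h2_coef f n)%C; ring.
- apply csums_scal; apply H2_inner_csums.
Qed.

Lemma ip_conj (f g : H2) : Cconj (ip f g) = ip g f.
Proof.
apply (cvto_unique (csum (fun n => h2_coef g n * Cconj (h2_coef f n))%C)); [|apply H2_inner_csums].
apply (csums_ext (fun n => Cconj (h2_coef f n * Cconj (h2_coef g n)))%C).
- intros n; rewrite Cmult_conj, Cconj_conj; ring.
- apply csums_conj, H2_inner_csums.
Qed.

Lemma ip_plus_r (f g h : H2) : ip h (plus f g) = (ip h f + ip h g)%C.
Proof. rewrite <- ip_conj, ip_plus_l, Cplus_conj, !ip_conj; easy. Qed.

Lemma ip_scal_r c (f h : H2) : ip h (scal c f) = (Cconj c * ip h f)%C.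
Proof. rewrite <- ip_conj, ip_scal_l, Cmult_conj, ip_conj; easy. Qed.

Lemma H2_minus_eq (f g : H2) : minus f g = plus f (scal (-(1))%C g).
Proof. reflexivity. Qed.

Lemma H2_minus_fun (f g : H2) z : (minus f g : H2) z = (f z - g z)%C.
Proof. rewrite H2_minus_eq. change (f z + (-(1)) * g z = f z - g z)%C; ring. Qed.

Lemma H2_minus_coef (f g : H2) n : h2_coef (minus f g) n = (h2_coef f n - h2_coef g n)%C.
Proof. rewrite H2_minus_eq. change (h2_coef f n + (-(1)) * h2_coef g n = h2_coef f n - h2_coef g n)%C; ring. Qed.

Lemma ip_minus_l (f g h : H2) : ip (minus f g) h = (ip f h - ip g h)%C.
Proof. rewrite H2_minus_eq, ip_plus_l, ip_scal_l; ring. Qed.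

Lemma ip_minus_r (f g h : H2) : ip h (minus f g) = (ip h f - ip h g)%C.
Proof. rewrite <- ip_conj, ip_minus_l, Cminus_conj, !ip_conj; easy. Qed.

Lemma cauchy_schwarz (f g : H2) : Cmod (ip f g) <= hn f * hn g.
Proof.
apply (csums_le _ _ _ (H2_inner_csums f g)); intros n.
rewrite (rsum_ext_lt _ (fun k => Cmod (h2_coef f k) * Cmod (h2_coef g k))) by (intros; now rewrite Cmod_mult, Cmod_conj).
apply rsum_cauchy_schwarz; auto using H2_norm_pos, H2_norm_partial.
Qed.

Lemma hn_plus_sq (f g : H2) : hn (plus f g) ^ 2 = hn f ^ 2 + 2 * Re (ip f g) + hn g ^ 2.
Proof.
rewrite !H2_norm_sq, ip_plus_l, !ip_plus_r, <- (ip_conj f g).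
change (Re (ip f f) + Re (ip f g) + (Re (ip f g) + Re (ip g g)) = Re (ip f f) + 2 * Re (ip f g) + Re (ip g g)). ring.
Qed.

Lemma hn_triangle (f g : H2) : hn (plus f g) <= hn f + hn g.
Proof.
pose proof (H2_norm_pos f); pose proof (H2_norm_pos g).
apply sq_le_sq; [lra|]. rewrite hn_plus_sq.
pose proof (cauchy_schwarz f g). pose proof (Re_le_Cmod (ip f g)). nra.
Qed.

Lemma hn_le_add (f g h : H2) : (forall z, f z = g z + h z)%C -> hn f <= hn g + hn h.
Proof.
intros E. replace f with (plus g h); [apply hn_triangle|].
apply H2_eq; intros z; symmetry; apply E.
Qed.

Lemma hn_scal c (f : H2) : hn (scal c f) = Cmod c * hn f.
Proof.
apply Rle_antisym; apply sq_le_sq; try (apply Rmult_le_pos; [apply Cmod_ge_0|apply H2_norm_pos]); try apply H2_norm_pos;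
rewrite Rpow_mult_distr, !H2_norm_sq, ip_scal_l, ip_scal_r, (H2_inner_self f), Cmult_assoc, <- Cmod2_conj, <- RtoC_mult, !re_RtoC; lra.
Qed.

Lemma hn_minus_sym (f g : H2) : hn (minus f g) = hn (minus g f).
Proof.
replace (minus f g) with (scal (-(1))%C (minus g f)).
- rewrite hn_scal, Cmod_opp, Cmod_1; ring.
- apply H2_eq; intros z. change ((-(1)) * (minus g f : H2) z = (minus f g : H2) z)%C. rewrite !H2_minus_fun; ring.
Qed.

Lemma hn_minus_triangle (f g h : H2) : hn (minus f h) <= hn (minus f g) + hn (minus g h).
Proof. apply hn_le_add; intros z; rewrite !H2_minus_fun; ring. Qed.

Lemma hn_zero (f : H2) : hn f = 0 -> f = H2_zero.
Proof.
intros H; apply H2_eq_coef; intros n. apply Cmod_eq_0. pose proof (H2_coef_le f n); pose proof (Cmod_ge_0 (h2_coef f n)); lra.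
Qed.

(** ** Completeness and projections *)

(** The limit has the limits of the coefficients as coefficients; the norm of
    its distance to a term of the sequence is bounded by Fatou's lemma. *)
Lemma H2_complete (g : nat -> H2) :
  (forall eps, 0 < eps -> exists N, forall n, (N <= n)%nat -> hn (minus (g n) (g N)) <= eps) ->
  exists h : H2, forall eps, 0 < eps -> exists N, hn (minus h (g N)) <= eps /\ forall n, (N <= n)%nat -> hn (minus (g n) (g N)) <= eps.
Proof.
intros HC.
assert (Hl : forall j, exists l, cvto (fun n => h2_coef (g n) j) l).
{ intros j; apply cvto_cauchy; intros eps He; destruct (HC (eps/2) ltac:(lra)) as [N HN]; exists N; intros n Hn.
  rewrite <- H2_minus_coef. apply Rle_lt_trans with (1 := H2_coef_le _ _). specialize (HN n Hn); lra. }
destruct (choice (fun j l => cvto (fun n => h2_coef (g n) j) l) Hl) as [a Ha].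
assert (Hb : forall eps N, 0 <= eps -> (forall n, (N <= n)%nat -> hn (minus (g n) (g N)) <= eps) ->
  forall J, rsum (fun j => Cmod (a j - h2_coef (g N) j) ^ 2) J <= eps ^ 2).
{ intros eps N He HN J. apply (rsum_sq_limit (fun n j => h2_coef (g n) j)); [exact Ha|].
  exists N; intros n Hn. rewrite (rsum_ext_lt _ (fun k => Cmod (h2_coef (minus (g n) (g N)) k) ^ 2))
    by (intros; now rewrite H2_minus_coef).
  apply Rle_trans with (1 := H2_norm_partial _ _). apply pow_incr; split; [apply H2_norm_pos|auto]. }
destruct (HC 1 ltac:(lra)) as [N1 HN1].
destruct (H2_of_coef _ _ (Hb 1 N1 ltac:(lra) HN1)) as [e He].
exists (plus (g N1) e); intros eps Heps.
destruct (HC eps Heps) as [N HN]; exists N; split; [|easy].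
apply H2_norm_le; [lra|]. intros J.
rewrite (rsum_ext_lt _ (fun j => Cmod (a j - h2_coef (g N) j) ^ 2)); [apply Hb; [lra|easy]|].
intros k _; rewrite H2_minus_coef.
change (h2_coef (plus (g N1) e) k) with (h2_coef (g N1) k + h2_coef e k)%C. rewrite He.
do 2 f_equal; ring.
Qed.

Fixpoint hsum (c : nat -> C) (s : nat -> H2) (n : nat) : H2 :=
  match n with O => H2_zero | S m => plus (hsum c s m) (scal (c m) (s m)) end.

Lemma hsum_fun c s n (z : disk) : hsum c s n z = csum (fun k => c k * s k z)%C n.
Proof.
induction n as [|n IH]; [easy|].
change (hsum c s n z + c n * s n z = csum (fun k => c k * s k z) (S n))%C. rewrite IH; easy.
Qed.

Lemma hsum_sum_n c s n : sum_n (fun k => scal (c k) (s k)) n = hsum c s (S n).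
Proof.
induction n as [|n IH]; [rewrite sum_O; symmetry; apply (plus_zero_l (scal (c O) (s O)))|]. rewrite sum_Sn, IH; easy.
Qed.

Lemma in_span_hsum (s : nat -> H2) (g : H2) : in_span s g <-> exists n c, g = hsum c s n.
Proof.
split.
- intros [N [c E]]; exists (S N), c. now rewrite <- hsum_sum_n.
- intros [n [c E]]. exists n, (fun k => if (k <? n)%nat then c k else 0). rewrite hsum_sum_n, E.
  apply H2_eq; intros z; rewrite !hsum_fun. cbn [csum]. destruct (Nat.ltb_spec n n); [lia|].
  rewrite (csum_ext_lt (fun k => (if (k <? n)%nat then c k else 0) * s k z)%C (fun k => c k * s k z)%C).
  + ring.
  + intros k Hk; destruct (Nat.ltb_spec k n); [easy|lia].
Qed.

Lemma in_span_combine (s : nat -> H2) (g h : H2) x : in_span s g -> in_span s h -> in_span s (plus g (scal x h)).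
Proof.
rewrite !in_span_hsum; intros [n [c ->]] [m [d ->]].
exists (n + m)%nat, (fun k => (if (k <? n)%nat then c k else 0) + x * (if (k <? m)%nat then d k else 0))%C.
apply H2_eq; intros z.
change (hsum c s n z + x * hsum d s m z = hsum (fun k => (if (k <? n)%nat then c k else 0) + x * (if (k <? m)%nat then d k else 0)) s (n + m) z)%C.
rewrite !hsum_fun.
assert (E : forall (e : nat -> C) p q, csum (fun k => e k * s k z)%C p = csum (fun k => (if (k <? p)%nat then e k else 0) * s k z)%C (p + q)).
{ intros e p q; induction q as [|q IH].
  - rewrite Nat.add_0_r; apply csum_ext_lt; intros k Hk. destruct (Nat.ltb_spec k p); [easy|lia].
  - rewrite Nat.add_succ_r; simpl; rewrite <- IH. destruct (Nat.ltb_spec (p + q) p); [lia|ring]. }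
rewrite (E c n m), (E d m n), (Nat.add_comm m n), <- csum_scal, <- csum_plus.
apply csum_ext; intros; ring.
Qed.

Lemma in_span_scal (s : nat -> H2) (g : H2) x : in_span s g -> in_span s (scal x g).
Proof.
intros H. replace (scal x g) with (plus g (scal (x - 1)%C g)); [now apply in_span_combine|].
apply H2_eq; intros z. change (g z + (x - 1) * g z = x * g z)%C; ring.
Qed.

Lemma in_span_term (s : nat -> H2) n : in_span s (s n).
Proof.
apply in_span_hsum; exists (S n), (fun k => if (k =? n)%nat then 1 else 0).
apply H2_eq; intros z; rewrite hsum_fun. simpl. rewrite Nat.eqb_refl, csum_zero; [ring|].
intros k Hk; destruct (Nat.eqb_spec k n); [lia|ring].
Qed.

(** If some [f] is at distance [d > 0] from the span, a minimising sequence is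
    Cauchy by the parallelogram identity. Its limit [h] is a nearest point, so
    [f - h] is orthogonal to the sequence, and vanishes by assumption, contrary
    to [d > 0]. *)
Lemma complete_of_orthogonal (s : nat -> H2) :
  (forall f : H2, (forall n, ip f (s n) = 0) -> f = H2_zero) -> complete_sequence H2_inner s.
Proof.
intros Horth.
enough (K : forall (f : H2) eps0, 0 < eps0 ->
  ~ ~ exists g : H2, in_span s g /\ hn (minus f g) < eps0) by (intros f eps He; exact (NNPP _ (K f eps He))).
intros f eps0 He0 Far.
set (D := fun x => exists g : H2, in_span s g /\ x = - hn (minus f g)).
assert (Z0 : in_span s H2_zero) by (apply in_span_hsum; exists O, (fun _ => RtoC 0); easy).
destruct (completeness D) as [d' [Hd1 Hd2]].
{ exists 0; intros x [g [_ ->]]. pose proof (H2_norm_pos (minus f g)); lra. }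
{ exists (- hn (minus f H2_zero)), H2_zero; easy. }
set (d := - d').
assert (Hd : eps0 <= d).
{ unfold d; assert (d' <= - eps0); [|lra]. apply Hd2; intros x [g [Hg ->]].
  apply Ropp_le_contravar, Rnot_lt_le; intros L; apply Far; now exists g. }
assert (Hlow : forall g : H2, in_span s g -> d <= hn (minus f g)).
{ intros g Hg. specialize (Hd1 (- hn (minus f g)) ltac:(now exists g)). unfold d; lra. }
assert (Happ : forall k : nat, exists g : H2, in_span s g /\ hn (minus f g) < d + / INR (S k)).
{ intros k. assert (0 < / INR (S k)) by (apply Rinv_0_lt_compat, lt_0_INR; lia).
  apply NNPP; intros N. assert (d' <= d' - / INR (S k)); [|lra].
  apply Hd2; intros x [g [Hg ->]]. apply Rnot_lt_le; intros L. apply N; exists g; split; [easy|unfold d; lra]. }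
destruct (choice _ Happ) as [g Hg].
assert (Hmid : forall k l, hn (minus (g k) (g l)) ^ 2 <= 2 * (hn (minus f (g k)) ^ 2 - d ^ 2) + 2 * (hn (minus f (g l)) ^ 2 - d ^ 2)).
{ intros k l. set (x := minus f (g k) : H2). set (y := minus f (g l) : H2).
  set (m := plus (scal (RtoC (1/2)) (g k)) (scal (RtoC (1/2)) (g l)) : H2).
  assert (Hm : d <= hn (minus f m)).
  { apply Hlow. apply in_span_combine; [apply in_span_scal|]; apply Hg. }
  assert (E1 : plus x y = scal (RtoC 2) (minus f m)).
  { apply H2_eq; intros z. unfold x, y. change ((minus f (g k) : H2) z + (minus f (g l) : H2) z = 2 * (minus f m : H2) z)%C.
    rewrite !H2_minus_fun. change (m z) with (RtoC (1/2) * g k z + RtoC (1/2) * g l z)%C.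
    replace (RtoC (1/2)) with (/ 2)%C by (rewrite RtoC_div by lra; field; intros E; apply RtoC_inj in E; lra).
    field; intros E; apply RtoC_inj in E; lra. }
  assert (E2 : minus (g k) (g l) = plus y (scal (-(1))%C x)).
  { apply H2_eq; intros z. change ((minus (g k) (g l) : H2) z = y z + (-(1)) * x z)%C. unfold x, y; rewrite !H2_minus_fun; ring. }
  rewrite E2, hn_plus_sq, hn_scal, Cmod_opp, Cmod_1, ip_scal_r.
  pose proof (hn_plus_sq x y) as P. rewrite E1, hn_scal, Cmod_R, Rabs_pos_eq in P by lra.
  replace (Re (Cconj (-(1)) * ip y x)) with (- Re (ip x y)) by (rewrite <- (ip_conj x y); simpl; ring).
  nra. }
assert (Hk : forall k, hn (minus f (g k)) ^ 2 - d ^ 2 <= (2 * d + 1) * / INR (S k)).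
{ intros k. destruct (Hg k) as [Hs Hk]. pose proof (Hlow _ Hs).
  assert (0 < / INR (S k)) by (apply Rinv_0_lt_compat, lt_0_INR; lia).
  assert (/ INR (S k) <= 1). { rewrite <- Rinv_1; apply Rinv_le_contravar; [lra|]. rewrite S_INR; pose proof (pos_INR k); lra. }
  set (x := hn (minus f (g k))) in *. nra. }
assert (Harch : forall e, 0 < e -> exists N, forall n, (N <= n)%nat -> / INR (S n) < e).
{ intros e He. destruct (archimed_cor1 e He) as [N [HN1 HN2]]; exists N; intros n Hn.
  apply Rle_lt_trans with (2 := HN1). apply Rinv_le_contravar; [now apply lt_0_INR|apply le_INR; lia]. }
destruct (H2_complete g) as [h Hh].
{ intros e He. destruct (Harch (e ^ 2 / (4 * (2 * d + 1)))) as [N HN]; [apply Rdiv_lt_0_compat; nra|].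
  exists N; intros n Hn. apply sq_le_sq; [lra|]. apply Rle_trans with (1 := Hmid n N).
  pose proof (Hk n); pose proof (Hk N). pose proof (HN n Hn); pose proof (HN N (le_n N)).
  assert ((2 * d + 1) * (e ^ 2 / (4 * (2 * d + 1))) = e ^ 2 / 4) by (field; lra).
  assert ((2 * d + 1) * / INR (S n) <= e ^ 2 / 4) by (rewrite <- H3; apply Rmult_le_compat_l; lra).
  assert ((2 * d + 1) * / INR (S N) <= e ^ 2 / 4) by (rewrite <- H3; apply Rmult_le_compat_l; lra).
  lra. }
set (r := minus f h : H2).
assert (Hr1 : hn r <= d).
{ apply Rnot_lt_le; intros L.
  destruct (Hh ((hn r - d) / 4) ltac:(lra)) as [N [HN1 HN2]].
  destruct (Harch ((hn r - d) / 4) ltac:(lra)) as [M HM].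
  specialize (HN2 (N + M)%nat ltac:(lia)). specialize (HM (N + M)%nat ltac:(lia)).
  destruct (Hg (N + M)%nat) as [_ Hg2]. set (n := (N + M)%nat) in *.
  pose proof (hn_minus_triangle f (g N) h) as T1.
  pose proof (hn_minus_triangle f (g n) (g N)) as T2.
  rewrite (hn_minus_sym (g N) h) in T1. change (hn (minus f h)) with (hn r) in T1. lra. }
assert (Hr2 : forall u : H2, in_span s u -> d <= hn (minus r u)).
{ intros u Hu. apply Rnot_lt_le; intros L.
  destruct (Hh ((d - hn (minus r u)) / 2) ltac:(lra)) as [N [HN1 _]].
  assert (Q : in_span s (plus (g N) (scal (RtoC 1) u))) by (apply in_span_combine; [apply Hg|easy]).
  pose proof (Hlow _ Q) as P.
  pose proof (hn_le_add (minus f (plus (g N) (scal (RtoC 1) u))) (minus r u) (minus h (g N))) as T.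
  assert (hn (minus f (plus (g N) (scal (RtoC 1) u))) <= hn (minus r u) + hn (minus h (g N))); [|lra].
  apply T; intros z. unfold r; rewrite !H2_minus_fun.
  change ((plus (g N) (scal (RtoC 1) u) : H2) z) with (g N z + 1 * u z)%C. ring. }
assert (Hr : r = H2_zero).
{ apply Horth; intros n. apply Cmod_eq_0. set (X := ip r (s n)).
  destruct (Req_dec (Cmod X) 0) as [|NX]; [easy|exfalso]. pose proof (Cmod_ge_0 X).
  set (S2 := hn (s n) ^ 2). assert (0 <= S2) by apply pow2_ge_0.
  (* moving from [r] along [s n] by [t X], with [t] small, would bring it closer to 0 *)
  set (t := / (S2 + 1)). assert (Ht : 0 < t) by (apply Rinv_0_lt_compat; lra).
  assert (Hu : in_span s (scal (RtoC t * X)%C (s n))).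
  { apply in_span_scal, in_span_term. }
  pose proof (Hr2 _ Hu) as P. rewrite H2_minus_eq in P.
  assert (P2 : d ^ 2 <= hn (plus r (scal (- (1))%C (scal (RtoC t * X)%C (s n)))) ^ 2) by (apply pow_incr; lra).
  rewrite hn_plus_sq, !hn_scal, !ip_scal_r, Cmod_opp, Cmod_1 in P2. fold X in P2.
  rewrite Cmod_mult, Cmod_R, Rabs_pos_eq in P2 by lra.
  replace (Re (Cconj (-(1)) * (Cconj (RtoC t * X) * X))) with (- (t * Cmod X ^ 2)) in P2.
  2:{ rewrite Cmult_conj. replace (Cconj (-(1)) * (Cconj (RtoC t) * Cconj X * X))%C with (RtoC (- (t * Cmod X ^ 2))).
      - now rewrite re_RtoC.
      - rewrite RtoC_opp, RtoC_mult, sq_conj. rewrite Cconj_RtoC.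
        rewrite Copp_conj, Cconj_RtoC. ring. }
  assert (P3 : (1 * (t * Cmod X * hn (s n))) ^ 2 = t ^ 2 * Cmod X ^ 2 * S2) by (unfold S2; ring).
  rewrite P3 in P2. assert (P4 : hn r ^ 2 <= d ^ 2) by (apply pow_incr; split; [apply H2_norm_pos|easy]).
  assert (P5 : 2 * t * Cmod X ^ 2 <= t ^ 2 * Cmod X ^ 2 * S2) by lra.
  assert (P6 : 0 < t * Cmod X ^ 2) by (apply Rmult_lt_0_compat; [easy|apply pow_lt; lra]).
  assert (P7 : t * S2 <= 1).
  { unfold t; apply Rmult_le_reg_l with (S2 + 1); [lra|]. rewrite <- Rmult_assoc, Rinv_r; lra. }
  nra. }
assert (hn r = 0).
{ rewrite Hr. apply Rle_antisym; [|apply H2_norm_pos]. apply H2_norm_le; [lra|].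
  intros n; right. rewrite (rsum_ext_lt _ (fun _ => 0)); [rewrite rsum_const; ring|]. intros k _; simpl; rewrite Cmod_0; ring. }
pose proof (Hr2 H2_zero Z0) as P. rewrite H2_minus_eq in P. pose proof (hn_triangle r (scal (-(1))%C H2_zero)) as Q.
rewrite hn_scal in Q. assert (hn H2_zero = 0) as Ez by now rewrite <- Hr. rewrite Ez in Q. lra.
Qed.

(** A bounded linear functional that vanishes on a dense subspace is zero. *)
Lemma complete_functional (s : nat -> H2) (L : H2 -> C) B : complete_sequence H2_inner s ->
  (forall f g : H2, L (plus f g) = (L f + L g)%C) -> (forall (c : C) (f : H2), L (scal c f) = (c * L f)%C) ->
  (forall f, Cmod (L f) <= B * hn f) -> (forall n, L (s n) = 0) -> forall f, L f = 0.
Proof.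
intros Hs HP HS HB Hn f. apply Cmod_eq_0. apply Rle_antisym; [|apply Cmod_ge_0].
apply Rnot_lt_le; intros Pos. pose proof (Rabs_pos B).
destruct (Hs f (Cmod (L f) / (Rabs B + 1))) as [g' Hg']; [apply Rdiv_lt_0_compat; lra|].
pose (g := g' : H2). change (in_span s g /\ hn (minus f g) < Cmod (L f) / (Rabs B + 1)) in Hg'.
clearbody g; clear g'; destruct Hg' as [Hg Hfg].
assert (Lg : L g = 0).
{ apply in_span_hsum in Hg; destruct Hg as [n [c ->]]. clear Hfg. induction n as [|n IH]; simpl.
  - replace H2_zero with (scal (RtoC 0) (H2_zero : H2)); [rewrite HS; ring|].
    apply H2_eq; intros z; exact (Cmult_0_l _).
  - rewrite HP, HS, IH, Hn; ring. }
assert (E : L (minus f g) = L f) by (rewrite H2_minus_eq, HP, HS, Lg; ring).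
pose proof (HB (minus f g)) as Q; rewrite E in Q.
pose proof (H2_norm_pos (minus f g)). pose proof (Rle_abs B).
assert (Q2 : Cmod (L f) < (Rabs B + 1) * (Cmod (L f) / (Rabs B + 1))).
{ apply Rle_lt_trans with ((Rabs B + 1) * hn (minus f g)); [nra|]. apply Rmult_lt_compat_l; lra. }
replace ((Rabs B + 1) * (Cmod (L f) / (Rabs B + 1))) with (Cmod (L f)) in Q2 by (field; lra). lra.
Qed.

(** ** Taylor coefficients at an arbitrary point *)

(** The inner product of [f] with this element is the [n]-th coefficient of the
    expansion of [f] at [c]. It is square summable because its [m]-th coefficient
    is at most [(|c| + s) ^ m / s ^ n], where [s] is taken so that [|c| + s < 1]. *)
Lemma taylor_kernel (c : disk) n : exists K : H2, forall m, h2_coef K m = Cconj (tc c m n).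
Proof.
pose proof (disk_lt1 c). pose proof (Cmod_ge_0 c). set (s := (1 - Cmod c) / 2). set (q := (Cmod c + s)).
assert (0 < s) by (unfold s; lra). assert (0 <= q < 1) by (unfold q, s; lra).
assert (0 < s ^ n) by (now apply pow_lt).
apply (H2_of_coef _ ((/ s ^ n) ^ 2 / (1 - q ^ 2))). intros N. apply rsum_geom; [apply pow2_ge_0|nra|].
intros k. rewrite Cmod_conj, <- pow_mult, Nat.mul_comm, pow_mult, <- Rpow_mult_distr.
apply pow_incr; split; [apply Cmod_ge_0|]. pose proof (tc_le c s k n ltac:(easy)) as Q. fold q in Q. unfold Rdiv in Q; lra.
Qed.

Definition tker (c : disk) (n : nat) : H2 := proj1_sig (constructive_indefinite_description _ (taylor_kernel c n)).

Lemma tker_tseries (f : H2) (c : disk) : tseries f c (fun n => ip f (tker c n)) (1 - Cmod c).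
Proof.
pose proof (disk_lt1 c). split; [lra|]. intros z Hz.
apply (pser_recenter (h2_coef f) _ c _ _ (hn f / (1 - (Cmod c + Cmod (z - c))))).
- intros N; apply H2_abs_bound. pose proof (Cmod_ge_0 c); pose proof (Cmod_ge_0 (z - c)); lra.
- intros n. apply (csums_ext (fun m => h2_coef f m * Cconj (h2_coef (tker c n) m))%C); [|apply H2_inner_csums].
  intros m; unfold tker. destruct (constructive_indefinite_description _ (taylor_kernel c n)) as [K HK]; simpl.
  now rewrite HK, Cconj_conj.
- replace (c + (z - c))%C with (z : C) by ring. apply H2_pser.
Qed.

Lemma H2_analytic (f : H2) : analytic f.
Proof. apply analytic_tseries; intros c; eexists; eexists; apply tker_tseries. Qed.

(** * Koenigs' theorem *)

(** [disk_derive] is a limit of difference quotients of the extension by 0,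
    which agrees with [f] near [c]. *)
Lemma analytic_derive (f : disk -> C) (c : disk) : analytic f ->
  asymp (fun z => f z - f c)%C c 1 (disk_derive f c).
Proof.
intros Hf. destruct (proj1 (analytic_tseries f) Hf c) as [b [r Hr]].
assert (K : asymp (fun z => f z - f c)%C c 1 (b 1%nat)).
{ apply (asymp_ext (fun z => f z - csum (fun k => b k * (z - c) ^ k) 1)%C); [|now apply (tseries_tail _ _ _ r)].
  intros z; simpl; rewrite (tseries_at _ _ _ _ Hr); ring. }
replace (disk_derive f c) with (b 1%nat); [easy|symmetry].
pose proof (disk_lt1 c) as Hc. pose proof (Cmod_ge_0 c).
assert (Ec : extend0 f c = f c).
{ unfold extend0. destruct (Rlt_dec (Cmod c) 1) as [h|]; [|easy]. destruct c as [c' h']; simpl in *.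
  now rewrite (proof_irrelevance _ h h'). }
unfold disk_derive, C_derive. apply is_C_lim_unique. apply filterlim_locally. intros eps.
assert (He : 0 < eps / 2) by (pose proof (cond_pos eps); lra).
destruct (K (eps / 2) He) as [d [Hd Kd]].
set (e := Rmin d (1 - Cmod c)). assert (0 < e) by (apply Rmin_glb_lt; lra).
assert (Hs : 0 < sqrt 2) by (apply sqrt_lt_R0; lra).
exists (mkposreal (e / sqrt 2) ltac:(apply Rdiv_lt_0_compat; lra)). intros x; change C in x; intros Hx Nx.
apply C_NormedModule_mixin_compat2 in Hx. simpl in Hx.
replace (sqrt 2 * (e / sqrt 2)) with e in Hx by (field; lra).
change (minus x (c : C)) with (x - c)%C in Hx.
assert (x - c <> 0)%C as N0 by (intros E; apply Nx, Ceq_minus, E).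
destruct (disk_near c (x - c)) as [z Hz]; [apply Rlt_le_trans with (1 := Hx), Rmin_r|].
assert (Ez : x = z :> C) by (replace x with ((x - c) + c)%C by ring; rewrite <- Hz; ring).
assert (Ex : extend0 f x = f z).
{ unfold extend0. destruct (Rlt_dec (Cmod x) 1) as [h|N]; [|exfalso; apply N; rewrite Ez; apply disk_lt1].
  destruct z as [z' h']; simpl in *; subst x. now rewrite (proof_irrelevance _ h h'). }
apply C_NormedModule_mixin_compat1. change (Cmod ((extend0 f x - extend0 f c) / (x - c) - b 1%nat) < eps).
rewrite Ex, Ec.
assert (Kz : Cmod (z - c) < d) by (rewrite Hz; apply Rlt_le_trans with (1 := Hx), Rmin_l).
specialize (Kd z Kz). rewrite Hz in Kd.
replace ((f z - f c) / (x - c) - b 1%nat)%C with ((f z - f c - b 1%nat * (x - c) ^ 1) / (x - c))%C by (field; easy).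
rewrite Cmod_div by easy. apply Cmod_gt_0 in N0. rewrite pow_1 in Kd.
apply Rle_lt_trans with (eps / 2); [|pose proof (cond_pos eps); lra].
apply Rmult_le_reg_r with (Cmod (x - c)); [easy|]. unfold Rdiv at 1. rewrite Rmult_assoc, Rinv_l, Rmult_1_r; lra.
Qed.

Lemma schroder_asymp (phi : disk -> disk) (a : disk) : schroder_map phi a ->
  asymp (fun z => phi z - a)%C a 1 (disk_derive (fun z => phi z) a).
Proof.
intros [H1 [H2 _]]. pose proof (analytic_derive _ a H1) as K. cbv beta in K. now rewrite H2 in K.
Qed.

(** The moduli of the powers are strictly decreasing. *)
Lemma Cpow_inj (l : C) n m : 0 < Cmod l < 1 -> (l ^ n)%C = (l ^ m)%C -> n = m.
Proof.
intros Hl E. apply (f_equal Cmod) in E. rewrite !Cmod_pow in E.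
assert (K : forall p q, (p < q)%nat -> Cmod l ^ q < Cmod l ^ p).
{ intros p q; induction 1 as [|q L IH]; simpl; [pose proof (pow_lt _ p (proj1 Hl)); nra|].
  pose proof (pow_lt _ q (proj1 Hl)); nra. }
destruct (Nat.lt_trichotomy n m) as [L|[L|L]]; [|easy|]; apply K in L; lra.
Qed.

(** Compare the leading terms at the fixed point on both sides of
    [f o phi = mu f]. *)
Lemma eigenvalue_of_order (phi : disk -> disk) (a : disk) f (mu al : C) k :
  schroder_map phi a -> (forall z, f (phi z) = mu * f z)%C -> al <> 0 -> asymp f a k al ->
  mu = (disk_derive (fun z => phi z) a ^ k)%C.
Proof.
intros Hphi Hf Hal H. pose proof (schroder_asymp phi a Hphi) as Hd. destruct Hphi as [_ [Ha _]].
pose proof (asymp_comp f phi a k al _ Ha Hd H) as K1.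
pose proof (asymp_scal mu _ _ _ _ H) as K2.
pose proof (asymp_unique _ a k _ _ (asymp_ext _ _ _ _ _ Hf K1) K2) as E.
set (la := disk_derive _ _) in *. replace mu with (mu * al / al)%C by (field; easy). rewrite <- E. field; easy.
Qed.

(** By [eigenvalue_of_order], [sigma] vanishes to order exactly 1 at [a], and
    every nonzero eigenfunction for [la ^ n] to order exactly [n]. Subtracting
    the multiple of [sigma ^ n] with the same leading term leaves an
    eigenfunction for [la ^ n] of higher order, hence 0. *)
Lemma koenigs_simple (phi : disk -> disk) (a : disk) sigma f n :
  schroder_map phi a -> koenigs_eigenfunction phi a sigma ->
  analytic f -> (forall z, f (phi z) = disk_derive (fun z => phi z) a ^ n * f z)%C ->
  exists c : C, forall z, f z = (c * sigma z ^ n)%C.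
Proof.
intros Hphi [Hs1 [[z0 Hz0] Hs2]] Hf Hfn.
assert (Hl : 0 < Cmod (disk_derive (fun z => phi z) a) < 1) by apply Hphi.
destruct (analytic_leading sigma a z0 Hs1 Hz0) as [k [al [Hal Hs]]].
assert (k = 1)%nat as ->.
{ apply (Cpow_inj _ _ _ Hl). rewrite <- (eigenvalue_of_order phi a sigma _ al k Hphi Hs2 Hal Hs). simpl; ring. }
set (la := disk_derive (fun z => phi z) a) in *.
destruct (classic (exists z, f z <> 0)) as [[z1 Hz1]|N].
2:{ exists 0; intros z. rewrite Cmult_0_l. apply NNPP; intros Hz; apply N; now exists z. }
destruct (analytic_leading f a z1 Hf Hz1) as [k [be [Hbe Hk]]].
assert (k = n) as ->.
{ apply (Cpow_inj _ _ _ Hl). symmetry; exact (eigenvalue_of_order phi a f _ be k Hphi Hfn Hbe Hk). }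
exists (be / al ^ n)%C. intros z. apply NNPP; intros Hz.
set (g := fun z => (f z - be / al ^ n * sigma z ^ n)%C).
assert (Hg0 : asymp g a n 0).
{ replace (RtoC 0) with (be - be / al ^ n * al ^ n)%C by (field; now apply Cpow_nz).
  apply asymp_minus; [easy|]. now apply asymp_scal, asymp_pow. }
assert (Hga : analytic g).
{ apply (analytic_minus f); [easy|]. apply (analytic_scal _ (fun z => sigma z ^ n)%C), analytic_pow, Hs1. }
assert (Hgz : g z <> 0) by (intros E; apply Hz, Ceq_minus, E).
destruct (analytic_leading g a z Hga Hgz) as [k [ga [Hga2 Hk2]]].
assert (k = n) as ->.
{ apply (Cpow_inj _ _ _ Hl). symmetry. refine (eigenvalue_of_order phi a g _ ga k Hphi _ Hga2 Hk2).
  intros x; unfold g. rewrite Hfn, Hs2. fold la. rewrite Cpow_mult_l. ring. }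
apply Hga2. exact (asymp_unique _ _ _ _ _ Hk2 Hg0).
Qed.

(** * Polynomials in the Hardy space *)

Lemma H2_of_pser (a : nat -> C) (F : disk -> C) B :
  (forall z : disk, pser a z (F z)) -> (forall n, rsum (fun k => Cmod (a k) ^ 2) n <= B) ->
  exists f : H2, (forall z, f z = F z) /\ forall n, h2_coef f n = a n.
Proof.
intros HF HB. destruct (H2_of_coef a B HB) as [f Hf]. exists f; split; [|easy].
intros z. apply (cvto_unique (csum (fun n => h2_coef f n * z ^ n)%C)); [apply H2_pser|].
apply (csums_ext (fun n => a n * z ^ n)%C); [intros; now rewrite Hf|apply HF].
Qed.

Lemma H2_shift_ex (f : H2) : exists g : H2, forall z : disk, g z = (z * f z)%C.
Proof.
destruct (H2_of_pser (fun n => match n with O => RtoC 0 | S m => h2_coef f m end)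
  (fun z : disk => z * f z)%C (hn f ^ 2)) as [g [Hg _]]; [| |now exists g].
- intros z. unfold pser.
  apply (csums_ext (fun m => if (m <? 1)%nat then RtoC 0 else ((fun k => z * (h2_coef f k * z ^ k)) (m - 1)%nat)%C)).
  + intros [|m]; [simpl; ring|]. simpl. rewrite Nat.sub_0_r. ring.
  + apply (csums_shift (fun k => z * (h2_coef f k * z ^ k))%C _ 1). apply csums_scal, H2_pser.
- intros [|n]; [simpl; apply pow2_ge_0|]. rewrite rsum_first, Cmod_0.
  pose proof (H2_norm_partial f n). simpl in *; lra.
Qed.

Lemma H2_const_ex (k : C) : exists g : H2, forall z, g z = k.
Proof.
destruct (H2_of_pser (fun n => match n with O => k | S _ => RtoC 0 end) (fun _ => k) (Cmod k ^ 2)) as [g [Hg _]];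
  [| |now exists g].
- intros z. set (u := fun n => (match n with O => k | S _ => 0 end * z ^ n)%C).
  assert (E : csums u (csum u 1)).
  { apply csums_finite; intros n Hn; unfold u; destruct n; [lia|ring]. }
  replace (csum u 1) with k in E by (unfold u; simpl; ring). exact E.
- intros [|n]; [apply pow2_ge_0|]. rewrite rsum_first, (rsum_ext_lt _ (fun _ => 0)), rsum_const.
  + lra.
  + intros; rewrite Cmod_0; ring.
Qed.

Lemma H2_centered_power (a : disk) n : exists e : H2, forall z : disk, e z = ((z - a) ^ n)%C.
Proof.
induction n as [|n [e IH]]; [exact (H2_const_ex 1)|].
destruct (H2_shift_ex e) as [g Hg]. exists (minus g (scal (a : C) e)).
intros z. rewrite H2_minus_fun, Hg. change (scal (a : C) e z) with (a * e z)%C. rewrite IH. simpl; ring.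
Qed.

Lemma ip_hsum_l c s n (h : H2) : ip (hsum c s n) h = csum (fun k => c k * ip (s k) h)%C n.
Proof.
induction n as [|n IH]; simpl.
- replace H2_zero with (scal (RtoC 0) H2_zero); [rewrite ip_scal_l; ring|]. apply H2_eq; intros z; exact (Cmult_0_l _).
- now rewrite ip_plus_l, ip_scal_l, IH.
Qed.

Lemma ip_hsum_r c s n (h : H2) : ip h (hsum c s n) = csum (fun k => Cconj (c k) * ip h (s k))%C n.
Proof.
rewrite <- ip_conj, ip_hsum_l, csum_conj. apply csum_ext; intros k. now rewrite Cmult_conj, ip_conj.
Qed.

(** Test against [g - h]. *)
Lemma ip_nondegenerate (g h : H2) : (forall f, ip f g = ip f h) -> g = h.
Proof.
intros E. assert (K : minus g h = H2_zero).
{ apply hn_zero. pose proof (H2_norm_sq (minus g h)) as Q. rewrite ip_minus_r, E in Q.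
  replace (ip (minus g h) h - ip (minus g h) h)%C with (RtoC 0) in Q by ring. rewrite re_RtoC in Q.
  pose proof (H2_norm_pos (minus g h)). nra. }
apply H2_eq; intros z. apply Ceq_minus. rewrite <- H2_minus_fun, K. easy.
Qed.

(** * From complex symmetry to the Koenigs sequence *)

Lemma ip_centered_power (a : disk) m n (e : H2) : (forall z : disk, e z = ((z - a) ^ m)%C) ->
  (n <= m)%nat -> ip e (tker a n) = if (n =? m)%nat then 1 else 0.
Proof.
intros He Hn. assert (K : asymp e a m 1).
{ intros eps Heps; exists 1; split; [lra|]; intros z _. rewrite He.
  replace ((z - a) ^ m - 1 * (z - a) ^ m)%C with (RtoC 0) by ring. rewrite Cmod_0.
  apply Rmult_le_pos; [lra|apply pow_le, Cmod_ge_0]. }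
destruct (asymp_tseries _ _ _ _ _ _ (tker_tseries e a) K) as [K1 K2].
destruct (Nat.eqb_spec n m) as [->|N]; [easy|]. apply K1; lia.
Qed.

(** Subtracting from [f] its Taylor polynomial of degree less than [n] at [a]
    leaves a function that vanishes to order [n], and composition multiplies the
    leading coefficient of such a function by [la ^ n]. So [A j] is the [n]-th
    coefficient at [a] of the composition of [(z - a) ^ j] with [phi]. *)
Lemma composition_triangular (phi : disk -> disk) (a : disk) (T : H2 -> H2) n :
  schroder_map phi a -> is_composition_operator phi T ->
  exists A : nat -> C, forall f : H2,
    ip (T f) (tker a n) = (disk_derive (fun z => phi z) a ^ n * ip f (tker a n)
      + csum (fun j => A j * ip f (tker a j)) n)%C.
Proof.
intros Hphi HT.
destruct (choice _ (H2_centered_power a)) as [e He].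
exists (fun j => ip (T (e j)) (tker a n)). intros f.
set (la := disk_derive (fun z => phi z) a).
set (l := fun j => ip f (tker a j)).
set (g := minus f (hsum l e n)).
assert (Kg : asymp g a n (l n)).
{ apply (asymp_ext (fun z => f z - csum (fun k => l k * (z - a) ^ k) n)%C).
  - intros z; unfold g. rewrite H2_minus_fun, hsum_fun. apply (f_equal (fun x => f z - x)%C).
    apply csum_ext; intros k; now rewrite He.
  - apply (tseries_tail _ _ l _ n (tker_tseries f a)). }
assert (KT : asymp (T g) a n (l n * la ^ n)%C).
{ apply (asymp_ext (fun z => g (phi z))); [intros z; symmetry; apply HT|].
  apply asymp_comp; [apply Hphi|now apply schroder_asymp|easy]. }
destruct (asymp_tseries _ _ _ _ _ _ (tker_tseries (T g) a) KT) as [_ E].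
assert (ET : T f = plus (T g) (hsum l (fun j => T (e j)) n)).
{ apply H2_eq; intros z. change (T f z = T g z + hsum l (fun j => T (e j)) n z)%C.
  rewrite hsum_fun, !HT. unfold g. rewrite H2_minus_fun, hsum_fun.
  rewrite (csum_ext (fun k => l k * T (e k) z)%C (fun k => l k * e k (phi z))%C) by (intros; now rewrite HT). ring. }
rewrite ET, ip_plus_l, E, ip_hsum_l.
rewrite (csum_ext _ (fun k => ip (T (e k)) (tker a n) * ip f (tker a k))%C) by (intros; unfold l; ring).
unfold l; ring.
Qed.

(** Apply the isometry property to [J f] and [g]. *)
Lemma conjugation_ip_swap (J : H2 -> H2) (f g : H2) : conjugation H2_inner J -> ip f (J g) = ip g (J f).
Proof. intros (_ & _ & H3 & H4). rewrite <- (H4 f) at 1. apply H3. Qed.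

Lemma conjugation_hsum (J : H2 -> H2) c s n : conjugation H2_inner J ->
  J (hsum c s n) = hsum (fun k => Cconj (c k)) (fun k => J (s k)) n.
Proof.
intros HJ. destruct HJ as (H1 & H2' & _ & _). induction n as [|n IH]; simpl.
- replace H2_zero with (scal (RtoC 0) H2_zero) by (apply H2_eq; intros z; exact (Cmult_0_l _)).
  etransitivity; [exact (H2' _ _)|]. apply H2_eq; intros z.
  change (Cconj 0 * J H2_zero z = 0 * 0)%C. rewrite Cconj_RtoC. ring.
- etransitivity; [exact (H1 _ _)|]. rewrite <- IH. f_equal. exact (H2' _ _).
Qed.

(** [composition_triangular] computes the adjoint on the kernels, and
    [T J = J T^*]. *)
Lemma conjugate_kernels_triangular (phi : disk -> disk) (a : disk) (T Ts J : H2 -> H2) n :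
  schroder_map phi a -> is_composition_operator phi T -> conjugation H2_inner J ->
  is_adjoint H2_inner T Ts -> (forall f : H2, J (T f) = Ts (J f)) ->
  exists A : nat -> C, forall z, J (tker a n) (phi z) =
    (disk_derive (fun z => phi z) a ^ n * J (tker a n) z + csum (fun j => A j * J (tker a j) z) n)%C.
Proof.
intros Hphi HT HJ Had Hsym.
destruct (composition_triangular phi a T n Hphi HT) as [A HA]; exists A; intros z.
set (la := disk_derive (fun z => phi z) a) in *.
assert (E1 : Ts (tker a n) = plus (scal (Cconj (la ^ n)) (tker a n)) (hsum (fun j => Cconj (A j)) (tker a) n)).
{ apply ip_nondegenerate; intros f. rewrite <- (Had f (tker a n)), HA, ip_plus_r, ip_scal_r, ip_hsum_r, Cconj_conj.
  f_equal. apply csum_ext; intros k; now rewrite Cconj_conj. }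
pose proof HJ as (H1 & H2' & H3 & H4).
assert (E2 : T (J (tker a n)) = J (Ts (tker a n))).
{ rewrite <- (H4 (tker a n)) at 2. rewrite <- Hsym. symmetry; apply H4. }
rewrite <- HT, E2, E1.
assert (E3 : J (plus (scal (Cconj (la ^ n)) (tker a n)) (hsum (fun j => Cconj (A j)) (tker a) n))
  = plus (scal (la ^ n)%C (J (tker a n))) (hsum A (fun j => J (tker a j)) n)).
{ etransitivity; [exact (H1 _ _)|]. f_equal.
  - etransitivity; [exact (H2' _ _)|]. now rewrite Cconj_conj.
  - etransitivity; [now apply conjugation_hsum|].
    apply H2_eq; intros x; rewrite !hsum_fun; apply csum_ext; intros k; now rewrite Cconj_conj. }
rewrite E3. change ((la ^ n * J (tker a n) z + hsum A (fun j => J (tker a j)) n z)%C =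
  (la ^ n * J (tker a n) z + csum (fun j => A j * J (tker a j) z) n)%C).
now rewrite hsum_fun.
Qed.

(** The induction carries two further facts. The inner products with the
    [J (e m)] for [m > n] vanish, which shows that the eigenfunction built at the
    next stages is not zero. The [n]-th conjugated kernel is a polynomial in
    [sigma] of degree at most [n], which serves to solve the triangular system
    and, at the end, to prove completeness. *)
Lemma koenigs_power_in_H2 (phi : disk -> disk) (a : disk) sigma (T Ts J : H2 -> H2) (e : nat -> H2) :
  schroder_map phi a -> koenigs_eigenfunction phi a sigma ->
  is_composition_operator phi T -> conjugation H2_inner J ->
  is_adjoint H2_inner T Ts -> (forall f : H2, J (T f) = Ts (J f)) ->
  (forall m (z : disk), e m z = ((z - a) ^ m)%C) ->
  forall n, exists s : H2, (forall z, s z = sigma z ^ n)%C /\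
    (forall m, (n < m)%nat -> ip s (J (e m)) = 0) /\
    exists x : nat -> C, forall N, (n < N)%nat -> forall z, J (tker a n) z = csum (fun k => x k * sigma z ^ k)%C N.
Proof.
intros Hphi Hsig HT HJ Had Hsym He n.
assert (Hl : 0 < Cmod (disk_derive (fun z => phi z) a) < 1) by apply Hphi.
induction n as [n IH] using (well_founded_induction Nat.lt_wf_0).
destruct (choice (fun j (p : H2 * (nat -> C)) => (j < n)%nat -> (forall z, fst p z = sigma z ^ j)%C /\
    (forall m, (j < m)%nat -> ip (fst p) (J (e m)) = 0) /\
    forall N, (j < N)%nat -> forall z, J (tker a j) z = csum (fun k => snd p k * sigma z ^ k)%C N)) as [p Hp].
{ intros j; destruct (Nat.lt_ge_cases j n) as [L|L].
  - destruct (IH j L) as [s [H1 [H2' [x Hx]]]]. exists (s, x); auto.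
  - exists (H2_zero, fun _ => RtoC 0); lia. }
destruct (conjugate_kernels_triangular phi a T Ts J n Hphi HT HJ Had Hsym) as [A HA].
set (la := disk_derive (fun z => phi z) a) in *.
set (u := J (tker a n)) in *.
set (y := fun k => csum (fun j => A j * snd (p j) k)%C n).
assert (HA' : forall z, u (phi z) = (la ^ n * u z + csum (fun k => y k * sigma z ^ k) n)%C).
{ intros z; rewrite HA; f_equal. unfold y.
  rewrite (csum_ext (fun k => csum (fun j => A j * snd (p j) k) n * sigma z ^ k)%C
     (fun k => csum (fun j => A j * snd (p j) k * sigma z ^ k) n)%C) by (intros; now rewrite csum_scal_r).
  rewrite csum_switch. apply csum_ext_lt; intros j Hj. destruct (Hp j Hj) as [_ [_ H3]].
  rewrite (H3 n Hj), <- csum_scal. apply csum_ext; intros; ring. }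
(* the coefficients that diagonalise the triangular relation for [u] *)
set (X := fun k => (y k / (la ^ n - la ^ k))%C).
assert (HX : forall k, (k < n)%nat -> (y k + X k * la ^ k = la ^ n * X k)%C).
{ intros k Hk. unfold X. field. intros E. apply Ceq_minus in E. apply (Cpow_inj _ _ _ Hl) in E. lia. }
set (w := plus u (hsum X (fun j => fst (p j)) n)).
assert (Hw : forall z, w z = (u z + csum (fun k => X k * sigma z ^ k) n)%C).
{ intros z. change (u z + hsum X (fun j => fst (p j)) n z = u z + csum (fun k => X k * sigma z ^ k) n)%C.
  rewrite hsum_fun. f_equal. apply csum_ext_lt; intros k Hk. now rewrite (proj1 (Hp k Hk)). }
destruct (koenigs_simple phi a sigma w n Hphi Hsig (H2_analytic w)) as [c Hc].
{ intros z. rewrite !Hw, HA'. destruct Hsig as [_ [_ Hs]]. fold la.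
  rewrite Cmult_plus_distr_l, <- Cplus_assoc, <- csum_scal, <- csum_plus.
  f_equal. apply csum_ext_lt; intros k Hk. rewrite Hs, Cpow_mult_l. fold la.
  transitivity ((y k + X k * la ^ k) * sigma z ^ k)%C; [ring|]. rewrite HX by easy. ring. }
assert (Hwe : forall m, (n <= m)%nat -> ip w (J (e m)) = if (n =? m)%nat then 1 else 0).
{ intros m Hm. unfold w. rewrite ip_plus_l, ip_hsum_l.
  rewrite csum_zero.
  - unfold u. rewrite (proj1 (proj2 (proj2 HJ)) (tker a n) (e m)).
    rewrite (ip_centered_power a m n (e m) (He m) Hm). destruct (n =? m)%nat; ring.
  - intros k Hk. rewrite (proj1 (proj2 (Hp k Hk)) m) by lia. ring. }
assert (Hc0 : c <> 0).
{ intros ->. assert (E : w = H2_zero) by (apply H2_eq; intros z; rewrite Hc, Cmult_0_l; easy).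
  pose proof (Hwe n (le_n n)) as Q. rewrite Nat.eqb_refl, E in Q.
  replace H2_zero with (hsum X (fun j => fst (p j)) 0) in Q by easy.
  rewrite ip_hsum_l in Q. simpl in Q. symmetry in Q. now apply C1_nz in Q. }
exists (scal (/ c)%C w). split; [|split].
- intros z. change (/ c * w z = sigma z ^ n)%C. rewrite Hc. field; easy.
- intros m Hm. rewrite ip_scal_l, Hwe by lia. destruct (Nat.eqb_spec n m); [lia|ring].
- exists (fun k => if (k <? n)%nat then (- X k)%C else if (k =? n)%nat then c else 0).
  intros N HN z. replace (u z) with (csum (fun k => - X k * sigma z ^ k) n + c * sigma z ^ n)%C.
  + induction HN as [|N L IHN]; simpl.
    * destruct (Nat.ltb_spec n n); [lia|]. rewrite Nat.eqb_refl. f_equal.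
      apply csum_ext_lt; intros k Hk. destruct (Nat.ltb_spec k n); [easy|lia].
    * rewrite <- IHN. destruct (Nat.ltb_spec N n); [lia|]. destruct (Nat.eqb_spec N n); [lia|ring].
  + rewrite <- Hc, Hw. rewrite (csum_ext (fun k => - X k * sigma z ^ k)%C (fun k => (-(1)) * (X k * sigma z ^ k))%C) by (intros; ring).
    rewrite csum_scal; ring.
Qed.

Lemma conjugation_zero (J : H2 -> H2) : conjugation H2_inner J -> J H2_zero = H2_zero.
Proof. intros HJ. exact (conjugation_hsum J (fun _ => RtoC 0) (fun _ => H2_zero) 0 HJ). Qed.

(** The Taylor coefficients of [J f] at [a] are the conjugates of the inner
    products of [f] with the conjugated kernels. *)
Lemma conjugate_kernels_total (a : disk) (J : H2 -> H2) (f : H2) : conjugation H2_inner J ->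
  (forall n, ip f (J (tker a n)) = 0) -> f = H2_zero.
Proof.
intros HJ H.
assert (Hz : forall n, ip (J f) (tker a n) = 0).
{ intros n. rewrite <- ip_conj, (conjugation_ip_swap J _ _ HJ), H. apply Cconj_RtoC. }
pose proof (tker_tseries (J f) a) as K.
assert (E : J f = H2_zero).
{ apply H2_eq. apply (identity_theorem (J f) a (1 - Cmod a) (H2_analytic _)); [apply K|].
  intros z Hz'. apply (cvto_unique (csum (fun n => ip (J f) (tker a n) * (z - a) ^ n)%C)); [now apply K|].
  apply (cvto_ext (fun _ => RtoC 0)); [|apply cvto_const].
  intros n; symmetry; apply csum_zero; intros k _; rewrite Hz; ring. }
rewrite <- (proj2 (proj2 (proj2 HJ)) f), E. now apply conjugation_zero.
Qed.

(** Completeness: the span contains all conjugated kernels, which are total.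
    Orthogonality: [J (s n)] is an eigenvector of the adjoint for
    [conj (la ^ n)] and [s m] is an eigenvector of [T] for [la ^ m]. *)
Lemma koenigs_of_complex_symmetric (phi : disk -> disk) (a : disk) sigma (T : H2 -> H2) :
  schroder_map phi a -> koenigs_eigenfunction phi a sigma ->
  is_composition_operator phi T -> complex_symmetric H2_inner T ->
  exists s : nat -> H2, is_koenigs_sequence sigma s /\
    complete_sequence H2_inner s /\ conjugate_orthogonal H2_inner s.
Proof.
intros Hphi Hsig HT [_ [J [Ts [HJ [Had Hsym]]]]].
destruct (choice _ (H2_centered_power a)) as [e He].
destruct (choice _ (koenigs_power_in_H2 phi a sigma T Ts J e Hphi Hsig HT HJ Had Hsym He)) as [s Hs].
exists s. split; [intros n; apply Hs|]. split.
- apply complete_of_orthogonal. intros f Hf. apply (conjugate_kernels_total a J f HJ). intros n.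
  destruct (proj2 (proj2 (Hs n))) as [x Hx].
  replace (J (tker a n)) with (hsum x s (S n)).
  + rewrite ip_hsum_r. apply csum_zero; intros k _. rewrite Hf; ring.
  + apply H2_eq; intros z. rewrite hsum_fun, (Hx (S n) (le_n _)). apply csum_ext; intros k.
    now rewrite (proj1 (Hs k)).
- exists J; split; [easy|]. intros n m Hnm.
  set (la := disk_derive (fun z => phi z) a).
  assert (HTs : forall k, T (s k) = scal (la ^ k)%C (s k)).
  { intros k. apply H2_eq; intros z. rewrite HT. change (s k (phi z) = la ^ k * s k z)%C.
    rewrite !(proj1 (Hs k)). destruct Hsig as [_ [_ Hs']]. rewrite Hs', Cpow_mult_l. easy. }
  assert (E1 : ip (J (T (s n))) (s m) = (Cconj (la ^ n) * ip (J (s n)) (s m))%C).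
  { rewrite HTs. rewrite <- ip_scal_l. f_equal. exact (proj1 (proj2 HJ) _ _). }
  assert (E2 : ip (J (T (s n))) (s m) = (Cconj (la ^ m) * ip (J (s n)) (s m))%C).
  { rewrite (Hsym (s n)), <- ip_conj, <- (Had (s m) (J (s n))), HTs, ip_scal_l, Cmult_conj, ip_conj. easy. }
  rewrite E1 in E2. apply NNPP; intros N. apply Hnm.
  assert (Hl : 0 < Cmod la < 1) by apply Hphi. apply (Cpow_inj _ _ _ Hl).
  rewrite <- (Cconj_conj (la ^ n)), <- (Cconj_conj (la ^ m)). f_equal.
  set (Y := ip (J (s n)) (s m)) in *.
  replace (Cconj (la ^ n)) with (Cconj (la ^ n) * Y / Y)%C by (field; easy). rewrite E2. field; easy.
Qed.

(** * Averages over roots of unity *)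

Definition root1 (N : nat) : C := (cos (2 * PI / INR N), sin (2 * PI / INR N)).

Lemma root1_pow N k : (root1 N ^ k)%C = (cos (INR k * (2 * PI / INR N)), sin (INR k * (2 * PI / INR N))).
Proof.
induction k as [|k IH].
- simpl. rewrite Rmult_0_l, cos_0, sin_0; easy.
- rewrite Cpow_S, IH, S_INR, Rmult_plus_distr_r, Rmult_1_l, cos_plus, sin_plus.
  unfold root1, Cmult; simpl; f_equal; ring.
Qed.

Lemma root1_N N : (0 < N)%nat -> (root1 N ^ N)%C = 1.
Proof.
intros H. rewrite root1_pow. apply lt_0_INR in H.
replace (INR N * (2 * PI / INR N)) with (2 * PI) by (field; lra).
rewrite cos_2PI, sin_2PI; easy.
Qed.

(** The angle is strictly between 0 and a full turn, where the cosine is not 1. *)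
Lemma root1_primitive N j : (0 < j < N)%nat -> (root1 N ^ j)%C <> 1.
Proof.
intros [H1 H2] E. rewrite root1_pow in E. apply (f_equal fst) in E; simpl in E.
apply lt_INR in H1, H2. simpl in H1. set (t := INR j * (2 * PI / INR N)) in *.
assert (Ht : 0 < t / 2 < PI).
{ pose proof PI_RGT_0. unfold t. replace (INR j * (2 * PI / INR N) / 2) with (INR j / INR N * PI) by (field; lra).
  assert (0 < INR j / INR N < 1).
  { split; [apply Rdiv_lt_0_compat; lra|]. apply Rmult_lt_reg_r with (INR N); [lra|].
    unfold Rdiv; rewrite Rmult_assoc, Rinv_l; lra. }
  split; nra. }
replace t with (2 * (t / 2)) in E by field. rewrite cos_2a_sin in E.
pose proof (sin_gt_0 (t / 2) (proj1 Ht) (proj2 Ht)). nra.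
Qed.

Lemma root1_mod N : Cmod (root1 N) = 1.
Proof.
unfold Cmod, root1; simpl. rewrite !Rmult_1_r.
pose proof (sin2_cos2 (2 * PI / INR N)) as H. unfold Rsqr in H. rewrite Rplus_comm, H. apply sqrt_1.
Qed.

Lemma unimodular_conj z : Cmod z = 1 -> (z * Cconj z)%C = 1.
Proof. intros H. rewrite <- Cmod2_conj, H. f_equal; ring. Qed.

Lemma csum_const_C (c : C) n : csum (fun _ => c) n = (RtoC (INR n) * c)%C.
Proof.
induction n as [|n IH]; [simpl; ring|]. rewrite S_INR, RtoC_plus. simpl; rewrite IH; ring.
Qed.

Lemma csum_geom (q : C) n : ((q - 1) * csum (fun k => q ^ k) n = q ^ n - 1)%C.
Proof. induction n as [|n IH]; simpl; [ring|]. rewrite Cmult_plus_distr_l, IH. ring. Qed.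

(** A geometric sum whose ratio is an [N]-th root of unity, different from 1 unless [m = n]. *)
Lemma root1_orthogonal N m n : (m < N)%nat -> (n < N)%nat ->
  csum (fun k => (root1 N ^ k) ^ m * Cconj ((root1 N ^ k) ^ n))%C N = if (m =? n)%nat then RtoC (INR N) else 0.
Proof.
intros Hm Hn. set (w := root1 N). set (q := (w ^ m * Cconj (w ^ n))%C).
assert (Hw : forall k, Cmod (w ^ k) = 1) by (intros; unfold w; now rewrite Cmod_pow, root1_mod, pow1).
assert (E : forall k, ((w ^ k) ^ m * Cconj ((w ^ k) ^ n) = q ^ k)%C).
{ intros k. unfold q. rewrite Cpow_mult_l, <- Cpow_conj, <- !Cpow_mult_r, (Nat.mul_comm k m), (Nat.mul_comm k n); easy. }
rewrite (csum_ext _ (fun k => q ^ k)%C) by exact E.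
destruct (Nat.eqb_spec m n) as [->|D].
- unfold q. rewrite (unimodular_conj _ (Hw n)).
  rewrite (csum_ext _ (fun _ => RtoC 1)) by (intros; apply Cpow_1_l). rewrite csum_const_C; ring.
- assert (Hq : q <> 1).
  { intros Q. assert (Q2 : (w ^ m = w ^ n)%C).
    { transitivity (q * w ^ n)%C; [|rewrite Q; ring]. unfold q.
      rewrite <- Cmult_assoc, (Cmult_comm (Cconj _)), unimodular_conj by apply Hw. ring. }
    assert (K : forall i j, (i < j)%nat -> (j < N)%nat -> (w ^ i)%C <> (w ^ j)%C).
    { intros i j L1 L2 F. apply (root1_primitive N (j - i)); [lia|]. fold w.
      replace j with (i + (j - i))%nat in F by lia. rewrite Cpow_add_r in F.
      transitivity (Cconj (w ^ i) * (w ^ i * w ^ (j - i)))%C.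
      - rewrite Cmult_assoc, (Cmult_comm (Cconj _)), unimodular_conj by apply Hw. ring.
      - rewrite <- F, Cmult_comm, unimodular_conj by apply Hw. easy. }
    destruct (Nat.lt_trichotomy m n) as [L|[L|L]]; [|lia|].
    - exact (K m n L Hn Q2).
    - exact (K n m L Hm (eq_sym Q2)). }
  assert (G : ((q - 1) * csum (fun k => q ^ k) N)%C = 0).
  { rewrite csum_geom. replace (q ^ N)%C with (RtoC 1); [ring|]. unfold q.
    rewrite Cpow_mult_l, <- Cpow_conj, <- !Cpow_mult_r, !(Nat.mul_comm _ N), !Cpow_mult_r.
    unfold w; rewrite root1_N by lia. rewrite !Cpow_1_l. unfold Cconj, RtoC; simpl. rewrite Ropp_0.
    unfold Cmult; simpl; f_equal; ring. }
  apply NNPP; intros Z. apply (Cmult_neq_0 (q - 1)%C (csum (fun k => q ^ k)%C N)); [|exact Z|exact G].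
  intros F; apply Hq, Ceq_minus, F.
Qed.

Lemma csum_mult_csum (x y : nat -> C) n m :
  (csum x n * csum y m = csum (fun i => csum (fun j => x i * y j) m) n)%C.
Proof. rewrite <- csum_scal_r. apply csum_ext; intros i. now rewrite csum_scal. Qed.

Lemma csum_delta (x : nat -> C) (m n : nat) : (m < n)%nat ->
  csum (fun j => if (m =? j)%nat then x j else 0) n = x m.
Proof.
intros H; induction n as [|n IH]; [lia|]. simpl. destruct (Nat.eqb_spec m n) as [->|D].
- rewrite csum_zero; [ring|]. intros k Hk. destruct (Nat.eqb_spec n k); [lia|easy].
- rewrite IH by lia. ring.
Qed.

(** Expand the square and use the orthogonality of the characters of order [N]. *)
Lemma discrete_parseval (d : nat -> C) (r : R) N :
  rsum (fun k => Cmod (csum (fun m => d m * (RtoC r * root1 N ^ k) ^ m)%C N) ^ 2) N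
  = INR N * rsum (fun m => Cmod (d m) ^ 2 * (r ^ 2) ^ m) N.
Proof.
apply RtoC_inj. rewrite RtoC_mult, <- !csum_RtoC.
set (b := fun m => (d m * RtoC r ^ m)%C). set (w := root1 N).
rewrite (csum_ext _ (fun k => csum (fun i => csum (fun j => (b i * Cconj (b j)) * ((w ^ k) ^ i * Cconj ((w ^ k) ^ j))) N) N)%C).
- rewrite csum_switch, <- csum_scal. apply csum_ext_lt; intros i Hi.
  rewrite csum_switch.
  rewrite (csum_ext_lt _ (fun j => if (i =? j)%nat then (b i * Cconj (b j) * RtoC (INR N))%C else 0)).
  + rewrite csum_delta by easy. rewrite <- Cmod2_conj. unfold b.
    rewrite Cmod_mult, Cmod_pow, Cmod_R, Rpow_mult_distr, <- pow_mult, Nat.mul_comm, pow_mult, pow2_abs, RtoC_mult. ring.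
  + intros j Hj. rewrite csum_scal. unfold w; rewrite root1_orthogonal by easy.
    destruct (i =? j)%nat; [easy|ring].
- intros k. rewrite Cmod2_conj, csum_conj, csum_mult_csum. apply csum_ext; intros i; apply csum_ext; intros j.
  unfold b. rewrite !Cmult_conj, !Cpow_mult_l, !Cmult_conj. ring.
Qed.

Lemma discrete_mean (h : nat -> C) (r : R) N : (0 < N)%nat ->
  csum (fun k => csum (fun m => h m * (RtoC r * root1 N ^ k) ^ m)%C N) N = (RtoC (INR N) * h O)%C.
Proof.
intros HN. rewrite csum_switch.
rewrite (csum_ext_lt _ (fun m => if (0 =? m)%nat then (RtoC (INR N) * h m)%C else 0)).
- now rewrite csum_delta.
- intros m Hm.
  rewrite (csum_ext _ (fun k => (h m * RtoC r ^ m) * ((root1 N ^ k) ^ m * Cconj ((root1 N ^ k) ^ 0)))%C).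
  + rewrite csum_scal, root1_orthogonal by lia. rewrite Nat.eqb_sym. destruct (Nat.eqb_spec 0 m) as [<-|]; simpl; ring.
  + intros k. rewrite Cpow_mult_l. simpl. rewrite Cconj_RtoC. ring.
Qed.

Lemma Re_csum u n : Re (csum u n) = rsum (fun k => Re (u k)) n.
Proof. induction n as [|n IH]; simpl; [easy|]. rewrite <- IH. easy. Qed.

(** Both bounds come from absolute convergence on the circle of radius [r]. *)
Lemma pser_tail_uniform (a : nat -> C) (F : disk -> C) r : (forall z : disk, pser a z (F z)) -> 0 <= r < 1 ->
  exists B, 0 <= B /\ (forall z : disk, Cmod z = r -> Cmod (F z) <= B) /\
    forall eps, 0 < eps -> exists N, forall n, (N <= n)%nat ->
      forall z : disk, Cmod z <= r -> Cmod (F z - csum (fun k => a k * z ^ k)%C n) <= eps.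
Proof.
intros HF Hr. pose proof (proj1 (global_tseries F a) HF) as HT.
destruct (tseries_abs_bound _ _ _ _ r HT) as [B HB]; try (simpl; rewrite ?Cmod_0; lra).
assert (Habs : forall (z : disk) n m, Cmod z <= r -> (n <= m)%nat ->
  rsum (fun k => Cmod (a k * z ^ k)) m - rsum (fun k => Cmod (a k * z ^ k)) n
  <= rsum (fun k => Cmod (a k) * r ^ k) m - rsum (fun k => Cmod (a k) * r ^ k) n).
{ intros z n m Hz; induction 1 as [|m L IH]; [lra|]. simpl. rewrite Cmod_mult, Cmod_pow.
  assert (Cmod (a m) * Cmod z ^ m <= Cmod (a m) * r ^ m); [|lra].
  apply Rmult_le_compat_l; [apply Cmod_ge_0|]. apply pow_incr; split; [apply Cmod_ge_0|lra]. }
exists B; split; [exact (HB O)|]. split.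
- intros z Hz. apply (csums_le _ _ _ (HF z)). intros n. pose proof (Habs z O n ltac:(lra) ltac:(lia)) as Q. simpl in Q.
  specialize (HB n). lra.
- intros eps He. destruct (rsum_tail _ B HB eps He) as [N HN]. exists N; intros n Hn z Hz.
  apply (csums_tail_le _ _ _ _ (HF z)). intros m Hm. apply Rle_trans with (1 := Habs z n m Hz Hm).
  specialize (HN m). pose proof (rsum_mono (fun k => Cmod (a k) * r ^ k) N n
    ltac:(intros; apply Rmult_le_pos; [apply Cmod_ge_0|apply pow_le; lra]) Hn). lra.
Qed.

(** This is the inequality between the means of [|F| ^ 2] and of [Re H] over the
    circle of radius [r], written with Taylor coefficients. Averages over [N]-th
    roots of unity compute both means exactly for Taylor polynomials of degree
    less than [N], which are uniformly close to [F] and [H]. *)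
Lemma mean_square_le (d h : nat -> C) (F H : disk -> C) r :
  (forall z : disk, pser d z (F z)) -> (forall z : disk, pser h z (H z)) -> 0 <= r < 1 ->
  (forall z : disk, Cmod z = r -> Cmod (F z) ^ 2 <= Re (H z)) ->
  forall K, rsum (fun k => Cmod (d k) ^ 2 * (r ^ 2) ^ k) K <= Re (h O).
Proof.
intros HF HH Hr Hle K.
destruct (pser_tail_uniform d F r HF Hr) as [BF [BF0 [HBF TF]]].
destruct (pser_tail_uniform h H r HH Hr) as [_ [_ [_ TH]]].
assert (Main : forall e, 0 < e <= 1 -> rsum (fun k => Cmod (d k) ^ 2 * (r ^ 2) ^ k) K <= Re (h O) + e * (2 + 2 * BF)).
{ intros e He. destruct (TF e ltac:(lra)) as [N1 HN1]; destruct (TH e ltac:(lra)) as [N2 HN2].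
  set (N := (S (N1 + N2 + K))). specialize (HN1 N ltac:(lia)). specialize (HN2 N ltac:(lia)).
  assert (HNp : 0 < INR N) by (apply lt_0_INR; lia).
  apply Rle_trans with (rsum (fun k => Cmod (d k) ^ 2 * (r ^ 2) ^ k) N).
  { apply rsum_mono; [|lia]. intros k; apply Rmult_le_pos; [apply pow2_ge_0|apply pow_le, pow2_ge_0]. }
  apply Rmult_le_reg_l with (INR N); [easy|]. rewrite <- discrete_parseval.
  apply Rle_trans with (rsum (fun k => Re (csum (fun m => h m * (RtoC r * root1 N ^ k) ^ m)%C N) + e * (2 + 2 * BF)) N).
  - apply rsum_le; intros k _. set (p := (RtoC r * root1 N ^ k)%C).
    assert (Hp : Cmod p = r).
    { unfold p. rewrite Cmod_mult, Cmod_pow, root1_mod, pow1, Cmod_R, Rabs_pos_eq; lra. }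
    set (z := Disk p ltac:(lra)). change p with (disk_val z).
    specialize (HN1 z ltac:(simpl; lra)). specialize (HN2 z ltac:(simpl; lra)).
    specialize (HBF z Hp). specialize (Hle z Hp).
    set (FN := csum (fun m => d m * z ^ m)%C N) in *. set (HN := csum (fun m => h m * z ^ m)%C N) in *.
    pose proof (Cmod_le_diff FN (F z)) as Q1. rewrite Cmod_sub_sym in HN1.
    pose proof (Re_le_Cmod (H z - HN)) as Q2. change (Re (H z - HN)) with (Re (H z) - Re HN) in Q2.
    pose proof (Cmod_ge_0 FN). pose proof (Cmod_ge_0 (F z)).
    assert (Cmod FN ^ 2 <= (Cmod (F z) + e) ^ 2) by (apply pow_incr; lra). nra.
  - rewrite rsum_plus, rsum_const, <- Re_csum, discrete_mean by lia.
    rewrite re_scal_l. lra. }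
apply Rnot_lt_le; intros L. set (g := rsum (fun k => Cmod (d k) ^ 2 * (r ^ 2) ^ k) K - Re (h O)) in *. assert (0 < g) by (unfold g; lra).
set (e := Rmin 1 (g / (2 * (2 + 2 * BF)))).
assert (0 < g / (2 * (2 + 2 * BF))) by (apply Rdiv_lt_0_compat; lra).
assert (0 < e) by (apply Rmin_glb_lt; lra).
specialize (Main e ltac:(split; [easy|apply Rmin_l])).
assert (e * (2 + 2 * BF) <= g / 2).
{ apply Rle_trans with (g / (2 * (2 + 2 * BF)) * (2 + 2 * BF)); [|right; field; lra].
  apply Rmult_le_compat_r; [lra|apply Rmin_r]. }
unfold g in *; lra.
Qed.

(** Take the constant [M ^ 2] as majorant in [mean_square_le]. *)
Lemma cauchy_estimate (d : nat -> C) (F : disk -> C) r M :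
  (forall z : disk, pser d z (F z)) -> 0 <= r < 1 -> 0 <= M ->
  (forall z : disk, Cmod z = r -> Cmod (F z) <= M) -> forall n, Cmod (d n) * r ^ n <= M.
Proof.
intros HF Hr HM Hle n. apply sq_le_sq; [easy|].
destruct (H2_const_ex (RtoC (M ^ 2))) as [H HH].
apply Rle_trans with (Re (h2_coef H O)).
- apply Rle_trans with (rsum (fun k => Cmod (d k) ^ 2 * (r ^ 2) ^ k) (S n)).
  + cbn [rsum]. replace ((Cmod (d n) * r ^ n) ^ 2) with (Cmod (d n) ^ 2 * (r ^ 2) ^ n)
      by (rewrite Rpow_mult_distr, <- !pow_mult; do 2 f_equal; lia).
    assert (0 <= rsum (fun k => Cmod (d k) ^ 2 * (r ^ 2) ^ k) n); [|lra].
    apply rsum_pos; intros k; apply Rmult_le_pos; [apply pow2_ge_0|apply pow_le, pow2_ge_0].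
  + apply (mean_square_le d (h2_coef H) F H r); [easy|apply H2_pser|easy|].
    intros z Hz. rewrite HH, re_RtoC. apply pow_incr; split; [apply Cmod_ge_0|auto].
- rewrite (pser_at_0 _ _ (H2_pser H disk0)), HH, re_RtoC. lra.
Qed.

(** * Locally uniform limits *)

(** By Cauchy's estimate the coefficients of the approximants converge, and do
    so geometrically uniformly, so that the limit coefficients sum to the limit
    of the approximants. *)
Lemma pser_locally_uniform_limit (F : disk -> C) :
  (forall r eps, r < 1 -> 0 < eps -> exists h : H2, forall z : disk, Cmod z <= r -> Cmod (h z - F z) <= eps) ->
  exists d, forall z : disk, pser d z (F z).
Proof.
intros HF.
assert (Hi : forall k, 0 < / INR (S k)) by (intros; apply Rinv_0_lt_compat, lt_0_INR; lia).
assert (Hd : forall k l, (k <= l)%nat -> / INR (S l) <= / INR (S k)).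
{ intros k l L; apply Rinv_le_contravar; [apply lt_0_INR; lia|apply le_INR; lia]. }
assert (Harch : forall e, 0 < e -> exists N, forall n, (N <= n)%nat -> / INR (S n) < e).
{ intros e He. destruct (archimed_cor1 e He) as [N [HN1 HN2]]; exists N; intros n Hn.
  apply Rle_lt_trans with (2 := HN1). apply Rinv_le_contravar; [now apply lt_0_INR|apply le_INR; lia]. }
destruct (choice (fun k (h : H2) => forall z : disk, Cmod z <= 1 - / INR (S k) -> Cmod (h z - F z) <= / INR (S k))) as [h Hh].
{ intros k. apply HF; [specialize (Hi k); lra|easy]. }
assert (Hdiff : forall r k l n, 0 <= r < 1 -> / INR (S k) <= 1 - r -> (k <= l)%nat ->
  Cmod (h2_coef (h l) n - h2_coef (h k) n) * r ^ n <= 2 * / INR (S k)).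
{ intros r k l n Hr Hk Hkl. rewrite <- H2_minus_coef. pose proof (Hi k). pose proof (Hd k l Hkl).
  apply (cauchy_estimate _ (minus (h l) (h k) : H2) r); [apply H2_pser|easy|lra|].
  intros z Hz. rewrite H2_minus_fun.
  pose proof (Hh k z ltac:(lra)) as Q1. pose proof (Hh l z ltac:(lra)) as Q2. rewrite Cmod_sub_sym in Q1.
  pose proof (Cmod_sub_triangle (h l z) (F z) (h k z)). lra. }
assert (Hlim : forall n, exists l, cvto (fun k => h2_coef (h k) n) l).
{ intros n; apply cvto_cauchy; intros eps He.
  assert (P : 0 < (1/2) ^ n) by (apply pow_lt; lra).
  destruct (Harch (Rmin (1/2) (eps * (1/2) ^ n / 2))) as [N HN].
  { apply Rmin_glb_lt; [lra|]. apply Rdiv_lt_0_compat; [apply Rmult_lt_0_compat; lra|lra]. }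
  exists N; intros k Hk. pose proof (HN N (le_n N)) as Q.
  pose proof (Rmin_l (1/2) (eps * (1/2) ^ n / 2)). pose proof (Rmin_r (1/2) (eps * (1/2) ^ n / 2)).
  pose proof (Hdiff (1/2) N k n ltac:(lra) ltac:(lra) Hk) as Q2.
  apply Rmult_lt_reg_r with ((1/2) ^ n); [easy|]. lra. }
destruct (choice _ Hlim) as [d Hdlim]. exists d.
intros z. pose proof (disk_lt1 z). pose proof (Cmod_ge_0 z).
set (r := (1 + Cmod z) / 2). assert (Hr : Cmod z < r < 1) by (unfold r; lra).
assert (Hq : 0 <= Cmod z / r < 1) by (apply ratio_lt_1; lra).
destruct (Harch (1 - r) ltac:(lra)) as [N0 HN0].
set (Cst := 2 / (1 - Cmod z / r)).
assert (HC : 0 < Cst) by (apply Rdiv_lt_0_compat; lra).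
assert (Hser : forall k, (N0 <= k)%nat -> exists L, pser d z (h k z + L) /\ Cmod L <= Cst * / INR (S k)).
{ intros k Hk. pose proof (Hi k).
  assert (Hdk : forall n, Cmod (d n - h2_coef (h k) n) * Cmod z ^ n <= 2 * / INR (S k) * (Cmod z / r) ^ n).
  { intros n. apply (coef_geom (fun n => d n - h2_coef (h k) n)%C); [lra|lra|].
    assert (P : 0 < r ^ n) by (apply pow_lt; lra).
    apply Rmult_le_reg_r with (/ r ^ n); [now apply Rinv_0_lt_compat|].
    rewrite Rmult_assoc, Rinv_r, Rmult_1_r by lra.
    apply (cvto_le (fun l => h2_coef (h l) n)); [|apply Hdlim]. exists k; intros l Hl.
    apply Rmult_le_reg_r with (r ^ n); [easy|]. rewrite (Rmult_assoc _ (/ r ^ n)), Rinv_l, Rmult_1_r by lra.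
    apply Hdiff; [lra| |easy]. pose proof (HN0 k Hk); lra. }
  assert (Hs : forall n, rsum (fun k0 => Cmod ((d k0 - h2_coef (h k) k0) * z ^ k0)) n <= Cst * / INR (S k)).
  { intros n. replace (Cst * / INR (S k)) with (2 * / INR (S k) / (1 - Cmod z / r)) by (unfold Cst; field; split; [apply not_0_INR; lia|lra]).
    apply rsum_geom; [lra|easy|]. intros j; rewrite Cmod_mult, Cmod_pow; apply Hdk. }
  destruct (csums_dominated (fun n => (d n - h2_coef (h k) n) * z ^ n)%C
     (fun n => Cmod ((d n - h2_coef (h k) n) * z ^ n)) _ ltac:(intros; lra) Hs) as [L HL].
  exists L; split.
  - apply (csums_ext (fun n => h2_coef (h k) n * z ^ n + (d n - h2_coef (h k) n) * z ^ n)%C); [intros; ring|].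
    apply csums_plus; [apply H2_pser|easy].
  - apply (csums_le _ _ _ HL Hs). }
destruct (Hser N0 (le_n _)) as [L0 [HL0 _]].
replace (F z) with (h N0 z + L0)%C; [exact HL0|].
apply Ceq_minus, Cmod_eq_0. set (V := (h N0 z + L0)%C) in *.
apply Rle_antisym; [|apply Cmod_ge_0]. apply Rnot_lt_le; intros Pos.
destruct (Harch (Rmin (1 - Cmod z) (Cmod (V - F z) / (Cst + 1)))) as [N HN].
{ apply Rmin_glb_lt; [lra|apply Rdiv_lt_0_compat; lra]. }
set (k := (N0 + N)%nat). specialize (HN k ltac:(lia)).
pose proof (Rmin_l (1 - Cmod z) (Cmod (V - F z) / (Cst + 1))). pose proof (Rmin_r (1 - Cmod z) (Cmod (V - F z) / (Cst + 1))).
destruct (Hser k ltac:(lia)) as [L [HL HL2]].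
assert (EV : V = (h k z + L)%C) by (apply (cvto_unique _ _ _ HL0 HL)).
pose proof (Hh k z ltac:(lra)) as Q.
assert (Cmod (V - F z) <= (Cst + 1) * / INR (S k)).
{ rewrite EV. replace (h k z + L - F z)%C with ((h k z - F z) + L)%C by ring.
  apply Rle_trans with (1 := Cmod_triangle _ _). lra. }
assert ((Cst + 1) * / INR (S k) < (Cst + 1) * (Cmod (V - F z) / (Cst + 1))) by (apply Rmult_lt_compat_l; lra).
replace ((Cst + 1) * (Cmod (V - F z) / (Cst + 1))) with (Cmod (V - F z)) in * by (field; lra). lra.
Qed.

(** * Compactness *)

(** Each point has a neighbourhood on which [|phi|] stays away from 1; a
    compactness argument on the square of side 2 makes the margin uniform.
    Points of that square outside the disk get a neighbourhood that does not
    meet the disk of radius [r]. *)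
Lemma self_map_compact (phi : disk -> disk) r : analytic (fun z => phi z) -> r < 1 ->
  exists rho, 0 <= rho < 1 /\ forall z : disk, Cmod z <= r -> Cmod (phi z) <= rho.
Proof.
intros Hphi Hr.
assert (Hloc : forall p : R * R, exists del : posreal, forall z : disk, Cmod z <= r ->
  Rabs (Re z - fst p) < del -> Rabs (Im z - snd p) < del -> Cmod (phi z) <= 1 - del).
{ intros [u v]. simpl. destruct (Rlt_le_dec (Cmod (u, v)) 1) as [L|L].
  - set (c := Disk (u, v) L). pose proof (disk_lt1 (phi c)) as Hc.
    destruct (proj1 (analytic_tseries _) Hphi c) as [b [rb Hb]].
    pose proof (tseries_tail _ _ _ _ 0 Hb) as K. rewrite (tseries_at _ _ _ _ Hb) in K.
    destruct (K ((1 - Cmod (phi c)) / 2) ltac:(lra)) as [d [Hd Kd]].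
    set (m := Rmin (d / 2) ((1 - Cmod (phi c)) / 2)).
    assert (Hm : 0 < m) by (apply Rmin_glb_lt; lra).
    exists (mkposreal m Hm). simpl. intros z _ H1 H2.
    pose proof (Rmin_l (d / 2) ((1 - Cmod (phi c)) / 2)); pose proof (Rmin_r (d / 2) ((1 - Cmod (phi c)) / 2)).
    fold m in H, H0.
    assert (Hz : Cmod (z - c) < d).
    { pose proof (Cmod_le_Re_Im (z - c)) as Q. change (Re (z - c)) with (Re z - u) in Q.
      change (Im (z - c)) with (Im z - v) in Q. lra. }
    specialize (Kd z Hz). simpl in Kd.
    replace (phi z - 0 - phi c * 1)%C with (phi z - phi c)%C in Kd by ring.
    pose proof (Cmod_le_diff (phi z) (phi c)). lra.
  - exists (mkposreal ((1 - r) / 2) ltac:(lra)). simpl. intros z Hz H1 H2. exfalso.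
    pose proof (Cmod_le_diff (u, v) z) as Q. rewrite Cmod_sub_sym in Q.
    pose proof (Cmod_le_Re_Im (z - (u, v))) as Q2. change (Re (z - (u, v))) with (Re z - u) in Q2.
    change (Im (z - (u, v))) with (Im z - v) in Q2. lra. }
destruct (choice _ Hloc) as [del Hdel].
destruct (compactness_value_2d (-1) 1 (-1) 1 (fun u v => del (u, v))) as [d Hd].
assert (Hmain : forall z : disk, Cmod z <= r -> Cmod (phi z) <= 1 - d).
{ intros z Hz. apply Rnot_lt_le; intros L. pose proof (disk_lt1 z).
  assert (B1 : -1 <= Re z <= 1) by (apply Rabs_le_between; pose proof (re_le_Cmod z); lra).
  assert (B2 : -1 <= Im z <= 1) by (apply Rabs_le_between; pose proof (Im_le_Cmod z); lra).
  apply (Hd (Re z) (Im z) B1 B2). intros [u [v (_ & _ & H1 & H2 & H3)]].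
  pose proof (Hdel (u, v) z Hz H1 H2). lra. }
pose proof (cond_pos d).
exists (Rmax 0 (1 - d)). split.
- split; [apply Rmax_l|apply Rmax_lub_lt; lra].
- intros z Hz. apply Rle_trans with (1 := Hmain z Hz), Rmax_r.
Qed.

(** * Littlewood's subordination principle *)

Fixpoint horner (l : list C) (w : C) : C :=
  match l with [] => 0 | a :: l' => (a + w * horner l' w)%C end.

(** The real part of [hmaj l] is the harmonic function with boundary values
    [|horner l| ^ 2] on the unit circle: if [f = a + w g], then
    [|f| ^ 2 = |a| ^ 2 + 2 Re (conj a w g) + |g| ^ 2] there. *)
Fixpoint hmaj (l : list C) (w : C) : C :=
  match l with
  | [] => 0
  | a :: l' => (RtoC (Cmod a ^ 2) + 2 * Cconj a * (w * horner l' w) + hmaj l' w)%C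
  end.

Fixpoint sqsum (l : list C) : R :=
  match l with [] => 0 | a :: l' => Cmod a ^ 2 + sqsum l' end.

Lemma Cmod_sq_plus x y : Cmod (x + y) ^ 2 = Cmod x ^ 2 + 2 * Re (Cconj x * y) + Cmod y ^ 2.
Proof. rewrite !Cmod2_alt. unfold Re, Im; simpl. ring. Qed.

Lemma Re_hmaj_cons a l w : Re (hmaj (a :: l) w) = Cmod a ^ 2 + 2 * Re (Cconj a * (w * horner l w)) + Re (hmaj l w).
Proof.
cbn [hmaj]. change (Re (RtoC (Cmod a ^ 2)) + Re (2 * Cconj a * (w * horner l w)) + Re (hmaj l w)
  = Cmod a ^ 2 + 2 * Re (Cconj a * (w * horner l w)) + Re (hmaj l w)).
rewrite re_RtoC, <- Cmult_assoc, re_scal_l. ring.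
Qed.

(** Inside the disk the term [|w g| ^ 2] of the square is at most [|g| ^ 2]. *)
Lemma horner_majorant l w : Cmod w <= 1 -> Cmod (horner l w) ^ 2 <= Re (hmaj l w).
Proof.
intros Hw; induction l as [|a l IH]; [simpl; rewrite Cmod_0; lra|].
rewrite Re_hmaj_cons. cbn [horner]. rewrite Cmod_sq_plus.
assert (Cmod (w * horner l w) ^ 2 <= Cmod (horner l w) ^ 2); [|lra].
rewrite Cmod_mult. apply pow_incr. pose proof (Cmod_ge_0 w). pose proof (Cmod_ge_0 (horner l w)). nra.
Qed.

(** An instance of Harnack's inequality, with a cruder constant. The square on
    the left makes the induction work: passing from [g] to [a + b g] frees
    [(1 - |b| ^ 2) |g b| ^ 2], which absorbs the cross terms
    [4 |a| |b| |g b|]. *)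
Lemma hmaj_bound l b : Cmod b < 1 ->
  Re (hmaj l b) + Cmod (horner l b) ^ 2 <= (2 + 4 / (1 - Cmod b ^ 2)) * sqsum l.
Proof.
intros Hb. pose proof (Cmod_ge_0 b). set (be := Cmod b) in *.
assert (Hbe : 0 < 1 - be ^ 2) by nra.
induction l as [|a l IH]; [simpl; rewrite Cmod_0; lra|].
rewrite Re_hmaj_cons. cbn [horner sqsum].
set (x := Cmod (horner l b)) in *. assert (0 <= x) by apply Cmod_ge_0.
set (y := Cmod a) in *. assert (0 <= y) by apply Cmod_ge_0.
assert (H2 : Re (Cconj a * (b * horner l b)) <= y * (be * x)).
{ apply Rle_trans with (1 := Re_le_Cmod _). rewrite !Cmod_mult, Cmod_conj. unfold y, be, x; lra. }
assert (H3 : Cmod (a + b * horner l b) ^ 2 <= (y + be * x) ^ 2).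
{ apply pow_incr; split; [apply Cmod_ge_0|]. apply Rle_trans with (1 := Cmod_triangle _ _). rewrite Cmod_mult. unfold y, be, x; lra. }
assert (H4 : 4 * y * (be * x) <= (1 - be ^ 2) * x ^ 2 + 4 / (1 - be ^ 2) * y ^ 2).
{ assert (H5 : 0 <= ((1 - be ^ 2) * x - 2 * be * y) ^ 2 / (1 - be ^ 2)) by (apply Rdiv_le_0_compat; [apply pow2_ge_0|lra]).
  replace (((1 - be ^ 2) * x - 2 * be * y) ^ 2 / (1 - be ^ 2))
    with ((1 - be ^ 2) * x ^ 2 - 4 * y * (be * x) + be ^ 2 * (4 / (1 - be ^ 2) * y ^ 2)) in H5 by (field; lra).
  assert (0 <= 4 / (1 - be ^ 2) * y ^ 2).
  { apply Rmult_le_pos; [apply Rdiv_le_0_compat; lra|apply pow2_ge_0]. }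
  assert (be ^ 2 * (4 / (1 - be ^ 2) * y ^ 2) <= 1 * (4 / (1 - be ^ 2) * y ^ 2)) by (apply Rmult_le_compat_r; lra).
  lra. }
nra.
Qed.

Lemma H2_horner l : exists p : H2, forall z : disk, p z = horner l z.
Proof.
induction l as [|a l [p IH]]; [exact (H2_const_ex 0)|].
destruct (H2_shift_ex p) as [q Hq]. destruct (H2_const_ex a) as [k Hk].
exists (plus k q); intros z. change (k z + q z = horner (a :: l) z)%C. rewrite Hk, Hq, IH; easy.
Qed.

Lemma H2_hmaj l : exists p : H2, forall z : disk, p z = hmaj l z.
Proof.
induction l as [|a l [p IH]]; [exact (H2_const_ex 0)|].
destruct (H2_horner l) as [g Hg]. destruct (H2_shift_ex g) as [q Hq]. destruct (H2_const_ex (RtoC (Cmod a ^ 2))) as [k Hk].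
exists (plus (plus k (scal (2 * Cconj a)%C q)) p); intros z.
change (k z + 2 * Cconj a * q z + p z = hmaj (a :: l) z)%C. rewrite Hk, Hq, IH, Hg; easy.
Qed.

Fixpoint coef_list (a : nat -> C) (n : nat) : list C :=
  match n with O => [] | S m => a O :: coef_list (fun k => a (S k)) m end.

Lemma horner_coef_list a n w : horner (coef_list a n) w = csum (fun k => a k * w ^ k)%C n.
Proof.
revert a; induction n as [|n IH]; intros a; [easy|]. rewrite csum_first. cbn [coef_list horner]. rewrite IH, <- csum_scal.
f_equal; [simpl; ring|]. apply csum_ext; intros k; simpl; ring.
Qed.

Lemma sqsum_coef_list a n : sqsum (coef_list a n) = rsum (fun k => Cmod (a k) ^ 2) n.
Proof. revert a; induction n as [|n IH]; intros a; [easy|]. rewrite rsum_first. cbn [coef_list sqsum]. now rewrite IH. Qed.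

(** Bernoulli's inequality bounds [r ^ (2 k)] below by [1 - 2 K (1 - r)]. *)
Lemma rsum_radial_limit (d : nat -> C) K B :
  (forall r, 0 <= r < 1 -> rsum (fun k => Cmod (d k) ^ 2 * (r ^ 2) ^ k) K <= B) ->
  rsum (fun k => Cmod (d k) ^ 2) K <= B.
Proof.
intros H. set (X := rsum (fun k => Cmod (d k) ^ 2) K).
assert (HX : 0 <= X) by (apply rsum_pos; intros; apply pow2_ge_0).
assert (Hb : forall t n, 0 <= t <= 1 -> 1 - INR n * t <= (1 - t) ^ n).
{ intros t n Ht; induction n as [|n IH]; [simpl; lra|]. rewrite S_INR; simpl.
  pose proof (pow_le (1 - t) n ltac:(lra)).
  assert ((1 - t) ^ n <= 1) by (pose proof (pow_incr (1 - t) 1 n ltac:(lra)) as Q; rewrite pow1 in Q; exact Q). assert (t * (1 - t) ^ n <= t * 1) by (apply Rmult_le_compat_l; lra). lra. }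
assert (Ht : forall t, 0 < t <= 1 -> X * (1 - INR (2 * K) * t) <= B).
{ intros t Ht. apply Rle_trans with (2 := H (1 - t) ltac:(lra)).
  rewrite Rmult_comm. unfold X; rewrite <- rsum_scal. apply rsum_le; intros k Hk. rewrite Rmult_comm.
  apply Rmult_le_compat_l; [apply pow2_ge_0|]. rewrite <- pow_mult.
  apply Rle_trans with (2 := Hb t (2 * k)%nat ltac:(lra)).
  assert (INR (2 * k) <= INR (2 * K)) by (apply le_INR; lia). nra. }
apply Rnot_lt_le; intros L. pose proof (pos_INR (2 * K)). set (m := INR (2 * K)) in *.
set (t := Rmin 1 ((X - B) / (2 * (X * m + 1)))).
assert (0 <= X * m) by (apply Rmult_le_pos; lra).
assert (0 < (X - B) / (2 * (X * m + 1))) by (apply Rdiv_lt_0_compat; lra).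
assert (0 < t) by (apply Rmin_glb_lt; lra).
specialize (Ht t ltac:(split; [easy|apply Rmin_l])).
assert (t * (X * m + 1) <= (X - B) / 2).
{ apply Rle_trans with ((X - B) / (2 * (X * m + 1)) * (X * m + 1)); [|right; field; lra].
  apply Rmult_le_compat_r; [lra|apply Rmin_r]. }
nra.
Qed.

(** [hmaj l o phi] is analytic, so the mean of its real part over a circle about
    0 is its value at 0. *)
Lemma littlewood_polynomial (phi : disk -> disk) l (d h : nat -> C) :
  (forall z : disk, pser d z (horner l (phi z))) -> (forall z : disk, pser h z (hmaj l (phi z))) ->
  forall K, rsum (fun k => Cmod (d k) ^ 2) K <= (2 + 4 / (1 - Cmod (phi disk0) ^ 2)) * sqsum l.
Proof.
intros Hd Hh K. apply rsum_radial_limit. intros r Hr.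
apply Rle_trans with (Re (h O)).
- apply (mean_square_le d h (fun z => horner l (phi z)) (fun z => hmaj l (phi z))); auto.
  intros z _. apply horner_majorant. pose proof (disk_lt1 (phi z)); lra.
- rewrite (pser_at_0 _ _ (Hh disk0)). pose proof (hmaj_bound l (phi disk0) (disk_lt1 _)).
  pose proof (pow2_ge_0 (Cmod (horner l (phi disk0)))). lra.
Qed.

(** The compositions of the Taylor polynomials of [f] with [phi] converge to
    [f o phi] uniformly on a small circle, hence coefficientwise; Fatou's lemma
    then extends the inequality from polynomials to [f]. *)
Lemma littlewood (phi : disk -> disk) : analytic (fun z => phi z) ->
  (forall f : H2, exists d, forall z : disk, pser d z (f (phi z))) ->
  exists M, 0 <= M /\ forall f : H2, exists g : H2, (forall z, g z = f (phi z)) /\ hn g <= M * hn f.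
Proof.
intros Hphi Hser.
set (Cst := 2 + 4 / (1 - Cmod (phi disk0) ^ 2)).
assert (HC : 0 <= Cst).
{ pose proof (disk_lt1 (phi disk0)). pose proof (Cmod_ge_0 (phi disk0)).
  assert (0 < 4 / (1 - Cmod (phi disk0) ^ 2)) by (apply Rdiv_lt_0_compat; nra). unfold Cst; lra. }
exists (sqrt Cst); split; [apply sqrt_pos|]. intros f.
destruct (Hser f) as [d Hd].
assert (HL : forall L, exists dL : nat -> C,
  (forall z : disk, pser dL z (csum (fun k => h2_coef f k * (phi z) ^ k)%C L)) /\
  forall K, rsum (fun k => Cmod (dL k) ^ 2) K <= Cst * hn f ^ 2).
{ intros L. set (l := coef_list (h2_coef f) L).
  destruct (H2_horner l) as [p Hp]; destruct (H2_hmaj l) as [q Hq].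
  destruct (Hser p) as [dL HdL]; destruct (Hser q) as [hL HhL].
  assert (H1 : forall z : disk, pser dL z (horner l (phi z))) by (intros z; rewrite <- Hp; apply HdL).
  assert (H2' : forall z : disk, pser hL z (hmaj l (phi z))) by (intros z; rewrite <- Hq; apply HhL).
  exists dL; split; [intros z; rewrite <- horner_coef_list; apply H1|].
  intros K. apply Rle_trans with (1 := littlewood_polynomial phi l dL hL H1 H2' K).
  apply Rmult_le_compat_l; [exact HC|]. unfold l; rewrite sqsum_coef_list. apply H2_norm_partial. }
destruct (choice _ HL) as [dL HdL].
assert (Hlim : forall k, cvto (fun L => dL L k) (d k)).
{ intros k eps He.
  destruct (self_map_compact phi (1/2) Hphi ltac:(lra)) as [rho [Hrho Hrho2]].
  destruct (pser_tail_uniform (h2_coef f) f rho (H2_pser f) Hrho) as [_ [_ [_ TF]]].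
  assert (P : 0 < (1/2) ^ k) by (apply pow_lt; lra).
  destruct (TF (eps * (1/2) ^ k / 2)) as [N HN]; [apply Rdiv_lt_0_compat; [now apply Rmult_lt_0_compat|lra]|].
  exists N; intros L HLN.
  assert (Q : Cmod (dL L k - d k) * (1/2) ^ k <= eps * (1/2) ^ k / 2).
  { assert (0 <= eps * (1/2) ^ k / 2) by (apply Rdiv_le_0_compat; [apply Rmult_le_pos; lra|lra]).
    apply (cauchy_estimate (fun j => dL L j - d j)%C
      (fun z => csum (fun k => h2_coef f k * (phi z) ^ k)%C L - f (phi z))%C (1/2)); [|lra|easy|].
    - intros z. apply (csums_ext (fun n => dL L n * z ^ n - d n * z ^ n)%C); [intros; ring|].
      apply csums_minus; [apply HdL|apply Hd].
    - intros z Hz. rewrite Cmod_sub_sym. apply HN; [easy|]. apply Hrho2; lra. }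
  apply Rmult_lt_reg_r with ((1/2) ^ k); [easy|].
  assert (0 < eps * (1/2) ^ k) by now apply Rmult_lt_0_compat. lra. }
assert (Hsq : forall K, rsum (fun k => Cmod (d k) ^ 2) K <= Cst * hn f ^ 2).
{ intros K. rewrite (rsum_ext_lt _ (fun k => Cmod (d k - 0) ^ 2)) by (intros; do 2 f_equal; ring).
  apply (rsum_sq_limit dL d (fun _ => RtoC 0) K _ Hlim). exists O; intros n _.
  rewrite (rsum_ext_lt _ (fun k => Cmod (dL n k) ^ 2)) by (intros; do 2 f_equal; ring). apply HdL. }
destruct (H2_of_pser d (fun z => f (phi z)) _ Hd Hsq) as [g [Hg Hgc]].
exists g; split; [easy|]. pose proof (H2_norm_pos f). pose proof (sqrt_pos Cst).
apply H2_norm_le; [now apply Rmult_le_pos|]. intros K.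
rewrite (rsum_ext_lt _ (fun k => Cmod (d k) ^ 2)) by (intros; now rewrite Hgc).
rewrite Rpow_mult_distr. simpl (sqrt Cst ^ 2); rewrite Rmult_1_r, sqrt_sqrt by easy. apply Hsq.
Qed.

(** * From the Koenigs sequence to complex symmetry *)

(** Approximating [f] by combinations of the [sigma ^ n] and using
    [sigma o phi = la sigma] exhibits [f o phi] as a locally uniform limit of
    elements of the Hardy space. *)
Lemma composition_pser (phi : disk -> disk) sigma (la : C) (s : nat -> H2) :
  analytic (fun z => phi z) -> (forall z, sigma (phi z) = la * sigma z)%C ->
  is_koenigs_sequence sigma s -> complete_sequence H2_inner s ->
  forall f : H2, exists d, forall z : disk, pser d z (f (phi z)).
Proof.
intros Hphi Hsig Hs Hcomp f. apply pser_locally_uniform_limit. intros r eps Hr He.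
destruct (self_map_compact phi r Hphi Hr) as [rho [Hrho Hrho2]].
destruct (Hcomp f (eps * (1 - rho))) as [g' Hg']; [apply Rmult_lt_0_compat; lra|].
pose (g := g' : H2). change (in_span s g /\ hn (minus f g) < eps * (1 - rho)) in Hg'.
clearbody g; clear g'; destruct Hg' as [Hg Hfg].
apply in_span_hsum in Hg; destruct Hg as [n [c ->]].
exists (hsum (fun k => c k * la ^ k)%C s n). intros z Hz.
replace (hsum (fun k => c k * la ^ k)%C s n z) with (hsum c s n (phi z)).
- rewrite Cmod_sub_sym, <- H2_minus_fun. apply Rle_trans with (1 := H2_eval_le _ _).
  specialize (Hrho2 z Hz).
  apply Rmult_le_reg_r with (1 - Cmod (phi z)); [lra|]. unfold Rdiv; rewrite Rmult_assoc, Rinv_l, Rmult_1_r by lra.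
  apply Rlt_le, Rlt_le_trans with (1 := Hfg). apply Rmult_le_compat_l; lra.
- rewrite !hsum_fun. apply csum_ext; intros k. rewrite !Hs, Hsig, Cpow_mult_l. ring.
Qed.

(** The adjoint is [J T J]: that this is an adjoint of [T] is the symmetry of
    the bilinear form [<T f, J g>], which holds on the powers of [sigma] because
    both sides vanish for different powers. *)
Lemma complex_symmetric_of_koenigs (phi : disk -> disk) (a : disk) sigma (s : nat -> H2) :
  schroder_map phi a -> koenigs_eigenfunction phi a sigma ->
  is_koenigs_sequence sigma s -> complete_sequence H2_inner s -> conjugate_orthogonal H2_inner s ->
  exists T : H2 -> H2, is_composition_operator phi T /\ complex_symmetric H2_inner T.
Proof.
intros [Hphi _] [_ [_ Hsig]] Hs Hcomp [J [HJ Horth]].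
set (la := disk_derive (fun z => phi z) a) in *.
destruct (littlewood phi Hphi (composition_pser phi sigma la s Hphi Hsig Hs Hcomp)) as [M [HM HT]].
destruct (choice _ HT) as [T HT']. exists T.
assert (HTf : forall (f : H2) z, T f z = f (phi z)) by apply HT'.
assert (HTn : forall f : H2, hn (T f) <= M * hn f) by apply HT'.
split; [exact HTf|].
assert (Tplus : forall f g : H2, T (plus f g) = plus (T f) (T g)).
{ intros f g; apply H2_eq; intros z. rewrite HTf. change (f (phi z) + g (phi z) = T f z + T g z)%C. now rewrite !HTf. }
assert (Tscal : forall (c : C) (f : H2), T (scal c f) = scal c (T f)).
{ intros c f; apply H2_eq; intros z. rewrite HTf. change (c * f (phi z) = c * T f z)%C. now rewrite HTf. }
assert (Ts : forall n, T (s n) = scal (la ^ n)%C (s n)).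
{ intros n; apply H2_eq; intros z. rewrite HTf. change (s n (phi z) = la ^ n * s n z)%C. now rewrite !Hs, Hsig, Cpow_mult_l. }
pose proof HJ as (J1 & J2 & J3 & J4).
assert (Jplus : forall f g : H2, J (plus f g) = plus (J f) (J g)) by exact J1.
assert (Jscal : forall (c : C) (f : H2), J (scal c f) = scal (Cconj c) (J f)) by exact J2.
assert (Jn : forall f : H2, hn (J f) = hn f) by (intros f; unfold ip_norm; now rewrite (J3 f f)).
(* the bilinear form [ip (T f) (J g)] is symmetric, by continuity in each variable *)
assert (Bd : forall f g : H2, Cmod (ip (T f) (J g) - ip (T g) (J f)) <= 2 * M * hn f * hn g).
{ intros f g. apply Rle_trans with (1 := Cmod_sub_le _ _).
  pose proof (cauchy_schwarz (T f) (J g)) as Q1. pose proof (cauchy_schwarz (T g) (J f)) as Q2. rewrite Jn in Q1, Q2.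
  pose proof (HTn f). pose proof (HTn g). pose proof (H2_norm_pos f). pose proof (H2_norm_pos g).
  assert (hn (T f) * hn g <= M * hn f * hn g) by (apply Rmult_le_compat_r; lra).
  assert (hn (T g) * hn f <= M * hn g * hn f) by (apply Rmult_le_compat_r; lra). lra. }
assert (Sym : forall f g : H2, ip (T f) (J g) = ip (T g) (J f)).
{ assert (S0 : forall n m, ip (T (s n)) (J (s m)) = ip (T (s m)) (J (s n))).
  { intros n m. destruct (Nat.eq_dec n m) as [->|D]; [easy|].
    rewrite !Ts, !ip_scal_l, <- (ip_conj (J (s m))), <- (ip_conj (J (s n))), !Horth by auto.
    rewrite Cconj_RtoC. ring. }
  assert (S1 : forall n (g : H2), ip (T (s n)) (J g) = ip (T g) (J (s n))).
  { intros n g. apply Ceq_minus.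
    refine (complete_functional s (fun g => ip (T (s n)) (J g) - ip (T g) (J (s n)))%C (2 * M * hn (s n)) Hcomp _ _ (Bd (s n)) _ g).
    - intros f h. rewrite Jplus, Tplus, ip_plus_l, ip_plus_r. ring.
    - intros c f. rewrite Jscal, Tscal, ip_scal_l, ip_scal_r, Cconj_conj. ring.
    - intros m. apply (proj1 (Ceq_minus _ _)), S0. }
  intros f g. apply Ceq_minus.
  refine (complete_functional s (fun f => ip (T f) (J g) - ip (T g) (J f))%C (2 * M * hn g) Hcomp _ _ _ _ f).
  - intros f1 f2. rewrite Jplus, Tplus, ip_plus_l, ip_plus_r. ring.
  - intros c f1. rewrite Jscal, Tscal, ip_scal_l, ip_scal_r, Cconj_conj. ring.
  - intros f1. apply Rle_trans with (1 := Bd f1 g). right; ring.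
  - intros m. apply (proj1 (Ceq_minus _ _)), S1. }
split.
- split; [exact Tplus|split; [exact Tscal|]]. now exists M.
- exists J, (fun f => J (T (J f))). split; [exact HJ|]. split.
  + intros f g. rewrite (conjugation_ip_swap J f (T (J g)) HJ), <- Sym.
    f_equal. symmetry. apply J4.
  + intros f. do 2 f_equal. symmetry. apply J4.
Qed.

Theorem theorem1p1 :
  forall (phi : disk -> disk) (a : disk) (sigma : disk -> C),
    schroder_map phi a ->
    koenigs_eigenfunction phi a sigma ->
    (exists T : H2 -> H2,
       is_composition_operator phi T /\ complex_symmetric H2_inner T)
    <->
    (exists s : nat -> H2,
       is_koenigs_sequence sigma s /\
       complete_sequence H2_inner s /\
       conjugate_orthogonal H2_inner s).
Proof.
intros phi a sigma Hphi Hsig; split.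
- intros [T [HT Hsym]]. now apply (koenigs_of_complex_symmetric phi a sigma T).
- intros [s [Hs [Hcomp Horth]]]. now apply (complex_symmetric_of_koenigs phi a sigma s).
Qed.
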